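(* Let $f\colon M^n(0)\to\mathbb{R}^{2n}$ (respectively, $f\colon M^n(c)\to\mathbb{S}^{2n+1}(c)$) be a Lagrangian (respectively, horizontal) isometric immersion of a Riemannian manifold of constant sectional curvature $0$ (respectively, $c$) and let $\tilde f=\mathcal{R}_{\varphi,\beta,\Omega,P}(f)\colon\tilde M^n(0)\to\mathbb{R}^{2n}$ (respectively, $\tilde f=\mathcal{R}_{\varphi,\beta,\Omega,P}(f)\colon\tilde M^n(c)\to\mathbb{S}^{2n+1}(c)$) be a $P$-transform of $f$ such that $P=P_1\oplus P_2$ with respect to an orthogonal decomposition $V=V_1\oplus V_2$. For $1\le i,j\le2$ define $$\varphi_j=\pi_{V_j}\circ\varphi,\qquad\beta_j=\beta|_{V_j},\qquad\Omega_{ij}=\pi_{V_i}\circ\Omega|_{V_j},$$ where $\pi_{V_j}\colon V\to V_j$ is the orthogonal projection, and for $i\neq j$ $$\bar\varphi_i=\varphi_i-\Omega_{ij}\Omega_{jj}^{-1}\varphi_j,\quad\bar\beta_i=\mathcal{P}_j\bigl(\beta_i-\beta_j(\Omega_{jj}^{-1})^t\Omega_{ij}^t\bigr),\quad\bar\Omega_{ii}=\Omega_{ii}-\Omega_{ij}\Omega_{jj}^{-1}\Omega_{ji},$$ where $\mathcal{P}_j=I-\mathcal{G}_j\Omega_{jj}^{-1}\mathcal{G}_j^t$ and $\mathcal{G}_j=F_*\omega_j^t+i_*\beta_j+\tilde cF\varphi_j^t$, $\omega_j=d\varphi_j$, with $\tilde c=0$ (respectively, $\tilde c=c$). Then $(\varphi_j,\beta_j,\Omega_{jj},P_j)$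 defines a $P_j$-transform $f_j$ of $f$ for $1\le j\le2$, $(\bar\varphi_i,\bar\beta_i,\bar\Omega_{ii},P_i)$ defines a $P_i$-transform $f_{ij}$ of $f_j$ for $1\le i\neq j\le2$, and $$\mathcal{R}_{\varphi,\beta,\Omega}(f)=\mathcal{R}_{\bar\varphi_i,\bar\beta_i,\bar\Omega_{ii}}\bigl(\mathcal{R}_{\varphi_j,\beta_j,\Omega_{jj}}(f)\bigr).$$ If, in addition, $f(M^n(0))\subset\mathbb{S}^{2n-1}$ and $\tilde f$ is a $P^*$-transform of $f$ (in the Lagrangian case), then $f_j$ is a $P_j^*$-transform of $f$ and $f_{ji}$ is a $P_j^*$-transform of $f_i$ for $1\le i\neq j\le2$.
   Context: Lagrangian case: the ambient space is $\mathbb{R}^{2n}\cong\mathbb{C}^n$ with complex structure $J$, $\tilde c=0$, $i$ is the identity and $F=f$. $f\colon M^n\to\mathbb{C}^n$ is Lagrangian if $J$ carries each tangent space of $M^n$ onto the corresponding normal space. $\mathbb{S}^{2n-1}\subset\mathbb{R}^{2n}$ is the unit sphere. Horizontal case: the ambient space is $\mathbb{S}^{2n+1}(c)=\{z\in\mathbb{C}^{n+1}:|z|^2=1/c\}$, $c>0$, $\tilde c=c$, $i$ is its inclusion in $\mathbb{C}^{n+1}$ and $F=i\circ f$. $\tilde J$ is multiplication by the imaginary unit on $\mathbb{C}^{n+1}$, $\phi$ its projection onto the tangent bundle of $\mathbb{S}^{2n+1}(c)$; $f$ is horizontal if $\xi_f=\sqrt{c}\,\tilde Jf$ is everywhere normal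 to $f$. In both cases $N_fM$, $\nabla^\perp$, $\alpha$, $A_\xi$ are the normal bundle, normal connection, second fundamental form and shape operators of $f$; superscript $t$ denotes transpose; normal vectors are identified with their images under $i_*$ when $\mathcal{P}_j$ is applied. Vectorial Ribaucour transform. Let $V$ be a (finite-dimensional) Euclidean vector space, identified with the trivial bundle $M\times V$ with its flat connection; $V^*\otimes V$ is identified with the endomorphisms of $V$. Let $\varphi\colon M\to V$ be smooth, $\omega=d\varphi$, $\langle\omega^t(v),X\rangle=\langle v,\omega(X)\rangle$, $\varphi^t(v)=\langle\varphi,v\rangle$, and let $\beta\in\Gamma(V^*\otimes N_fM)$ satisfy $\alpha(X,\omega^t(v))+(\nabla_X\beta)v=0$ (with $(\nabla_X\beta)v=\nabla^\perp_X(\beta(v))-\beta(\nabla_Xv)$) and $[\Phi_u,\Phi_v]=0$ for all $X,u,v$, where $\Phi_vX=\Phi(X)(v)=(\nabla_X\omega^t)v-A_{\beta(v)}X+\tilde c\,\varphi^t(v)X$. Put $\mathcal{G}=F_*\omega^t+i_*\beta+\tilde cF\varphi^t$ and let $\Omega\in\Gamma(V^*\otimes V)$ be everywhere invertible with $d\Omega=\mathcal{G}^td\mathcal{G}$ and $\Omega+\Omega^t=\mathcal{G}^t\mathcal{G}$. The vectorial Ribaucour transform $\tilde f=\mathcal{R}_{\varphi,\beta,\Omega}(f)$ is defined by $i\circ\tilde f=F-\mathcal{G}\Omega^{-1}\varphi$ on the set $\tilde M^n$ of its regular points, with the induced metric. $P$-transform. $\tilde f=\mathcal{R}_{\varphi,\beta,\Omega}(f)$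 is a $P$-transform of $f$, written $\mathcal{R}_{\varphi,\beta,\Omega,P}(f)$, if $P\in V^*\otimes V$ satisfies $\sigma(P)\cap(-\sigma(P))=\emptyset$ ($\sigma(P)$ the set of complex eigenvalues of $P$) and, with $T=-P^t-(P^t)^{-1}$, $\Omega^tP+P^t\Omega^t+T\rho=0$, where: in the Lagrangian case ($f\colon M^n(0)\to\mathbb{R}^{2n}$ Lagrangian) $\beta=Jf_*\omega^tP$ and $\rho=P^t\omega\omega^tP$; in the horizontal case ($f\colon M^n(c)\to\mathbb{S}^{2n+1}(c)$ horizontal) $\beta=(\phi f_*\omega^t+\sqrt{c}\,\xi_f\varphi^t)P$ and $\rho=P^t\omega\omega^tP+cP^t\varphi\varphi^tP$. $P^*$-transform. If $f\colon M^n(0)\to\mathbb{R}^{2n}$ is Lagrangian with $f(M^n(0))\subset\mathbb{S}^{2n-1}$, there are locally principal coordinates $u_1,\ldots,u_n$ and positive functions $v_1,\ldots,v_n$ with $ds^2=\sum_jv_j^2du_j^2$ and $\alpha(\partial_i,\partial_j)=\delta_{ij}Jf_*\partial_i$. A $P$-transform $\mathcal{R}_{\varphi,\beta,\Omega,P}(f)$ (on an open set with such coordinates) is a $P^*$-transform if $\varphi+\sum_{i=1}^nv_iP^t\gamma_i=0$, where $\gamma_i=v_i^{-1}\omega(\partial_i)$. Here this definition is also applied to the transforms $f_i$, with respect to the same coordinates $u_1,\ldots,u_n$ and with $v_l$ and $\gamma_l$ replaced by the corresponding functions for $f_i$, so that the condition on a transform of $f_i$ with data $\bar\varphi_j$ and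 endomorphism $P_j$ is $\bar\varphi_j+P_j^t\,d\bar\varphi_j\bigl(\sum_l\partial_l\bigr)=0$. *)

(* Defs.v *)
From HB Require Import structures.
From mathcomp Require Import all_boot all_order all_algebra.
From mathcomp Require Import complex.
From mathcomp Require Import all_classical all_reals all_analysis.

Set Implicit Arguments.
Unset Strict Implicit.
Unset Printing Implicit Defensive.

Import Order.TTheory GRing.Theory Num.Theory numFieldNormedType.Exports.

Local Open Scope classical_set_scope.
Local Open Scope ring_scope.

Section SmoothMaps.
Context {R : realType} {n m k : nat}.

(* C^oo on D (meant for D open): all iterated directional derivatives are
   differentiable at every point of D. *)
Definition smooth_map (D : set 'cV[R]_n) (h : 'cV[R]_n -> 'M[R]_(m, k)) : Prop :=
  forall (s : seq 'cV[R]_n) (x : 'cV[R]_n), D x ->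
    differentiable (foldr (fun v h' => (fun y => 'D_v h' y)) h s) x.

End SmoothMaps.

(* A chart of an n-dimensional topological manifold; cmap and cinv are total
   functions, relevant only on cdom and on cimg = cmap @` cdom. *)
Record chart (R : realType) (n : nat) (T : topologicalType) := Chart {
  cdom : set T;
  cmap : T -> 'cV[R]_n;
  cinv : 'cV[R]_n -> T;
  cdom_open : open cdom;
  cimg_open : open (cmap @` cdom);
  cmapK : forall p, cdom p -> cinv (cmap p) = p;
  cmap_continuous : forall p, cdom p -> {for p, continuous cmap};
  cinv_continuous : forall x, (cmap @` cdom) x -> {for x, continuous cinv}
}.

Definition compatible_charts (R : realType) (n : nat) (T : topologicalType)
    (c d : chart R n T) : Prop :=
  smooth_map (cmap c @` (cdom c `&` cdom d)) (cmap d \o cinv c) /\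
  smooth_map (cmap d @` (cdom c `&` cdom d)) (cmap c \o cinv d).

(* The atlas is the family (chart_at p)_p.  The tangent space at p is 'cV[R]_n,
   a vector being given by its components in chart_at p. *)
Record manifold (R : realType) (n : nat) := Manifold {
  carrier :> topologicalType;
  manifold_hausdorff : hausdorff_space carrier;
  manifold_second_countable : @second_countable carrier;
  chart_at : carrier -> chart R n carrier;
  chart_at_dom : forall p, cdom (chart_at p) p;
  chart_at_compatible : forall p q,
    compatible_charts (chart_at p) (chart_at q)
}.

Section Calculus.
Context {R : realType} {n : nat} {M : manifold R n}.
Implicit Types (c : chart R n M) (p : M) (W : set M).

Definition smooth_chart c : Prop :=
  forall p, compatible_charts (chart_at p) c.

Definition smooth_on {m k : nat} W (h : M -> 'M[R]_(m, k)) : Prop :=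
  forall c, smooth_chart c -> smooth_map (cmap c @` (W `&` cdom c)) (h \o cinv c).

Definition basis_vec (i : 'I_n) : 'cV[R]_n := delta_mx i 0.

(* dh_p(X), for the tangent vector X = \sum_i X_i d/dx_i in the chart c. *)
Definition Dc {m k : nat} c (h : M -> 'M[R]_(m, k)) p (X : 'cV[R]_n)
  : 'M[R]_(m, k) := 'D_X (h \o cinv c) (cmap c p).

Definition Jac {m : nat} c (h : M -> 'cV[R]_m) p : 'M[R]_(m, n) :=
  \matrix_(a < m, i < n) Dc c h p (basis_vec i) a 0.

(* The differential at p as a linear map on the tangent space at p. *)
Definition diffl {m : nat} (h : M -> 'cV[R]_m) p : 'M[R]_(m, n) :=
  Jac (chart_at p) h p.

Definition dot {m : nat} (u v : 'cV[R]_m) : R := (u^T *m v) 0 0.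

Section Metric.
(* g p is the matrix of the metric on the tangent space at p, i.e. in the
   coordinates of chart_at p; gram c p is its matrix in the chart c. *)
Variable g : M -> 'M[R]_n.

Definition gram c p : 'M[R]_n :=
  let A := Jac c (cmap (chart_at p)) p in A^T *m g p *m A.

Definition riemannian_metric W : Prop :=
  (forall p, W p -> (g p)^T = g p /\
     forall X : 'cV[R]_n, X != 0 -> 0 < dot X (g p *m X)) /\
  (forall c, smooth_chart c ->
     smooth_map (cmap c @` (W `&` cdom c)) (gram c \o cinv c)).

Definition christoffel c p (l i j : 'I_n) : R :=
  2^-1 * \sum_(a < n) invmx (gram c p) l a *
    (Dc c (gram c) p (basis_vec i) j a + Dc c (gram c) p (basis_vec j) i a
     - Dc c (gram c) p (basis_vec a) i j).

(* nabla_X Y for the Levi-Civita connection, in components in the chart c. *)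
Definition nabla c (X : 'cV[R]_n) (Y : M -> 'cV[R]_n) p : 'cV[R]_n :=
  Dc c Y p X +
  \col_(l < n) \sum_(i < n) \sum_(j < n) christoffel c p l i j * X i 0 * Y p j 0.

(* X, Y, Z have constant components in the chart c, so [X, Y] = 0. *)
Definition curvature c p (X Y Z : 'cV[R]_n) : 'cV[R]_n :=
  nabla c X (fun q => nabla c Y (fun=> Z) q) p -
  nabla c Y (fun q => nabla c X (fun=> Z) q) p.

Definition gdot c p (X Y : 'cV[R]_n) : R := dot X (gram c p *m Y).

Definition area2 c p (X Y : 'cV[R]_n) : R :=
  gdot c p X X * gdot c p Y Y - gdot c p X Y ^+ 2.

Definition sectional_curvature c p (X Y : 'cV[R]_n) : R :=
  gdot c p (curvature c p X Y Y) X / area2 c p X Y.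

Definition constant_curvature W (kappa : R) : Prop :=
  forall c, smooth_chart c -> forall p, W p -> cdom c p ->
  forall X Y : 'cV[R]_n, area2 c p X Y != 0 ->
    sectional_curvature c p X Y = kappa.

End Metric.

Definition induced_metric {m : nat} (F : M -> 'cV[R]_m) (p : M) : 'M[R]_n :=
  (diffl F p)^T *m diffl F p.

Definition isometric_immersion {m : nat} W (g : M -> 'M[R]_n)
    (F : M -> 'cV[R]_m) : Prop :=
  smooth_on W F /\ forall p, W p -> induced_metric F p = g p.

Definition regular_points {m : nat} W (F : M -> 'cV[R]_m) : set M :=
  W `&` [set p | \rank (diffl F p) = n].

End Calculus.

(* The two cases: f Lagrangian in R^2n = C^n, or f horizontal in the sphere
   S^{2n+1}(c) of C^{n+1}. *)
Inductive setting (R : realType) := Lagrangian | Horizontal (c : R).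
Arguments Lagrangian {R}.

Definition curv {R : realType} (S : setting R) : R :=
  match S with Lagrangian => 0 | Horizontal c => c end.

Definition cdim {R : realType} (n : nat) (S : setting R) : nat :=
  match S with Lagrangian => n | Horizontal _ => n.+1 end.

(* Multiplication by the imaginary unit of C^m, where x + i y in C^m is
   col_mx x y. *)
Definition Jmx (R : realType) (m : nat) : 'M[R]_(m + m) :=
  block_mx 0 (- 1%:M) 1%:M 0.
Arguments Jmx {R m}.

Notation ambient R n S := 'cV[R]_(cdim n S + cdim n S).

(* The data (phi, beta, Omega) of a transform, the Euclidean space V being
   R^k (in an orthonormal basis) and V^* (x) W being identified with
   matrices with k columns. *)
Record ribdata (R : realType) (T : Type) (N k : nat) := RibData {
  rphi : T -> 'cV[R]_k;
  rbeta : T -> 'M[R]_(N, k);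
  rOmega : T -> 'M[R]_k
}.

Section Submanifold.
(* F is the immersion viewed in C^n (Lagrangian case) or C^{n+1} (horizontal
   case), with metric g; W is the open set on which it is considered. *)
Context {R : realType} {n : nat} {M : manifold R n}.
Variables (S : setting R) (W : set M) (g : M -> 'M[R]_n).
Variable F : M -> ambient R n S.

(* Normal vectors of f: in the horizontal case, also tangent to the sphere. *)
Definition is_normal (p : M) (xi : ambient R n S) : Prop :=
  (diffl F p)^T *m xi = 0 /\
  match S with Lagrangian => True | Horizontal _ => dot (F p) xi = 0 end.

Definition normal_part (p : M) (w : ambient R n S) : ambient R n S :=
  w - diffl F p *m invmx (g p) *m (diffl F p)^T *m w
    - (curv S * dot (F p) w) *: F p.

(* Second fundamental form, normal connection and shape operators; X and Y are
   tangent vectors given in the chart c. *)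
Definition sff (c : chart R n M) (p : M) (X Y : 'cV[R]_n) : ambient R n S :=
  normal_part p (Dc c (fun q => Jac c F q *m Y) p X).

Definition nabla_perp (c : chart R n M) (X : 'cV[R]_n)
    (xi : M -> ambient R n S) (p : M) : ambient R n S :=
  normal_part p (Dc c xi p X).

Definition shape (c : chart R n M) (p : M) (xi : ambient R n S) (X : 'cV[R]_n)
  : 'cV[R]_n :=
  invmx (gram g c p) *m \col_(j < n) dot (sff c p X (basis_vec j)) xi.

(* In the horizontal case, xi_f = sqrt c J F. *)
Definition lagrangian_or_horizontal : Prop :=
  match S with
  | Lagrangian => forall p, W p -> forall xi : ambient R n S,
      is_normal p xi <-> exists X : 'cV[R]_n, xi = Jmx *m (diffl F p *m X)
  | Horizontal c => 0 < c /\ forall p, W p ->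
      dot (F p) (F p) = c^-1 /\
      is_normal p (Num.sqrt c *: (Jmx *m F p))
  end.

(* f : W -> C^n is a Lagrangian isometric immersion and W is flat, resp.
   f : W -> S^{2n+1}(c) is a horizontal isometric immersion and W has constant
   curvature c. *)
Definition admissible_immersion : Prop :=
  [/\ open W, riemannian_metric g W, constant_curvature g W (curv S),
      isometric_immersion W g F & lagrangian_or_horizontal].

Section Data.
Context {k : nat}.
Variable d : ribdata R M (cdim n S + cdim n S) k.

(* The components in the chart c of the vectors omega^t(v), for omega = d phi. *)
Definition omega_t (c : chart R n M) (p : M) : 'M[R]_(n, k) :=
  invmx (gram g c p) *m (Jac c (rphi d) p)^T.

Definition F_omega_t (p : M) : 'M[R]_(cdim n S + cdim n S, k) :=
  diffl F p *m invmx (g p) *m (diffl (rphi d) p)^T.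

Definition omega_omega_t (p : M) : 'M[R]_k :=
  diffl (rphi d) p *m invmx (g p) *m (diffl (rphi d) p)^T.

(* Vectors v of V are extended as constant sections, so that
   (nabla_X s) v = nabla_X (s v) for sections s of V^* (x) E. *)
Definition Phi (c : chart R n M) (v : 'cV[R]_k) (p : M) (X : 'cV[R]_n)
  : 'cV[R]_n :=
  nabla g c X (fun q => omega_t c q *m v) p
  - shape c p (rbeta d p *m v) X
  + (curv S * dot (rphi d p) v) *: X.

Definition calG (p : M) : 'M[R]_(cdim n S + cdim n S, k) :=
  F_omega_t p + rbeta d p + curv S *: (F p *m (rphi d p)^T).

Definition calP (p : M) : 'M[R]_(cdim n S + cdim n S) :=
  1%:M - calG p *m invmx (rOmega d p) *m (calG p)^T.

Definition ribaucour_conditions : Prop :=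
  [/\ smooth_on W (rphi d), smooth_on W (rbeta d) & smooth_on W (rOmega d)] /\
  (forall p, W p -> forall v : 'cV[R]_k, is_normal p (rbeta d p *m v)) /\
  (forall c, smooth_chart c -> forall p, W p -> cdom c p ->
   forall (X : 'cV[R]_n) (u v : 'cV[R]_k),
     sff c p X (omega_t c p *m v)
       + nabla_perp c X (fun q => rbeta d q *m v) p = 0 /\
     Phi c u p (Phi c v p X) = Phi c v p (Phi c u p X)) /\
  (forall p, W p -> rOmega d p \in unitmx) /\
  (forall c, smooth_chart c -> forall p, W p -> cdom c p ->
   forall X : 'cV[R]_n,
     Dc c (rOmega d) p X = (calG p)^T *m Dc c calG p X) /\
  (forall p, W p -> rOmega d p + (rOmega d p)^T = (calG p)^T *m calG p).

(* i o ~f; the transform itself is its restriction to the regular points. *)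
Definition ribaucour (p : M) : ambient R n S :=
  F p - calG p *m invmx (rOmega d p) *m rphi d p.

Definition spectrum_condition (P : 'M[R]_k) : Prop :=
  let PC := map_mx (real_complex R) P in
  forall z : R[i], ~ (eigenvalue PC z /\ eigenvalue PC (- z)).

Definition beta_condition (P : 'M[R]_k) (p : M) : Prop :=
  match S with
  | Lagrangian => rbeta d p = Jmx *m F_omega_t p *m P
  | Horizontal c =>
      let xi_f := Num.sqrt c *: (Jmx *m F p) in
      (* multiplication by i followed by the projection onto the tangent
         space of the sphere at F p *)
      let phi_str := Jmx - c *: (F p *m (F p)^T *m Jmx) in
      rbeta d p =
        (phi_str *m F_omega_t p + Num.sqrt c *: (xi_f *m (rphi d p)^T)) *m P
  end.

Definition P_rho (P : 'M[R]_k) (p : M) : 'M[R]_k :=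
  P^T *m omega_omega_t p *m P
  + curv S *: (P^T *m rphi d p *m (rphi d p)^T *m P).

(* (phi, beta, Omega) defines a P-transform of f on W. *)
Definition P_transform (P : 'M[R]_k) : Prop :=
  [/\ admissible_immersion,
      ribaucour_conditions,
      spectrum_condition P,
      (forall p, W p -> beta_condition P p) &
      forall p, W p ->
        (rOmega d p)^T *m P + P^T *m (rOmega d p)^T
        + (- P^T - invmx P^T) *m P_rho P p = 0].

End Data.
End Submanifold.

(* u is a system of principal coordinates on W: ds^2 = \sum_i v_i^2 du_i^2 with
   v_i > 0, and alpha(d_i, d_j) = delta_ij J F_* d_i. *)
Definition principal_coordinates {R : realType} {n : nat} {M : manifold R n}
    (S : setting R) (W : set M) (g : M -> 'M[R]_n) (F : M -> ambient R n S)
    (u : chart R n M) (v : 'I_n -> M -> R) : Prop :=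
  [/\ smooth_chart u, W `<=` cdom u &
   forall p, W p -> forall i j : 'I_n,
     [/\ 0 < v i p,
         gram g u p i j = (v i p) ^+ 2 *+ (i == j) &
         sff g F u p (basis_vec i) (basis_vec j)
           = (Jmx *m (Jac u F p *m basis_vec i)) *+ (i == j)]].

(* P^*-transforms, on an open set W with principal coordinates u (used for
   S = Lagrangian only). *)
Definition P_star_transform {R : realType} {n : nat} {M : manifold R n}
    (S : setting R) (W : set M) (g : M -> 'M[R]_n) (F : M -> ambient R n S)
    {k : nat} (d : ribdata R M (cdim n S + cdim n S) k) (P : 'M[R]_k)
    (u : chart R n M) : Prop :=
  [/\ P_transform W g F d P,
      (forall p, W p -> dot (F p) (F p) = 1) &
      exists v : 'I_n -> M -> R,
        principal_coordinates W g F u v /\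
        forall p, W p ->
          let gamma i := (v i p)^-1 *: Dc u (rphi d) p (basis_vec i) in
          rphi d p + \sum_(i < n) v i p *: (P^T *m gamma i) = 0].

Section Decomposition.
(* V = V_0 (+) V_1: the columns of E j form an orthonormal basis of V_j, which
   identifies V_j with R^(kd j); the inclusion of V_j in V is E j and the
   orthogonal projection of V onto V_j is (E j)^T. *)
Context {R : realType} {k : nat} {kd : 'I_2 -> nat}.
Variable E : forall j : 'I_2, 'M[R]_(k, kd j).

Definition orthogonal_decomposition : Prop :=
  [/\ forall j, (E j)^T *m E j = 1%:M,
      forall i j, i != j -> (E i)^T *m E j = 0 &
      \sum_(j < 2) E j *m (E j)^T = 1%:M].

Definition direct_sum_endo (Pd : forall j : 'I_2, 'M[R]_(kd j)) : 'M[R]_k :=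
  \sum_(j < 2) E j *m Pd j *m (E j)^T.

Context {n : nat} {M : manifold R n}.
Variables (S : setting R) (g : M -> 'M[R]_n) (F : M -> ambient R n S).
Variable d : ribdata R M (cdim n S + cdim n S) k.

Definition Omega_block (i j : 'I_2) (p : M) : 'M[R]_(kd i, kd j) :=
  (E i)^T *m rOmega d p *m E j.

Definition sub_data (j : 'I_2) : ribdata R M (cdim n S + cdim n S) (kd j) :=
  RibData (fun p => (E j)^T *m rphi d p)
          (fun p => rbeta d p *m E j)
          (Omega_block j j).

Definition bar_data (i j : 'I_2) : ribdata R M (cdim n S + cdim n S) (kd i) :=
  let di := sub_data i in
  let dj := sub_data j in
  RibData
    (fun p => rphi di p
       - Omega_block i j p *m invmx (Omega_block j j p) *m rphi dj p)
    (fun p => calP g F dj p *m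
       (rbeta di p
        - rbeta dj p *m (invmx (Omega_block j j p))^T *m (Omega_block i j p)^T))
    (fun p => Omega_block i i p
       - Omega_block i j p *m invmx (Omega_block j j p) *m Omega_block j i p).

End Decomposition.

(* Main.v *)
Require Import Defs.
From HB Require Import structures.
From mathcomp Require Import all_boot all_order all_algebra.
From mathcomp Require Import complex.
From mathcomp Require Import ring lra.
From mathcomp Require Import all_classical all_reals all_analysis.
Import Order.TTheory GRing.Theory Num.Theory numFieldNormedType.Exports.
Local Open Scope classical_set_scope.
Local Open Scope ring_scope.

Set Implicit Arguments.
Unset Strict Implicit.
Unset Printing Implicit Defensive.

(** Both cases are treated together, with [k = curv S] equal to [0] or [c].  In a
   chart let [T] be the Jacobian of the immersion and put
   [H = T omega^t + k F phi^t] ([cH]).  The tangent space, together with the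
   position vector when [k] is not zero, spans a Lagrangian subspace of the complex
   ambient space ([tproj_lagrangian]) that contains the columns of [H], and in
   both cases the form required of [beta] is [beta = J H P] ([beta_conditionE]).
   Hence [calG = H + J H P], and the algebraic conditions on a P-transform become
   two relations between [H], [P] and [Omega] at a point ([linking]).

   Pointwise, [Omega + Omega^t = calG^t calG] makes
   [calP = I - calG Omega^-1 calG^t] orthogonal ([CP_orth]); the second relation
   gives [(P + P^-1)^t Omega = Omega^t (P + P^-1)] ([P'Om]) and a twisted
   commutation of [calP] with [J] ([JCP]), so that [calP] maps the Lagrangian
   subspace to a Lagrangian one.  The diagonal blocks of [Omega] are invertible
   ([block_unit]): on the kernel of such a block [Omega] intertwines [P] with
   [- P^t], and the spectra of these two are disjoint.

   Infinitesimally, let [a_X] be the shape operator in the direction [J F_* X]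
   ([aop]).  By the equation of Gauss the curvature is constant, equal to [k],
   if and only if all [a_X] commute ([aop_commute], [sectional_of_commute]).  The
   condition of Codazzi type forces
   [d calG (X) = - F_* a_X omega^t (P + P^-1)] ([P_dG]).  Therefore the transform has the
   Jacobian [calP F_* (1 + a_z)] for a vector field [z] ([jac_transform]), it
   has the same operators [a_X] as the immersion ([aop_transform]), and so
   it is again Lagrangian, respectively horizontal, of the same constant curvature
   ([transform_admissible]).  Conversely, data with [beta = J H P], the
   relations [linking] and a derivative of [calG] of this shape are the data of a
   P-transform ([P_transform_intro]).

   For the decomposition of [V], restriction to [V_j] restricts [H], [calG] and the relations
   ([sub_transform]).  Block elimination in [Omega] provides injections [Y] and [Y'] of
   [V_i] into [V] such that the second data have [phi = Y^t phi],
   [H = calP_j H Y] and [calG = calP_j calG Y = calG Y'] ([cH_bar],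
   [cG_bar]), and the criterion applies to them ([bar_transform]).  The two transforms
   compose to the given one because
   [Omega^-1 = E_j Omega_jj^-1 E_j^t + Y' (bar Omega)^-1 Y^t] ([bar_compose]).

   In principal coordinates [a_X] is diagonal with the components of [X] as
   entries, so that it is the identity for the sum [e] of the coordinate fields.  A
   Lagrangian immersion into the unit sphere is then [F = - J F_* e]
   ([position_ones]), the condition on a P-star-transform says that
   [calG^t F = phi] ([cG_position]), and
   this passes to the second data, since [f_j = calP_j F] gives
   [(calG Y')^t f_j = Y^t calG^t F = Y^t phi] ([cG_bar_position]). *)

(** * Calculus of matrix-valued maps *)

Section MatrixCalculus.
Context {R : realType} {V : normedModType R}.

Lemma near_eq_differentiable (W : normedModType R) (f h : V -> W) (x : V) :
  (\forall y \near x, f y = h y) -> differentiable f x -> differentiable h x.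
Proof.
move=> fh df; have -> : h = f + (h - f) by rewrite addrC subrK.
apply: differentiableD => //.
have k0 : \forall y \near x, (h - f) y = 0.
  by apply: filterS fh => y fy; rewrite !fctE fy subrr.
move: (h - f) k0 => {fh df}k k0.
have kx : k x = 0 by exact: (nbhs_singleton k0).
have kE : k \o shift x = cst (k x) + (\0 : V -> W) +o_ 0 id.
  apply/eqaddoP => _/posnumP[e].
  have k0' : \forall y \near (0 : V), k (y + x) = 0.
    rewrite (near_shift x) /=; apply: filterS k0 => y ky.
    by rewrite /= sub0r addrNK.
  apply: filterS k0' => y ky; rewrite !fctE /= ky kx.
  by rewrite !addr0 subrr normr0 mulr_ge0.
have dk : 'd k x = \0 :> (V -> W) by apply: diff_unique => //; exact: cst_continuous.
apply/diff_locallyP; rewrite dk; split => //; exact: cst_continuous.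
Qed.

Lemma differentiable_mxP (m n : nat) (f : V -> 'M[R]_(m, n)) x :
  differentiable f x <-> forall i j, differentiable (fun y => f y i j) x.
Proof.
split=> [df i j|df].
  exact: (differentiable_comp df (differentiable_coord (f x) i j)).
have -> : f = \sum_(i < m) \sum_(j < n) (fun y => f y i j *: delta_mx i j).
  apply/funext => y; rewrite [LHS]matrix_sum_delta fct_sumE.
  by apply: eq_bigr => i _; rewrite fct_sumE.
by apply: differentiable_sum => i; apply: differentiable_sum => j;
   apply: differentiableZl.
Qed.

Lemma derive_mxE (m n : nat) (f : V -> 'M[R]_(m, n)) x v i j :
  differentiable f x -> ('D_v f x) i j = 'D_v (fun y => f y i j) x.
Proof. by move=> df; rewrite derive_mx ?mxE //; exact: diff_derivable. Qed.

Lemma differentiable_mulmx (m n p : nat) (f : V -> 'M[R]_(m, n))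
    (h : V -> 'M[R]_(n, p)) x :
  differentiable f x -> differentiable h x ->
  differentiable (fun y => f y *m h y) x.
Proof.
move=> /differentiable_mxP df /differentiable_mxP dh.
apply/differentiable_mxP => i j.
have -> : (fun y => (f y *m h y) i j)
    = \sum_(k < n) ((fun y => f y i k) * (fun y => h y k j)).
  by apply/funext => y; rewrite mxE fct_sumE.
by apply: differentiable_sum => k; exact: differentiableM.
Qed.

Lemma derive_mulmx (m n p : nat) (f : V -> 'M[R]_(m, n))
    (h : V -> 'M[R]_(n, p)) x v :
  differentiable f x -> differentiable h x ->
  'D_v (fun y => f y *m h y) x = 'D_v f x *m h x + f x *m 'D_v h x.
Proof.
move=> df dh; apply/matrixP => i j.
rewrite derive_mxE; last exact: differentiable_mulmx.
have -> : (fun y => (f y *m h y) i j)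
    = \sum_(k < n) ((fun y => f y i k) * (fun y => h y k j)).
  by apply/funext => y; rewrite mxE fct_sumE.
have /differentiable_mxP df' := df; have /differentiable_mxP dh' := dh.
rewrite derive_sum; last first.
  by move=> k; apply: diff_derivable; exact: differentiableM.
rewrite !mxE -big_split /=; apply: eq_bigr => k _.
rewrite deriveM; [|exact: diff_derivable..].
rewrite !derive_mxE // addrC; congr (_ + _).
by rewrite /GRing.scale /= mulrC.
Qed.

Lemma differentiable_trmx (m n : nat) (f : V -> 'M[R]_(m, n)) x :
  differentiable f x -> differentiable (fun y => (f y)^T) x.
Proof.
move=> /differentiable_mxP df; apply/differentiable_mxP => i j.
by under eq_fun do rewrite mxE.
Qed.

Lemma derive_trmx (m n : nat) (f : V -> 'M[R]_(m, n)) x v :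
  differentiable f x -> 'D_v (fun y => (f y)^T) x = ('D_v f x)^T.
Proof.
move=> df; apply/matrixP => i j.
rewrite derive_mxE ?mxE; last exact: differentiable_trmx.
by rewrite derive_mxE //; under eq_fun do rewrite mxE.
Qed.

Lemma differentiable_prod (I : Type) (r : seq I) (f : I -> V -> R) x :
  (forall i, differentiable (f i) x) ->
  differentiable (fun y => \prod_(i <- r) f i y) x.
Proof.
move=> df; elim: r => [|i r IH].
  by under eq_fun do rewrite big_nil; exact: differentiable_cst.
under eq_fun do rewrite big_cons.
exact: (differentiableM (df i) IH).
Qed.

Lemma differentiable_suml (I : Type) (r : seq I) (W : normedModType R)
    (f : I -> V -> W) x :
  (forall i, differentiable (f i) x) ->
  differentiable (fun y => \sum_(i <- r) f i y) x.
Proof.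
move=> df; elim: r => [|i r IH].
  by under eq_fun do rewrite big_nil; exact: differentiable_cst.
under eq_fun do rewrite big_cons.
exact: (differentiableD (df i) IH).
Qed.

Lemma differentiable_det (n : nat) (f : V -> 'M[R]_n) x :
  differentiable f x -> differentiable (fun y => \det (f y)) x.
Proof.
move=> /differentiable_mxP df; rewrite /determinant.
apply: differentiable_suml => s.
exact: (differentiableM (differentiable_cst _ _)
  (differentiable_prod _ (fun i => df i (perm.fun_of_perm s i)))).
Qed.

Lemma near_unitmx (n : nat) (f : V -> 'M[R]_n) x :
  differentiable f x -> f x \in unitmx -> \forall y \near x, f y \in unitmx.
Proof.
move=> df fx.
have c := differentiable_continuous (differentiable_det df).
have : \det (f x) != 0 by rewrite -unitfE -unitmxE.
move=> d0; have nb : nbhs (\det (f x)) [set z : R | z != 0].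
  by apply: open_nbhs_nbhs; split => //; exact: open_neq.
have cn : \forall y \near x, \det (f y) != 0 by exact: (c _ nb).
by apply: filterS cn => y /=; rewrite unitmxE unitfE.
Qed.

Lemma differentiable_invmx (n : nat) (f : V -> 'M[R]_n) x :
  differentiable f x -> f x \in unitmx ->
  differentiable (fun y => invmx (f y)) x.
Proof.
move=> df fx.
apply: (@near_eq_differentiable _ (fun y => (\det (f y))^-1 *: \adj (f y))).
  have := near_unitmx df fx; apply: filterS => y fy; by rewrite /invmx fy.
apply/differentiable_mxP => i j.
have -> : (fun y => ((\det (f y))^-1 *: \adj (f y)) i j) =
    (fun y => (\det (f y))^-1) *
    ((fun=> (-1) ^+ (j + i)) * (fun y => \det (row' j (col' i (f y))))).
  by apply/funext => y; rewrite !mxE /= /cofactor !fctE.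
apply: differentiableM.
  apply: (@differentiableV _ _ (fun y => \det (f y))).
    exact: differentiable_det.
  by rewrite -unitfE -unitmxE.
apply: differentiableM; first exact: differentiable_cst.
apply: differentiable_det; apply/differentiable_mxP => a b.
under eq_fun do rewrite !mxE.
by have /differentiable_mxP := df.
Qed.

Lemma derive_invmx (n : nat) (f : V -> 'M[R]_n) x v :
  differentiable f x -> f x \in unitmx ->
  'D_v (fun y => invmx (f y)) x
    = - (invmx (f x) *m 'D_v f x *m invmx (f x)).
Proof.
move=> df fx; have di := differentiable_invmx df fx.
have : 'D_v (fun y => f y *m invmx (f y)) x = 'D_v (cst (1%:M : 'M[R]_n)) x.
  apply: near_eq_derive; have := near_unitmx df fx; apply: filterS => y fy.
  by rewrite mulmxV.
rewrite derive_cst derive_mulmx // => /(congr1 (mulmx (invmx (f x)))).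
rewrite mulmxDr mulmx0 mulKmx // addrC => /eqP.
by rewrite addr_eq0 mulmxA => /eqP.
Qed.

End MatrixCalculus.

Section Schwarz.
Context {R : realType} {V : normedModType R}.

Lemma is_derive_line (f : V -> R) (a v : V) (s : R) :
  differentiable f (a + s *: v) ->
  is_derive s 1 (fun t => f (a + t *: v)) ('D_v f (a + s *: v)).
Proof.
move=> df.
have E : (fun h : R => h^-1 *: (f (a + (h *: 1 + s) *: v) - f (a + s *: v)))
       = (fun h : R => h^-1 *: (f (h *: v + (a + s *: v)) - f (a + s *: v))).
  apply/funext => h; congr (_ *: (f _ - _)).
  by rewrite scalerDl -[h *: 1]/(h * 1) mulr1 addrCA.
have d : derivable f (a + s *: v) v by exact: diff_derivable.
by apply: DeriveDef; rewrite /derivable /derive E.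
Qed.

Lemma MVT_line (f : V -> R) (a v : V) (t : R) : 0 < t ->
  (forall s, 0 <= s <= t -> differentiable f (a + s *: v)) ->
  exists2 s, 0 <= s <= t & f (a + t *: v) - f a = t * 'D_v f (a + s *: v).
Proof.
move=> t0 df.
have itvW s : s \in `]0, t[ -> 0 <= s <= t.
  by rewrite in_itv /= => /andP[? ?]; apply/andP; split; exact: ltW.
have dphi s : 0 <= s <= t ->
    is_derive s 1 (fun s => f (a + s *: v)) ('D_v f (a + s *: v)).
  by move=> hs; apply/is_derive_line/df.
move: ('D_v f) dphi => Df dphi.
have cphi : {within `[0, t], continuous (fun s => f (a + s *: v))}.
  apply: derivable_within_continuous => s; rewrite in_itv /= => hs.
  by have := dphi s hs; case.
have [s sI E] := MVT t0 (fun s hs => dphi s (itvW s hs)) cphi.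
by exists s; [exact: itvW|move: E; rewrite scale0r addr0 subr0 mulrC].
Qed.

(** One application of the mean value theorem to the increment of [f] along
   [v], as a function of the position along [u], and one to the derivative
   that this produces. *)
Lemma second_difference (f : V -> R) (x u v : V) (t : R) : 0 < t ->
  (forall s1 s2, 0 <= s1 <= t -> 0 <= s2 <= t ->
     differentiable f (x + s1 *: u + s2 *: v) /\
     differentiable ('D_u f) (x + s1 *: u + s2 *: v)) ->
  exists s1 s2, [/\ 0 <= s1 <= t, 0 <= s2 <= t &
   f (x + t *: u + t *: v) - f (x + t *: u) - (f (x + t *: v) - f x)
     = t * t * 'D_v ('D_u f) (x + s1 *: u + s2 *: v)].
Proof.
move=> t0 df.
have t00 : 0 <= t <= t by rewrite lexx ltW.
have z00 : 0 <= (0 : R) <= t by rewrite lexx ltW.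
pose phi y := f (y + t *: v) - f y.
have dft s : 0 <= s <= t -> differentiable (fun y => f (y + t *: v)) (x + s *: u).
  move=> hs; apply: (@differentiable_comp _ _ _ _ (fun y => y + t *: v) f).
    by apply: differentiableD => //; exact: differentiable_cst.
  by have [] := df _ _ hs t00.
have df0 s : 0 <= s <= t -> differentiable f (x + s *: u).
  by move=> hs; have [] := df _ _ hs z00; rewrite scale0r addr0.
have Dshift y : 'D_u (fun z => f (z + t *: v)) y = 'D_u f (y + t *: v).
  rewrite /derive.
  have -> : (fun h : R => h^-1 *: (f (h *: u + y + t *: v) - f (y + t *: v)))
    = (fun h : R => h^-1 *: (f (h *: u + (y + t *: v)) - f (y + t *: v))) by
    apply/funext => h; rewrite addrA.
  by [].
have dphi s : 0 <= s <= t -> differentiable phi (x + s *: u).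
  by move=> hs; apply: differentiableB; [exact: dft|exact: df0].
have [s1 hs1 E1] := MVT_line t0 dphi.
have E1' : 'D_u phi (x + s1 *: u)
    = 'D_u f (x + s1 *: u + t *: v) - 'D_u f (x + s1 *: u).
  rewrite deriveB; [|apply: diff_derivable..]; [|exact: dft|exact: df0].
  by rewrite Dshift.
have df' s : 0 <= s <= t -> differentiable ('D_u f) (x + s1 *: u + s *: v).
  by move=> hs; have [] := df _ _ hs1 hs.
have [s2 hs2 E2] := MVT_line t0 df'.
exists s1, s2; split => //.
rewrite -mulrA -E2 -E1' -E1 /phi; ring.
Qed.

Lemma near_dist_lt (h : V -> R) (x : V) (e : R) : 0 < e ->
  differentiable h x -> \forall y \near x, `|h x - h y| < e.
Proof.
move=> e0 /differentiable_continuous ch.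
by move/cvgrPdist_lt : ch; exact.
Qed.

(** Both mixed derivatives are limits of the same symmetric second
   difference; it is enough that they are continuous at the point. *)
Lemma derive_comm_real (f : V -> R) (x u v : V) :
  (\forall y \near x, differentiable f y) ->
  (\forall y \near x, differentiable ('D_u f) y) ->
  (\forall y \near x, differentiable ('D_v f) y) ->
  differentiable ('D_v ('D_u f)) x -> differentiable ('D_u ('D_v f)) x ->
  'D_v ('D_u f) x = 'D_u ('D_v f) x.
Proof.
move=> nf nu nv duv dvu.
apply/eqP; rewrite -subr_eq0 -normr_le0; apply/ler_addgt0Pr => e e0; rewrite add0r.
have e2 : 0 < e / 2 by rewrite divr_gt0.
have na := near_dist_lt e2 duv.
have nb := near_dist_lt e2 dvu.
have hI := filterI nf (filterI nu (filterI nv (filterI na nb))).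
have : \forall y \near x, [/\ differentiable f y, differentiable ('D_u f) y,
   differentiable ('D_v f) y, `|'D_v ('D_u f) x - 'D_v ('D_u f) y| < e / 2
   & `|'D_u ('D_v f) x - 'D_u ('D_v f) y| < e / 2].
  have F := nbhs_filter x.
  apply: filterS (hI F F F F) => y [a [b [c [b1 b2]]]].
  exact (And5 a b c b1 b2).
move=> /nbhs_ballP[r /= r0 hr].
(* the parallelogram spanned by [t u] and [t v] at [x] lies in the ball *)
pose t := r / (`|u| + `|v| + 1).
have D0 : 0 < `|u| + `|v| + 1 by rewrite ltr_wpDl // addr_ge0.
have t0 : 0 < t by rewrite divr_gt0.
have inb s1 s2 : 0 <= s1 <= t -> 0 <= s2 <= t -> ball x r (x + s1 *: u + s2 *: v).
  move=> /andP[a1 a2] /andP[b1 b2].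
  rewrite -ball_normE /= -addrA opprD addNKr normrN.
  apply: (le_lt_trans (ler_normD _ _)); rewrite !normrZ !ger0_norm //.
  have : s1 * `|u| + s2 * `|v| <= t * `|u| + t * `|v|.
    by apply: lerD; apply: ler_wpM2r.
  move=> /le_lt_trans; apply.
  have -> : r = t * (`|u| + `|v| + 1) by rewrite /t divfK // gt_eqF.
  by rewrite -mulrDr ltr_pM2l // ltrDl.
have inb' s1 s2 : 0 <= s1 <= t -> 0 <= s2 <= t -> ball x r (x + s2 *: v + s1 *: u).
  by move=> h1 h2; rewrite addrAC; exact: inb.
have [s1 [s2 [h1 h2 E1]]] : exists s1 s2, [/\ 0 <= s1 <= t, 0 <= s2 <= t &
   f (x + t *: u + t *: v) - f (x + t *: u) - (f (x + t *: v) - f x)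
     = t * t * 'D_v ('D_u f) (x + s1 *: u + s2 *: v)].
  apply: second_difference => // a b ha hb.
  by have [] := hr _ (inb a b ha hb).
have [s3 [s4 [h3 h4 E2]]] : exists s1 s2, [/\ 0 <= s1 <= t, 0 <= s2 <= t &
   f (x + t *: v + t *: u) - f (x + t *: v) - (f (x + t *: u) - f x)
     = t * t * 'D_u ('D_v f) (x + s1 *: v + s2 *: u)].
  apply: second_difference => // a b ha hb.
  by have [] := hr _ (inb' b a hb ha).
have [_ _ _ A _] := hr _ (inb _ _ h1 h2).
have [_ _ _ _ B] := hr _ (inb' _ _ h4 h3).
have sym_diff : f (x + t *: u + t *: v) - f (x + t *: u) - (f (x + t *: v) - f x)
  = f (x + t *: v + t *: u) - f (x + t *: v) - (f (x + t *: u) - f x).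
  rewrite (addrAC x); ring.
have key (a b a' b' : R) : `|a - a'| < e / 2 -> `|b - b'| < e / 2 ->
    t * t * a' = t * t * b' -> `|a - b| <= e.
  move=> Ha Hb Hab.
  have tt : t * t != 0 by rewrite mulf_neq0 // gt_eqF.
  rewrite -(mulfI tt Hab) in Hb.
  rewrite [e]splitr; apply/ltW/(le_lt_trans _ (ltrD Ha Hb)).
  rewrite [X in _ <= _ + X]distrC.
  by apply: le_trans (ler_normD _ _); rewrite addrA subrK.
exact: (key _ _ _ _ A B (etrans (esym E1) (etrans sym_diff E2))).
Qed.

End Schwarz.

Section SmoothClosure.
Context {R : realType} {n : nat}.
Local Notation V := 'cV[R]_n.
Variable D : set V.
Hypothesis oD : open D.

(** Finite orders of differentiability, in the recursive form on which the
   closure properties of smooth maps are proved by induction. *)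
Fixpoint Ck (k : nat) {m p : nat} (h : V -> 'M[R]_(m, p)) : Prop :=
  (forall x, D x -> differentiable h x) /\
  if k is k'.+1 then forall v, Ck k' ('D_v h) else True.

Lemma CkP (m p : nat) (h : V -> 'M[R]_(m, p)) :
  smooth_map D h <-> forall k, Ck k h.
Proof.
split=> [sh k|Ch s].
  elim: k h sh => [|k IH] h sh /=; (split; [exact: (sh [::])|]) => // v.
  by apply: IH => s x Dx; have := sh (rcons s v) x Dx; rewrite -cats1 foldr_cat.
elim/last_ind: s h Ch => [|s v IH] h Ch x Dx /=.
  by have [+ _] := Ch 0%N; exact.
rewrite -cats1 foldr_cat /=; apply: IH => // k.
by have [_] := Ch k.+1; exact.
Qed.

Lemma near_open x : D x -> \forall y \near x, D y.
Proof. by move=> Dx; exact: open_nbhs_nbhs. Qed.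

Lemma derive_eq_on (m p : nat) (h1 h2 : V -> 'M[R]_(m, p)) :
  (forall x, D x -> h1 x = h2 x) ->
  forall v x, D x -> 'D_v h1 x = 'D_v h2 x.
Proof.
move=> e v x Dx; apply: near_eq_derive.
by apply: filterS (near_open Dx) => y; exact: e.
Qed.

Lemma Ck_ext k (m p : nat) (h1 h2 : V -> 'M[R]_(m, p)) :
  (forall x, D x -> h1 x = h2 x) -> Ck k h1 -> Ck k h2.
Proof.
elim: k h1 h2 => [|k IH] h1 h2 e /= [d1 C1]; (split; [move=> x Dx|]) => //.
- apply: near_eq_differentiable (d1 _ Dx).
  by apply: filterS (near_open Dx) => y; exact: e.
- apply: near_eq_differentiable (d1 _ Dx).
  by apply: filterS (near_open Dx) => y; exact: e.
- by move=> v; apply: IH (C1 v) => x Dx; exact: derive_eq_on.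
Qed.

Lemma CkW k (m p : nat) (h : V -> 'M[R]_(m, p)) : Ck k.+1 h -> Ck k h.
Proof.
elim: k h => [|k IH] h [d C]; split => // v.
by apply: IH; exact: C.
Qed.

Lemma Ck_cst k (m p : nat) (a : 'M[R]_(m, p)) : Ck k (fun=> a).
Proof.
elim: k a => [|k IH] a; (split; [by move=> x _; exact: differentiable_cst|]) => // v.
by apply: Ck_ext (IH 0) => x _; rewrite derive_cst.
Qed.

Lemma Ck_add k (m p : nat) (h1 h2 : V -> 'M[R]_(m, p)) :
  Ck k h1 -> Ck k h2 -> Ck k (fun x => h1 x + h2 x).
Proof.
elim: k h1 h2 => [|k IH] h1 h2 [d1 C1] [d2 C2]; (split;
  [by move=> x Dx; exact: (differentiableD (d1 x Dx) (d2 x Dx))|]) => // v.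
apply: Ck_ext (IH _ _ (C1 v) (C2 v)) => x Dx.
by rewrite deriveD //; apply: diff_derivable; [exact: d1|exact: d2].
Qed.

Lemma Ck_mulmx k (m p q : nat) (h1 : V -> 'M[R]_(m, p)) (h2 : V -> 'M[R]_(p, q)) :
  Ck k h1 -> Ck k h2 -> Ck k (fun x => h1 x *m h2 x).
Proof.
elim: k h1 h2 => [|k IH] h1 h2 C1 C2.
  have [d1 _] := C1; have [d2 _] := C2.
  by split => // x Dx; apply: differentiable_mulmx; [exact: d1|exact: d2].
have [d1 C1'] := C1; have [d2 C2'] := C2; split => [x Dx|v].
  by apply: differentiable_mulmx; [exact: d1|exact: d2].
apply: Ck_ext (Ck_add (IH _ _ (C1' v) (CkW C2)) (IH _ _ (CkW C1) (C2' v))) => x Dx.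
by rewrite derive_mulmx //; [exact: d1|exact: d2].
Qed.

Lemma Ck_trmx k (m p : nat) (h : V -> 'M[R]_(m, p)) :
  Ck k h -> Ck k (fun x => (h x)^T).
Proof.
elim: k h => [|k IH] h [d C]; (split;
  [by move=> x Dx; exact/differentiable_trmx/d|]) => // v.
by apply: Ck_ext (IH _ (C v)) => x Dx; rewrite derive_trmx //; exact: d.
Qed.

Lemma Ck_opp k (m p : nat) (h : V -> 'M[R]_(m, p)) :
  Ck k h -> Ck k (fun x => - h x).
Proof.
move=> C; apply: Ck_ext (Ck_mulmx (Ck_cst k (- 1%:M)) C) => x _.
by rewrite mulNmx mul1mx.
Qed.

(** By induction on the order, since the derivative of the inverse is
   [- h^-1 h' h^-1]. *)
Lemma Ck_invmx k (m : nat) (h : V -> 'M[R]_m) :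
  (forall x, D x -> h x \in unitmx) -> Ck k h -> Ck k (fun x => invmx (h x)).
Proof.
move=> uh; elim: k => [|k IH] C; have [d C'] := C; (split;
  [by move=> x Dx; apply: differentiable_invmx; [exact: d|exact: uh]|]) => // v.
have I := IH (CkW C).
apply: Ck_ext (Ck_opp (Ck_mulmx (Ck_mulmx I (C' v)) I)) => x Dx.
by rewrite derive_invmx; [|exact: d|exact: uh].
Qed.

Lemma Ck_mx k (m p : nat) (h : V -> 'M[R]_(m, p)) :
  (forall i j, Ck k (fun x => (h x i j)%:M : 'M[R]_1)) -> Ck k h.
Proof.
move=> C.
have CS (I : Type) (r : seq I) (f : I -> V -> 'M[R]_(m, p)) :
    (forall i, Ck k (f i)) -> Ck k (fun x => \sum_(i <- r) f i x).
  move=> Cf; elim: r => [|i r IH].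
    by apply: Ck_ext (Ck_cst k 0) => x _; rewrite big_nil.
  by apply: Ck_ext (Ck_add (Cf i) IH) => x _; rewrite big_cons.
apply: (@Ck_ext _ _ _ (fun x => \sum_i \sum_j
   (delta_mx i 0 *m (h x i j)%:M *m delta_mx 0 j))).
  move=> x _; rewrite [RHS]matrix_sum_delta; apply: eq_bigr => i _.
  apply: eq_bigr => j _; rewrite mul_mx_scalar -scalemxAl mul_delta_mx //.
apply: (CS _ _ _) => i; apply: (CS _ _ _) => j.
exact: (Ck_mulmx (Ck_mulmx (Ck_cst _ _) (C i j)) (Ck_cst _ _)).
Qed.

End SmoothClosure.

Lemma smooth_map_sub {R : realType} {n m p : nat} (D D' : set 'cV[R]_n)
    (h : 'cV[R]_n -> 'M[R]_(m, p)) :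
  D' `<=` D -> smooth_map D h -> smooth_map D' h.
Proof. by move=> sD sh s x /sD; exact: sh. Qed.

(** Young's theorem. *)
Lemma derive_comm {R : realType} {n m p : nat} (D : set 'cV[R]_n)
    (h : 'cV[R]_n -> 'M[R]_(m, p)) (u v x : 'cV[R]_n) :
  open D -> smooth_map D h -> D x -> 'D_v ('D_u h) x = 'D_u ('D_v h) x.
Proof.
move=> oD sh Dx.
have d0 y : D y -> differentiable h y by exact: (sh [::]).
have d1 w y : D y -> differentiable ('D_w h) y by exact: (sh [:: w]).
have d2 w z y : D y -> differentiable ('D_w ('D_z h)) y by exact: (sh [:: w; z]).
apply/matrixP => i j.
have e1 w y : D y -> 'D_w h y i j = 'D_w (fun y => h y i j) y.
  by move=> Dy; rewrite derive_mxE //; exact: d0.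
have nD := near_open oD Dx.
have f1 w y : D y -> differentiable ('D_w (fun z => h z i j)) y.
  move=> Dy; apply: (@near_eq_differentiable _ _ _ (fun y => 'D_w h y i j)).
    by apply: filterS (near_open oD Dy) => z; exact: e1.
  by have /differentiable_mxP := d1 w y Dy; exact.
have e2 w z y : D y -> 'D_w ('D_z h) y i j = 'D_w ('D_z (fun y => h y i j)) y.
  move=> Dy; rewrite derive_mxE; last exact: d1.
  apply: near_eq_derive.
  by apply: filterS (near_open oD Dy) => t; exact: e1.
have f2 w z y : D y -> differentiable ('D_w ('D_z (fun y => h y i j))) y.
  move=> Dy; apply: (@near_eq_differentiable _ _ _ (fun y => 'D_w ('D_z h) y i j)).
    by apply: filterS (near_open oD Dy) => t; exact: e2.
  by have /differentiable_mxP := d2 w z y Dy; exact.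
have [a1 a2 a3] : [/\ \forall y \near x, differentiable (fun y => h y i j) y,
  \forall y \near x, differentiable ('D_u (fun y => h y i j)) y
  & \forall y \near x, differentiable ('D_v (fun y => h y i j)) y].
  split; [|by apply: filterS nD => y; exact: f1..].
  by apply: filterS nD => y Dy; have /differentiable_mxP := d0 y Dy; exact.
exact: (etrans (e2 v u x Dx) (etrans (derive_comm_real a1 a2 a3
  (f2 v u x Dx) (f2 u v x Dx)) (esym (e2 u v x Dx)))).
Qed.

(** * Calculus in charts *)

(** Sealed copies of the derivative, Jacobian and Gram matrix in a chart, so
   that comparing two of them does not unfold them to limits. *)
HB.lock Definition dd {R : realType} {n : nat} {M : manifold R n} {m k : nat}
    (c : chart R n M) (h : M -> 'M[R]_(m, k)) (p : M) (X : 'cV[R]_n) : 'M[R]_(m, k) :=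
  Dc c h p X.

HB.lock Definition jac {R : realType} {n : nat} {M : manifold R n} {m : nat}
    (c : chart R n M) (h : M -> 'cV[R]_m) (p : M) : 'M[R]_(m, n) := Jac c h p.

HB.lock Definition gm {R : realType} {n : nat} {M : manifold R n}
    (g : M -> 'M[R]_n) (c : chart R n M) (p : M) : 'M[R]_n := gram g c p.

Lemma ddE {R : realType} {n : nat} {M : manifold R n} {m k : nat}
    (c : chart R n M) (h : M -> 'M[R]_(m, k)) p X : Dc c h p X = dd c h p X.
Proof. by rewrite dd.unlock. Qed.

Lemma jacE {R : realType} {n : nat} {M : manifold R n} {m : nat}
    (c : chart R n M) (h : M -> 'cV[R]_m) p : Jac c h p = jac c h p.
Proof. by rewrite jac.unlock. Qed.

Lemma jac_entry {R : realType} {n : nat} {M : manifold R n} {m : nat}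
    (c : chart R n M) (h : M -> 'cV[R]_m) p a i :
  jac c h p a i = dd c h p (basis_vec i) a 0.
Proof. by rewrite jac.unlock dd.unlock mxE. Qed.

Lemma gmE {R : realType} {n : nat} {M : manifold R n}
    (g : M -> 'M[R]_n) (c : chart R n M) p : gram g c p = gm g c p.
Proof. by rewrite gm.unlock. Qed.

Section Charts.
Context {R : realType} {n : nat} {M : manifold R n}.
Implicit Types (c d : chart R n M) (p q : M) (W : set M) (X Y : 'cV[R]_n).

Definition img c W := cmap c @` (W `&` cdom c).

(** Statements on an open set of the manifold become statements near a point
   of the chart. *)
Lemma near_chart c W p : open W -> W p -> cdom c p ->
  \forall y \near cmap c p,
    [/\ cmap c (cinv c y) = y, W (cinv c y) & cdom c (cinv c y)].
Proof.
move=> oW Wp cp.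
have n1 : \forall y \near cmap c p, (cmap c @` cdom c) y.
  by apply: open_nbhs_nbhs; split; [exact: cimg_open|exists p].
have n2 : \forall y \near cmap c p, W (cinv c y).
  have ci := @cinv_continuous _ _ _ c (cmap c p) (ex_intro2 _ _ p cp erefl).
  by apply: ci; rewrite cmapK //; apply: open_nbhs_nbhs.
apply: filterS2 n1 n2 => y [q cq <-] Wq.
by move: Wq; rewrite cmapK.
Qed.

Lemma open_img c W : open W -> open (img c W).
Proof.
move=> oW; rewrite openE => x [p [Wp cp] <-].
have := near_chart oW Wp cp; apply: filterS => y [e Wy cy].
by exists (cinv c y).
Qed.

Lemma img_mem c W p : W p -> cdom c p -> img c W (cmap c p).
Proof. by move=> Wp cp; exists p. Qed.

Lemma imgP c W y : img c W y ->
  [/\ cmap c (cinv c y) = y, W (cinv c y) & cdom c (cinv c y)].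
Proof. by case=> p [Wp cp] <-; rewrite cmapK. Qed.

Definition diffat {m k : nat} c (h : M -> 'M[R]_(m, k)) p : Prop :=
  differentiable (h \o cinv c) (cmap c p).

Definition smooth_in {m k : nat} c W (h : M -> 'M[R]_(m, k)) : Prop :=
  smooth_map (img c W) (h \o cinv c).

Lemma smooth_in_diffat {m k : nat} c W (h : M -> 'M[R]_(m, k)) p :
  smooth_in c W h -> W p -> cdom c p -> diffat c h p.
Proof. by move=> sh Wp cp; apply: (sh [::]); exact: img_mem. Qed.

Section Rules.
Context {m k l : nat}.
Implicit Types h : M -> 'M[R]_(m, k).

Lemma dd_ext c W h1 h2 p X : open W -> W p -> cdom c p ->
  (forall q, W q -> cdom c q -> h1 q = h2 q) -> dd c h1 p X = dd c h2 p X.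
Proof.
move=> oW Wp cp e; rewrite dd.unlock; apply: near_eq_derive.
by apply: filterS (near_chart oW Wp cp) => y [_ Wy cy]; exact: e.
Qed.

Lemma diffat_ext c W h1 h2 p : open W -> W p -> cdom c p ->
  (forall q, W q -> cdom c q -> h1 q = h2 q) -> diffat c h1 p -> diffat c h2 p.
Proof.
move=> oW Wp cp e; apply: near_eq_differentiable.
by apply: filterS (near_chart oW Wp cp) => y [_ Wy cy]; exact: e.
Qed.

Lemma dd_cst c (a : 'M[R]_(m, k)) p X : dd c (fun=> a) p X = 0.
Proof. by rewrite dd.unlock; exact: derive_cst. Qed.

Lemma diffat_cst c (a : 'M[R]_(m, k)) p : diffat c (fun=> a) p.
Proof. exact: differentiable_cst. Qed.

Lemma diffat_add c h1 h2 p : diffat c h1 p -> diffat c h2 p ->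
  diffat c (fun q => h1 q + h2 q) p.
Proof. exact: differentiableD. Qed.

Lemma dd_add c h1 h2 p X : diffat c h1 p -> diffat c h2 p ->
  dd c (fun q => h1 q + h2 q) p X = dd c h1 p X + dd c h2 p X.
Proof. by move=> d1 d2; rewrite dd.unlock; apply: deriveD; exact: diff_derivable. Qed.

Lemma diffat_opp c h p : diffat c h p -> diffat c (fun q => - h q) p.
Proof. exact: differentiableN. Qed.

Lemma dd_opp c h p X : diffat c h p -> dd c (fun q => - h q) p X = - dd c h p X.
Proof. by move=> d; rewrite dd.unlock; apply: deriveN; exact: diff_derivable. Qed.

Lemma diffat_scale c (a : R) h p : diffat c h p -> diffat c (fun q => a *: h q) p.
Proof. exact: differentiableZ. Qed.

Lemma dd_scale c (a : R) h p X : diffat c h p ->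
  dd c (fun q => a *: h q) p X = a *: dd c h p X.
Proof. by move=> d; rewrite dd.unlock; apply: deriveZ; exact: diff_derivable. Qed.

Lemma diffat_trmx c h p : diffat c h p -> diffat c (fun q => (h q)^T) p.
Proof. exact: differentiable_trmx. Qed.

Lemma dd_trmx c h p X : diffat c h p -> dd c (fun q => (h q)^T) p X = (dd c h p X)^T.
Proof. by rewrite dd.unlock; exact: derive_trmx. Qed.

Lemma diffat_mulmx c h (h' : M -> 'M[R]_(k, l)) p :
  diffat c h p -> diffat c h' p -> diffat c (fun q => h q *m h' q) p.
Proof. exact: differentiable_mulmx. Qed.

Lemma dd_mulmx c h (h' : M -> 'M[R]_(k, l)) p X : cdom c p ->
  diffat c h p -> diffat c h' p ->
  dd c (fun q => h q *m h' q) p X = dd c h p X *m h' p + h p *m dd c h' p X.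
Proof.
move=> cp d d'; have := derive_mulmx X d d'.
by rewrite /= cmapK // !dd.unlock.
Qed.

Lemma smooth_in_ext c W h1 h2 : open W ->
  (forall q, W q -> cdom c q -> h1 q = h2 q) ->
  smooth_in c W h1 -> smooth_in c W h2.
Proof.
move=> oW e /CkP C; apply/CkP => i; apply: Ck_ext (C i); first exact: open_img.
by move=> y /imgP[_ Wy cy]; exact: e.
Qed.

Lemma smooth_in_sub c W W' h : W' `<=` W -> smooth_in c W h -> smooth_in c W' h.
Proof.
by move=> sW; apply: smooth_map_sub => y [p [Wp cp] <-]; exists p => //; split => //; exact: sW.
Qed.

Lemma smooth_in_cst c W (a : 'M[R]_(m, k)) : open W -> smooth_in c W (fun=> a).
Proof. by move=> oW; apply/CkP => i; exact: (Ck_cst (open_img oW)). Qed.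

Lemma smooth_in_add c W h1 h2 : open W -> smooth_in c W h1 -> smooth_in c W h2 ->
  smooth_in c W (fun q => h1 q + h2 q).
Proof.
by move=> oW /CkP C1 /CkP C2; apply/CkP => i; apply: (Ck_add (open_img oW) (C1 i) (C2 i)).
Qed.

Lemma smooth_in_trmx c W h : open W -> smooth_in c W h -> smooth_in c W (fun q => (h q)^T).
Proof. by move=> oW /CkP C; apply/CkP => i; exact: (Ck_trmx (open_img oW) (C i)). Qed.

Lemma smooth_in_mulmx c W h (h' : M -> 'M[R]_(k, l)) : open W ->
  smooth_in c W h -> smooth_in c W h' -> smooth_in c W (fun q => h q *m h' q).
Proof.
by move=> oW /CkP C1 /CkP C2; apply/CkP => i; exact: (Ck_mulmx (open_img oW) (C1 i) (C2 i)).
Qed.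

Lemma smooth_in_opp c W h : open W -> smooth_in c W h -> smooth_in c W (fun q => - h q).
Proof. by move=> oW /CkP C; apply/CkP => i; exact: (Ck_opp (open_img oW) (C i)). Qed.

Lemma smooth_in_scale c W (a : R) h : open W ->
  smooth_in c W h -> smooth_in c W (fun q => a *: h q).
Proof.
move=> oW /CkP C; apply/CkP => i.
apply: (@Ck_ext _ _ _ (open_img oW) _ _ _ (fun y => a%:M *m (h \o cinv c) y)).
  by move=> y _; rewrite mul_scalar_mx.
exact: (Ck_mulmx (open_img oW) (Ck_cst (open_img oW) _ _) (C i)).
Qed.

Lemma smooth_in_dd c W h X : open W -> smooth_in c W h ->
  smooth_in c W (fun q => dd c h q X).
Proof.
move=> oW /CkP C; apply/CkP => i; have [_ /(_ X) CX] := C i.+1.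
apply: Ck_ext CX; first exact: open_img.
by move=> y /imgP[e _ _]; rewrite dd.unlock /= /Dc e.
Qed.

Lemma dd_comm c W h p X Y : open W -> smooth_in c W h -> W p -> cdom c p ->
  dd c (fun q => dd c h q X) p Y = dd c (fun q => dd c h q Y) p X.
Proof.
move=> oW sh Wp cp; have oI := @open_img c W oW; have Ip := img_mem Wp cp.
have E Z T : dd c (fun q => dd c h q Z) p T = 'D_T ('D_Z (h \o cinv c)) (cmap c p).
  rewrite !dd.unlock; apply: near_eq_derive.
  by apply: filterS (near_open oI Ip) => y /imgP[e _ _]; rewrite /= /Dc e.
by rewrite (E X Y) (E Y X); exact: (derive_comm X Y oI sh Ip).
Qed.

Lemma dd_lin c h p X : diffat c h p ->
  dd c h p X = \sum_(i < n) X i 0 *: dd c h p (basis_vec i).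
Proof.
move=> dh; rewrite !dd.unlock /Dc deriveE //.
have XE : X = \sum_(i < n) X i 0 *: basis_vec i.
  rewrite [LHS]matrix_sum_delta; apply: eq_bigr => i _; by rewrite big_ord1.
rewrite [in LHS]XE linear_sum; apply: eq_bigr => i _.
by rewrite linearZ /= deriveE.
Qed.

End Rules.

Lemma dd_invmx {m : nat} c (h : M -> 'M[R]_m) p X : cdom c p ->
  diffat c h p -> h p \in unitmx ->
  dd c (fun q => invmx (h q)) p X = - (invmx (h p) *m dd c h p X *m invmx (h p)).
Proof.
move=> cp d u; have := @derive_invmx _ _ _ (h \o cinv c) (cmap c p) X d.
by rewrite /= cmapK // !dd.unlock; apply.
Qed.

Lemma diffat_invmx {m : nat} c (h : M -> 'M[R]_m) p : cdom c p ->
  diffat c h p -> h p \in unitmx -> diffat c (fun q => invmx (h q)) p.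
Proof. by move=> cp d u; apply: differentiable_invmx => //=; rewrite cmapK. Qed.

Lemma smooth_in_invmx {m : nat} c W (h : M -> 'M[R]_m) : open W ->
  (forall q, W q -> h q \in unitmx) ->
  smooth_in c W h -> smooth_in c W (fun q => invmx (h q)).
Proof.
move=> oW u /CkP C; apply/CkP => i; apply: (Ck_invmx (open_img oW) _ (C i)).
by move=> y /imgP[_ Wy _]; exact: u.
Qed.

Lemma dd_jac {m : nat} c (h : M -> 'cV[R]_m) p X : diffat c h p ->
  dd c h p X = jac c h p *m X.
Proof.
move=> dh; rewrite dd_lin //; apply/matrixP => a b.
rewrite [RHS]mxE summxE; apply: eq_bigr => i _.
by rewrite jac_entry mxE (ord1 b) mulrC.
Qed.

Lemma smooth_in_jac {m : nat} c W (h : M -> 'cV[R]_m) : open W ->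
  smooth_in c W h -> smooth_in c W (jac c h).
Proof.
move=> oW sh; apply/CkP => k.
apply: (@Ck_mx _ _ _ (open_img oW)) => a i.
have /CkP/(_ k) C : smooth_in c W (fun q => delta_mx 0 a *m dd c h q (basis_vec i) : 'M[R]_1).
  by apply: smooth_in_mulmx => //; [exact: smooth_in_cst|exact: smooth_in_dd].
apply: Ck_ext C; first exact: open_img.
by move=> y _; rewrite /= -rowE [LHS]mx11_scalar mxE jac_entry.
Qed.

(** The symmetry of the second derivative. *)
Lemma jac_dd_comm {m : nat} c W (h : M -> 'cV[R]_m) p X Y : open W ->
  smooth_in c W h -> W p -> cdom c p ->
  dd c (jac c h) p X *m Y = dd c (jac c h) p Y *m X.
Proof.
move=> oW sh Wp cp.
have E Z T : dd c (jac c h) p Z *m T = dd c (fun q => dd c h q T) p Z.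
  have dJ : diffat c (jac c h) p by apply: smooth_in_diffat (smooth_in_jac oW sh) _ _.
  rewrite (@dd_ext _ _ c W (fun q => dd c h q T) (fun q => jac c h q *m T)) //.
    by rewrite dd_mulmx // ?dd_cst ?mulmx0 ?addr0 //; exact: diffat_cst.
  by move=> q Wq cq; apply: dd_jac; exact: smooth_in_diffat sh _ _.
exact: (etrans (E X Y) (etrans (dd_comm Y X oW sh Wp cp) (esym (E Y X)))).
Qed.

(** The chain rule for a change of chart. *)
Lemma jac_change {m : nat} c d (h : M -> 'cV[R]_m) p :
  compatible_charts d c -> cdom c p -> cdom d p -> diffat d h p ->
  diffat c h p /\ jac c h p = jac d h p *m jac c (cmap d) p.
Proof.
move=> [_ cc] cp dp dh.
have tp : (cmap c @` (cdom d `&` cdom c)) (cmap c p) by exists p.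
have dt : differentiable (cmap d \o cinv c) (cmap c p) by exact: (cc [::]).
have oU : open (cdom d) by exact: cdom_open.
have e : \forall y \near cmap c p,
    ((h \o cinv d) \o (cmap d \o cinv c)) y = (h \o cinv c) y.
  by apply: filterS (near_chart oU dp cp) => y [_ dy _]; rewrite /= cmapK.
have tpE : (cmap d \o cinv c) (cmap c p) = cmap d p by rewrite /= cmapK.
have dh' : differentiable (h \o cinv d) ((cmap d \o cinv c) (cmap c p)) by rewrite tpE.
have dcmp := differentiable_comp dt dh'.
have dch : diffat c h p by apply: near_eq_differentiable dcmp.
split => //; apply/matrixP => a i.
rewrite jac_entry.
have E : dd c h p (basis_vec i) = dd d h p (dd c (cmap d) p (basis_vec i)).
  rewrite !dd.unlock /Dc -(near_eq_derive _ e) deriveE // diff_comp //=.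
  by rewrite [in RHS]deriveE // ?cmapK // -tpE [in RHS]deriveE.
by rewrite E (dd_jac _ dh) !mxE; apply: eq_bigr => j _; rewrite !jac_entry.
Qed.

Lemma compatible_sym c d : compatible_charts c d -> compatible_charts d c.
Proof. by move=> [a b]; split; rewrite setIC. Qed.

Lemma diffat_cmap c p : cdom c p -> diffat c (cmap c) p /\ jac c (cmap c) p = 1%:M.
Proof.
move=> cp.
have e : \forall y \near cmap c p, id y = (cmap c \o cinv c) y.
  by apply: filterS (near_chart openT I cp) => y [].
split; first by apply: near_eq_differentiable e _.
apply/matrixP => a i; rewrite jac_entry dd.unlock /Dc -(near_eq_derive _ e) derive_id.
by rewrite /basis_vec !mxE eqxx andbT.
Qed.

Lemma jac_cmap_unit c d p : compatible_charts c d -> cdom c p -> cdom d p ->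
  jac c (cmap d) p \in unitmx.
Proof.
move=> cc cp dp.
have [_ cd] := compatible_sym cc.
have dt : diffat c (cmap d) p.
  exact: (cd [::] _ (ex_intro2 _ _ p (conj dp cp) erefl)).
have [_ E] := jac_change cc dp cp dt.
have [_ E1] := diffat_cmap dp.
by move: E; rewrite E1 => /esym /mulmx1_unit[].
Qed.

End Charts.

(** * Matrices and the scalar product *)

Lemma addmxE (R : nmodType) m n (A B : 'M[R]_(m, n)) i j : (A + B) i j = A i j + B i j.
Proof. by rewrite mxE. Qed.
Lemma oppmxE (R : zmodType) m n (A : 'M[R]_(m, n)) i j : (- A) i j = - A i j.
Proof. by rewrite mxE. Qed.
Lemma scalemxE (R : pzRingType) m n a (A : 'M[R]_(m, n)) i j : (a *: A) i j = a * A i j.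
Proof. by rewrite mxE. Qed.
Lemma zeromxE (R : nmodType) m n i j : (0 : 'M[R]_(m, n)) i j = 0.
Proof. by rewrite mxE. Qed.

Definition mxlinE := (addmxE, oppmxE, scalemxE, zeromxE).

(** Identities that hold by linearity, the products of matrices being atoms. *)
Ltac mxatoms := repeat match goal with
  |- context [@mulmx ?R ?m ?n ?p ?A ?B] =>
       let X := fresh "X" in set X := (A *m B); clearbody X end.
Ltac mxlin := mxatoms; apply/matrixP => ? ?; rewrite ?mxlinE; ring.

Section DotProduct.
Context {R : realType}.

Lemma dotE m (u v : 'cV[R]_m) : u^T *m v = (dot u v)%:M.
Proof. by rewrite [LHS]mx11_scalar. Qed.

Lemma dotC m (u v : 'cV[R]_m) : dot u v = dot v u.
Proof.
rewrite /dot; have -> : u^T *m v = (v^T *m u)^T by rewrite trmx_mul trmxK.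
by rewrite mxE.
Qed.

Lemma dot_mulmxl m p (A : 'M[R]_(m, p)) u v : dot (A *m u) v = dot u (A^T *m v).
Proof. by rewrite /dot trmx_mul mulmxA. Qed.

Lemma dot_ge0 m (u : 'cV[R]_m) : 0 <= dot u u.
Proof. by rewrite /dot mxE; apply: sumr_ge0 => i _; rewrite mxE -expr2 sqr_ge0. Qed.

Lemma dot_eq0 m (u : 'cV[R]_m) : dot u u = 0 -> u = 0.
Proof.
rewrite /dot mxE => /eqP; rewrite psumr_eq0; last first.
  by move=> i _; rewrite mxE -expr2 sqr_ge0.
move=> /allP h; apply/matrixP => i j; rewrite mxE (ord1 j).
by have := h i (mem_index_enum _); rewrite mxE mulf_eq0 orbb => /eqP.
Qed.

Lemma dot_scale m p (a : R) (u v : 'cV[R]_m) (w : 'cV[R]_p) : (a * dot u v) *: w = a *: (w *m (u^T *m v)).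
Proof. by rewrite dotE mul_mx_scalar scalerA. Qed.

Lemma dot0r m (u : 'cV[R]_m) : dot u 0 = 0.
Proof. by rewrite /dot mulmx0 mxE. Qed.

Lemma dotDr m (u v w : 'cV[R]_m) : dot u (v + w) = dot u v + dot u w.
Proof. by rewrite /dot mulmxDr mxE. Qed.

Lemma dotNr m (u v : 'cV[R]_m) : dot u (- v) = - dot u v.
Proof. by rewrite /dot mulmxN mxE. Qed.

End DotProduct.

(** * The formulas of Gauss and Weingarten *)

Section Frames.
Context {R : realType} {n : nat} {M : manifold R n}.
Variables (S : setting R) (W : set M) (g : M -> 'M[R]_n).
Variable F : M -> ambient R n S.

(** The common part of both cases: when the curvature [curv S] is not zero,
   the position vector is orthogonal to the immersion and has square length
   [(curv S)^-1]. *)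
Definition framed : Prop :=
  [/\ open W, forall c, smooth_chart c -> smooth_in c W F,
   forall p, W p -> (diffl F p)^T *m diffl F p = g p,
   forall p, W p -> g p \in unitmx
   & forall p, W p -> curv S *: ((diffl F p)^T *m F p) = 0 /\
       curv S * (curv S * dot (F p) (F p)) = curv S].

Hypothesis fF : framed.
Local Notation k := (curv S).

Let oW : open W. Proof. by case: fF. Qed.

(** The orthogonal projection onto the sum of the tangent space and, in the
   spherical case, of the line of the position vector. *)
Definition tproj (c : chart R n M) (p : M) : 'M[R]_(cdim n S + cdim n S) :=
  jac c F p *m invmx (gm g c p) *m (jac c F p)^T + k *: (F p *m (F p)^T).

Variable c : chart R n M.
Hypothesis sc : smooth_chart c.

Lemma smooth_frame : smooth_in c W F.
Proof. by case: fF => _ + _ _ _; apply. Qed.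

Lemma smooth_jac : smooth_in c W (jac c F).
Proof. by apply: smooth_in_jac => //; exact: smooth_frame. Qed.

Lemma jac_diffl {m : nat} (h : M -> 'cV[R]_m) p : smooth_on W h -> W p -> cdom c p ->
  jac c h p = diffl h p *m jac c (cmap (chart_at p)) p.
Proof.
move=> sh Wp cp; have dp := chart_at_dom p.
have dh : diffat (chart_at p) h p.
  have sp : smooth_chart (chart_at p) by move=> q; exact: chart_at_compatible.
  by apply: smooth_in_diffat (sh _ sp) _ _.
by have [_ ->] := jac_change (sc p) cp dp dh; rewrite /diffl jacE.
Qed.

Lemma jac_unit p : cdom c p -> jac c (cmap (chart_at p)) p \in unitmx.
Proof.
move=> cp; apply: jac_cmap_unit cp (chart_at_dom p).
exact: compatible_sym.
Qed.

Lemma gram_frame p : W p -> cdom c p -> gm g c p = (jac c F p)^T *m jac c F p.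
Proof.
move=> Wp cp; have [_ sF iF _ _] := fF.
by rewrite gm.unlock /gram jacE (jac_diffl sF Wp cp) trmx_mul -iF // !mulmxA.
Qed.

Lemma gram_unit p : W p -> cdom c p -> gm g c p \in unitmx.
Proof.
move=> Wp cp; have [_ _ _ ug _] := fF.
by rewrite gm.unlock /gram jacE !unitmx_mul unitmx_tr ug // jac_unit.
Qed.

Lemma gram_sym p : W p -> cdom c p -> (gm g c p)^T = gm g c p.
Proof. by move=> Wp cp; rewrite gram_frame // trmx_mul trmxK. Qed.

Lemma invgram_sym p : W p -> cdom c p -> (invmx (gm g c p))^T = invmx (gm g c p).
Proof. by move=> Wp cp; rewrite trmx_inv gram_sym. Qed.

Lemma smooth_gram : smooth_in c W (gm g c).
Proof.
apply: (@smooth_in_ext _ _ _ _ _ c W (fun q => (jac c F q)^T *m jac c F q)) => //.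
  by move=> q Wq cq; rewrite gram_frame.
by apply: smooth_in_mulmx => //; [apply: smooth_in_trmx => //|]; exact: smooth_jac.
Qed.

Lemma smooth_invgram : smooth_in c (W `&` cdom c) (fun q => invmx (gm g c q)).
Proof.
apply: smooth_in_invmx; first by apply: openI => //; exact: cdom_open.
  by move=> q [Wq cq]; exact: gram_unit.
by apply: smooth_in_sub smooth_gram => q [].
Qed.

(** Contractions with the inverse metric do not depend on the chart. *)
Lemma frame_change {m l : nat} (h1 : M -> 'cV[R]_m) (h2 : M -> 'cV[R]_l) p :
  smooth_on W h1 -> smooth_on W h2 -> W p -> cdom c p ->
  diffl h1 p *m invmx (g p) *m (diffl h2 p)^T
    = jac c h1 p *m invmx (gm g c p) *m (jac c h2 p)^T.
Proof.
move=> s1 s2 Wp cp; rewrite (jac_diffl s1 Wp cp) (jac_diffl s2 Wp cp) trmx_mul.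
have [_ _ _ ug _] := fF; have uA := jac_unit cp.
set A := jac c _ p in uA *.
have -> : invmx (gm g c p) = invmx A *m invmx (g p) *m invmx A^T.
  have e : gm g c p *m (invmx A *m invmx (g p) *m invmx A^T) = 1%:M.
    rewrite gm.unlock /gram jacE -/A !mulmxA mulmxK // mulmxK ?ug //.
    by rewrite mulmxV ?unitmx_tr.
  by rewrite -[LHS]mulmx1 -e mulKmx // gram_unit.
by rewrite !mulmxA mulmxK // mulmxKV // unitmx_tr.
Qed.

Lemma position_normal p : W p -> cdom c p -> k *: ((jac c F p)^T *m F p) = 0.
Proof.
move=> Wp cp; have [_ sF _ _ /(_ p Wp)[kF _]] := fF.
by rewrite (jac_diffl sF Wp cp) trmx_mul -mulmxA scalemxAr kF mulmx0.
Qed.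

Lemma normal_partE p (w : ambient R n S) : W p -> cdom c p ->
  normal_part g F p w = w - tproj c p *m w.
Proof.
move=> Wp cp; have [_ sF _ _ _] := fF.
rewrite /normal_part frame_change // dot_scale /tproj mulmxDl opprD addrA.
by rewrite -scalemxAl mulmxA.
Qed.

Lemma tprojT p : W p -> cdom c p -> (tproj c p)^T = tproj c p.
Proof.
move=> Wp cp; rewrite /tproj linearD linearZ /= !trmx_mul !trmxK invgram_sym //.
by rewrite mulmxA.
Qed.

Lemma tproj_jac p : W p -> cdom c p -> tproj c p *m jac c F p = jac c F p.
Proof.
move=> Wp cp; rewrite /tproj mulmxDl -!mulmxA -gram_frame // mulVmx ?gram_unit //.
rewrite mulmx1 -scalemxAl -mulmxA.
have /(congr1 trmx) := position_normal Wp cp.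
rewrite linearZ /= trmx_mul trmxK trmx0 => e.
by rewrite scalemxAr e mulmx0 addr0.
Qed.

Lemma tproj_F p : W p -> cdom c p -> k *: (tproj c p *m F p) = k *: F p.
Proof.
move=> Wp cp; rewrite /tproj mulmxDl scalerDr -!mulmxA.
rewrite scalemxAr scalemxAr position_normal // !mulmx0 add0r.
have [_ _ _ _ /(_ p Wp)[_ kk]] := fF.
rewrite -scalemxAl -mulmxA dotE mul_mx_scalar !scalerA; congr (_ *: _).
by rewrite -[RHS]kk; ring.
Qed.

Lemma diffat_jac p : W p -> cdom c p -> diffat c (jac c F) p.
Proof. by move=> Wp cp; apply: smooth_in_diffat smooth_jac _ _. Qed.

Lemma diffat_F p : W p -> cdom c p -> diffat c F p.
Proof. by move=> Wp cp; apply: smooth_in_diffat smooth_frame _ _. Qed.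

Lemma dd_gram p X : W p -> cdom c p ->
  dd c (gm g c) p X = (dd c (jac c F) p X)^T *m jac c F p
     + (jac c F p)^T *m dd c (jac c F) p X.
Proof.
move=> Wp cp; have dJ := diffat_jac Wp cp.
rewrite (@dd_ext _ _ _ _ _ c W _ (fun q => (jac c F q)^T *m jac c F q)) //.
  by rewrite dd_mulmx ?dd_trmx //; exact: diffat_trmx.
by move=> q Wq cq; rewrite gram_frame.
Qed.

Lemma dd_jac_sym p X Y : W p -> cdom c p ->
  dd c (jac c F) p X *m Y = dd c (jac c F) p Y *m X.
Proof. by move=> Wp cp; apply: jac_dd_comm oW smooth_frame Wp cp. Qed.

(** The Koszul formula: the Christoffel symbols of the first kind of the
   metric induced by [F] are the products of first and second derivatives
   of [F]. *)
Lemma gram_christoffel p (b i j : 'I_n) : W p -> cdom c p ->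
  \sum_(l < n) gm g c p b l * christoffel g c p l i j
    = ((jac c F p)^T *m dd c (jac c F) p (basis_vec i)) b j.
Proof.
move=> Wp cp.
pose K i := (jac c F p)^T *m dd c (jac c F) p (basis_vec i).
have Ksym i' b' j' : K i' b' j' = K j' b' i'.
  have KE i1 b1 j1 : ((jac c F p)^T *m dd c (jac c F) p (basis_vec i1)) b1 j1
      = ((jac c F p)^T *m (dd c (jac c F) p (basis_vec i1) *m basis_vec j1)) b1 0.
    by rewrite mulmxA -colE [RHS]mxE.
  have e := dd_jac_sym (basis_vec i') (basis_vec j') Wp cp.
  apply: etrans (KE i' b' j') (etrans _ (esym (KE j' b' i'))).
  by move: e; move: (dd c _ p _) (dd c _ p _) => A B ->.
have DgE i' x y : dd c (gm g c) p (basis_vec i') x y = K i' y x + K i' x y.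
  rewrite dd_gram // addmxE; congr (_ + _).
  by rewrite -[in LHS](trmxK (jac c F p)) -trmx_mul mxE.
pose C a := dd c (gm g c) p (basis_vec i) j a + dd c (gm g c) p (basis_vec j) i a
     - dd c (gm g c) p (basis_vec a) i j.
have CE : C b = 2 * K i b j.
  by rewrite /C !DgE; clearbody K; rewrite (Ksym j b i) (Ksym b j i) (Ksym b i j); ring.
have -> : \sum_(l < n) gm g c p b l * christoffel g c p l i j
   = 2^-1 * (gm g c p *m (invmx (gm g c p) *m \col_a C a)) b 0.
  rewrite mxE mulr_sumr; apply: eq_bigr => l _.
  have gE : gram g c = gm g c by apply/funext => q; rewrite gmE.
  rewrite /christoffel mulrCA gE; congr (_ * (_ * _)).
  by rewrite [RHS]mxE; apply: eq_bigr => a _; rewrite [in RHS]mxE /C !ddE.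
by rewrite mulKVmx ?gram_unit // mxE CE mulrA mulVf ?mul1r // pnatr_eq0.
Qed.

(** The Levi-Civita connection is the tangential part of the derivative in
   the ambient space. *)
Lemma gram_nabla p X (U : M -> 'cV[R]_n) : W p -> cdom c p -> diffat c U p ->
  gm g c p *m nabla g c X U p
    = (jac c F p)^T *m dd c (fun q => jac c F q *m U q) p X.
Proof.
move=> Wp cp dU; have dJ := diffat_jac Wp cp.
rewrite dd_mulmx // /nabla ddE mulmxDr mulmxDr mulmxA [in RHS]mulmxA -gram_frame //.
rewrite addrC; congr (_ + _).
rewrite (dd_lin X dJ); apply/matrixP => b z; rewrite (ord1 z) mxE.
under eq_bigr => l _ do rewrite [X in _ * X]mxE mulr_sumr.
rewrite exchange_big /= mulmx_sumr mulmx_suml summxE; apply: eq_bigr => i _.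
rewrite -scalemxAr -scalemxAl scalemxE mxE mulr_sumr.
under eq_bigr => l _ do rewrite mulr_sumr.
rewrite exchange_big /=; apply: eq_bigr => j _.
rewrite -gram_christoffel // mulr_suml mulr_sumr; apply: eq_bigr => l _; ring.
Qed.

(** The second fundamental form before linearisation in the arguments: its
   value on [X] is a matrix applied to [Y]. *)
Definition sffm p X := (1%:M - tproj c p) *m dd c (jac c F) p X.

(** The second fundamental form, as the normal part of the derivative of the
   Jacobian. *)
Lemma sffE p X Y : W p -> cdom c p -> sff g F c p X Y = sffm p X *m Y.
Proof.
move=> Wp cp; rewrite /sff normal_partE // /sffm ddE.
rewrite (_ : (fun q => Jac c F q *m Y) = (fun q => jac c F q *m Y)); last first.
  by apply/funext => q; rewrite jacE.
have dJ := diffat_jac Wp cp.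
rewrite dd_mulmx // ?dd_cst ?mulmx0 ?addr0; last exact: diffat_cst.
by rewrite mulmxBl mul1mx mulmxBl mulmxA.
Qed.

Lemma tproj_normal p : W p -> cdom c p -> (jac c F p)^T *m (1%:M - tproj c p) = 0.
Proof.
move=> Wp cp; rewrite mulmxBr mulmx1.
have /(congr1 trmx) := tproj_jac Wp cp; rewrite trmx_mul tprojT // => ->.
by rewrite subrr.
Qed.

Lemma jac_sffm p X : W p -> cdom c p -> (jac c F p)^T *m sffm p X = 0.
Proof. by move=> Wp cp; rewrite /sffm mulmxA tproj_normal // mul0mx. Qed.

Lemma dd_position_normal p X : W p -> cdom c p ->
  k *: ((F p)^T *m dd c (jac c F) p X) = - (k *: (X^T *m gm g c p)).
Proof.
move=> Wp cp; have dJ := diffat_jac Wp cp; have dF := diffat_F Wp cp.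
have : dd c (fun q => k *: ((F q)^T *m jac c F q)) p X = 0.
  rewrite (@dd_ext _ _ _ _ _ c W _ (fun=> 0)) // ?dd_cst // => q Wq cq.
  by rewrite -[LHS]trmxK linearZ /= trmx_mul trmxK position_normal // trmx0.
rewrite dd_scale; last by apply: diffat_mulmx => //; exact: diffat_trmx.
rewrite dd_mulmx //; last exact: diffat_trmx.
rewrite dd_trmx // dd_jac // trmx_mul -mulmxA -gram_frame // scalerDr addrC.
by move/eqP; rewrite addr_eq0 => /eqP.
Qed.

Lemma tproj_split p : jac c F p *m invmx (gm g c p) *m (jac c F p)^T
  = tproj c p - k *: (F p *m (F p)^T).
Proof. by rewrite /tproj addrK. Qed.

(** The Gauss formula for the constant fields [Y] and [Z] of the chart. *)
Lemma gauss_formula q Y Z : W q -> cdom c q ->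
  jac c F q *m nabla g c Y (fun=> Z) q
    = dd c (jac c F) q Y *m Z - sffm q Y *m Z
      + k *: (F q *m (Y^T *m gm g c q *m Z)).
Proof.
move=> Wq cq; have dJ := diffat_jac Wq cq.
have E : nabla g c Y (fun=> Z) q
   = invmx (gm g c q) *m ((jac c F q)^T *m (dd c (jac c F) q Y *m Z)).
  have := gram_nabla Y Wq cq (diffat_cst c Z q).
  rewrite (dd_mulmx Y cq dJ (diffat_cst c Z q)) dd_cst mulmx0 addr0.
  by move=> <-; rewrite mulKmx // gram_unit.
have := dd_position_normal Y Wq cq => /(congr1 (fun A => F q *m A *m Z)) e.
rewrite E.
have -> : jac c F q *m (invmx (gm g c q) *m ((jac c F q)^T *m (dd c (jac c F) q Y *m Z)))
  = (tproj c q - k *: (F q *m (F q)^T)) *m (dd c (jac c F) q Y *m Z).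
  by rewrite -tproj_split; move: (invmx _) => I; rewrite !mulmxA.
rewrite /sffm; move: (gm g c q) (tproj c q) e {E} => G Q e.
rewrite !mulmxA.
move: e; rewrite -scalemxAr -scalemxAl mulmxN mulNmx -scalemxAr -scalemxAl !mulmxA => e.
by rewrite !mulmxBl mul1mx -!scalemxAl e; mxlin.
Qed.

Lemma smooth_sffm X : smooth_in c (W `&` cdom c) (fun q => sffm q X).
Proof.
have oWc : open (W `&` cdom c) by apply: openI => //; exact: cdom_open.
have sW (m l : nat) (h : M -> 'M[R]_(m, l)) : smooth_in c W h -> smooth_in c (W `&` cdom c) h.
  by apply: smooth_in_sub => q [].
have sJ := sW _ _ _ smooth_jac; have sF := sW _ _ _ smooth_frame.
apply: smooth_in_mulmx => //; last exact: smooth_in_dd.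
apply: smooth_in_add => //; first exact: smooth_in_cst.
apply: smooth_in_opp => //; apply: smooth_in_add => //.
  apply: smooth_in_mulmx => //; last exact: smooth_in_trmx.
  by apply: smooth_in_mulmx => //; exact: smooth_invgram.
apply: smooth_in_scale => //; apply: smooth_in_mulmx => //.
exact: smooth_in_trmx.
Qed.

Lemma gram_nabla_nabla p X Y Z : W p -> cdom c p ->
  gm g c p *m nabla g c X (fun q => nabla g c Y (fun=> Z) q) p
    = (jac c F p)^T *m (dd c (fun q => dd c (jac c F) q Y) p X *m Z)
      + (dd c (jac c F) p X)^T *m (sffm p Y *m Z)
      + k *: (gm g c p *m X *m (Y^T *m gm g c p *m Z)).
Proof.
move=> Wp cp; have dJ := diffat_jac Wp cp; have dF := diffat_F Wp cp.
have oWc : open (W `&` cdom c) by apply: openI => //; exact: cdom_open.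
have Wcp : (W `&` cdom c) p by [].
have sJ : smooth_in c W (jac c F) by exact: smooth_jac.
have dg : diffat c (gm g c) p by apply: smooth_in_diffat smooth_gram _ _.
have dJJ : diffat c (fun q => dd c (jac c F) q Y) p.
  by apply: smooth_in_diffat (smooth_in_dd Y oW sJ) _ _.
have ds : diffat c (fun q => sffm q Y) p by exact: smooth_in_diffat (smooth_sffm Y) Wcp cp.
have dU : diffat c (fun q => nabla g c Y (fun=> Z) q) p.
  apply: (@diffat_ext _ _ _ _ _ c W (fun q =>
    invmx (gm g c q) *m ((jac c F q)^T *m (dd c (jac c F) q Y *m Z)))) => //.
    move=> q Wq cq; have dJq := diffat_jac Wq cq.
    have := gram_nabla Y Wq cq (diffat_cst c Z q).
    rewrite (dd_mulmx Y cq dJq (diffat_cst c Z q)) dd_cst mulmx0 addr0.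
    by move=> <-; rewrite mulKmx // gram_unit.
  apply: diffat_mulmx; first exact: smooth_in_diffat smooth_invgram Wcp cp.
  apply: diffat_mulmx; first exact: diffat_trmx.
  by apply: diffat_mulmx => //; exact: diffat_cst.
rewrite gram_nabla //.
pose G1 q := dd c (jac c F) q Y *m Z.
pose G2 q := - (sffm q Y *m Z).
pose G3 q := k *: (F q *m (Y^T *m gm g c q *m Z)).
rewrite (@dd_ext _ _ _ _ _ c W _ (fun q => G1 q + G2 q + G3 q)) //; last first.
  by move=> q Wq cq; exact: gauss_formula.
have cZ : diffat c (fun=> Z) p by exact: diffat_cst.
have d1 : diffat c G1 p by exact: diffat_mulmx.
have ds' : diffat c (fun q => sffm q Y *m Z) p by exact: diffat_mulmx.
have d2 : diffat c G2 p by exact: diffat_opp.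
have dYg : diffat c (fun q => Y^T *m gm g c q) p.
  by apply: diffat_mulmx => //; exact: diffat_cst.
have dYgZ : diffat c (fun q => Y^T *m gm g c q *m Z) p by exact: diffat_mulmx.
have d3' : diffat c (fun q => F q *m (Y^T *m gm g c q *m Z)) p by exact: diffat_mulmx.
have d3 : diffat c G3 p by exact: diffat_scale.
rewrite (dd_add _ (diffat_add d1 d2) d3) (dd_add _ d1 d2) !mulmxDr.
congr (_ + _ + _).
- by rewrite dd_mulmx // dd_cst mulmx0 addr0.
- rewrite dd_opp // mulmxN; apply/eqP; rewrite eqr_oppLR; apply/eqP.
  have : dd c (fun q => (jac c F q)^T *m (sffm q Y *m Z)) p X = 0.
    rewrite (@dd_ext _ _ _ _ _ c W _ (fun=> 0)) // ?dd_cst // => q Wq cq.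
    by rewrite mulmxA jac_sffm // mul0mx.
  rewrite (dd_mulmx _ cp (diffat_trmx dJ) ds') (dd_trmx _ dJ) addrC.
  by move/eqP; rewrite addr_eq0 => /eqP.
- rewrite dd_scale // (dd_mulmx _ cp dF dYgZ) scalerDr mulmxDr.
  rewrite -!scalemxAr [X in _ + X](_ : _ = 0) ?addr0; last first.
    by rewrite mulmxA scalemxAl position_normal // mul0mx.
  by rewrite dd_jac // !mulmxA -gram_frame.
Qed.

(** The tangential parts of the second covariant derivatives differ from
   those of the second derivatives by the second fundamental form; the second
   derivatives themselves cancel.  In the spherical case the radial component of the
   second fundamental form contributes the terms with [k]. *)
Lemma gauss_equation p X Y Z : W p -> cdom c p ->
  gm g c p *m curvature g c p X Y Z
    = (dd c (jac c F) p X)^T *m (sffm p Y *m Z)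
      - (dd c (jac c F) p Y)^T *m (sffm p X *m Z)
      + k *: (gm g c p *m X *m (Y^T *m gm g c p *m Z))
      - k *: (gm g c p *m Y *m (X^T *m gm g c p *m Z)).
Proof.
move=> Wp cp; rewrite /curvature mulmxBr.
rewrite (gram_nabla_nabla X Y Z Wp cp) (gram_nabla_nabla Y X Z Wp cp).
have := dd_comm Y X oW smooth_jac Wp cp.
set A1 := dd c (fun q => dd c (jac c F) q Y) p X.
set A2 := dd c (fun q => dd c (jac c F) q X) p Y.
set D1 := dd c (jac c F) p X; set D2 := dd c (jac c F) p Y.
set G := gm g c p; set B1 := sffm p X; set B2 := sffm p Y.
by clearbody A1 A2 D1 D2 G B1 B2 => ->; mxlin.
Qed.

Lemma normal_dot p (xi : ambient R n S) : is_normal F p xi -> k *: ((F p)^T *m xi) = 0.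
Proof.
move=> [_]; rewrite dotE; clear fF; case: S xi F => [|c0] xi F' /= h.
  by rewrite scale0r.
by rewrite h scale_scalar_mx mulr0 raddf0.
Qed.

Lemma normal_jac p (xi : ambient R n S) : W p -> cdom c p ->
  is_normal F p xi -> (jac c F p)^T *m xi = 0.
Proof.
move=> Wp cp [h _]; have [_ sF _ _ _] := fF.
by rewrite (jac_diffl sF Wp cp) trmx_mul -mulmxA h mulmx0.
Qed.

Lemma normal_tproj p (xi : ambient R n S) : W p -> cdom c p ->
  is_normal F p xi -> tproj c p *m xi = 0.
Proof.
move=> Wp cp nxi; rewrite /tproj mulmxDl -mulmxA (normal_jac Wp cp nxi) mulmx0 add0r.
by rewrite -scalemxAl -mulmxA scalemxAr (normal_dot nxi) mulmx0.
Qed.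

End Frames.

HB.lock Definition cG {R : realType} {n : nat} {M : manifold R n} {S : setting R}
    (g : M -> 'M[R]_n) (F : M -> ambient R n S) {k : nat}
    (d : ribdata R M (cdim n S + cdim n S) k) (p : M)
    : 'M[R]_(cdim n S + cdim n S, k) := calG g F d p.

Lemma cGE {R : realType} {n : nat} {M : manifold R n} {S : setting R}
    (g : M -> 'M[R]_n) (F : M -> ambient R n S) {k : nat}
    (d : ribdata R M (cdim n S + cdim n S) k) : calG g F d = cG g F d.
Proof. by apply/funext => p; rewrite cG.unlock. Qed.

HB.lock Definition om {R : realType} {n : nat} {M : manifold R n}
    (g : M -> 'M[R]_n) {k : nat} (phi : M -> 'cV[R]_k) (c : chart R n M) (p : M)
    : 'M[R]_(n, k) := invmx (gm g c p) *m (jac c phi p)^T.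

Section Weingarten.
Context {R : realType} {n : nat} {M : manifold R n}.
Variables (S : setting R) (W : set M) (g : M -> 'M[R]_n).
Variable F : M -> ambient R n S.
Hypothesis fF : framed W g F.
Local Notation k := (curv S).
Context {l : nat}.
Variable d : ribdata R M (cdim n S + cdim n S) l.
Hypotheses (sphi : smooth_on W (rphi d)) (sbeta : smooth_on W (rbeta d)).
Hypothesis nbeta : forall p, W p -> forall v, is_normal F p (rbeta d p *m v).
Variable c : chart R n M.
Hypothesis sc : smooth_chart c.

Let oW : open W. Proof. by case: fF. Qed.
Let oWc : open (W `&` cdom c).
Proof. by apply: openI => //; exact: cdom_open. Qed.

Lemma eq_col_mul m q (A B : 'M[R]_(m, q)) :
  (forall v : 'cV[R]_q, A *m v = B *m v) -> A = B.
Proof.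
move=> h; apply/matrixP => i j.
by have /matrixP/(_ i 0) := h (delta_mx j 0); rewrite -!colE !mxE.
Qed.

Lemma beta_jac p : W p -> cdom c p -> (jac c F p)^T *m rbeta d p = 0.
Proof.
move=> Wp cp; apply: eq_col_mul => v; rewrite mul0mx -mulmxA.
exact: (normal_jac fF sc Wp cp (nbeta Wp v)).
Qed.

Lemma omega_tE p : omega_t g d c p = om g (rphi d) c p.
Proof. by rewrite om.unlock /omega_t gmE jacE. Qed.

Lemma calG_chart p : W p -> cdom c p ->
  cG g F d p = jac c F p *m om g (rphi d) c p + rbeta d p
    + k *: (F p *m (rphi d p)^T).
Proof.
move=> Wp cp; have [_ sF _ _ _] := fF.
rewrite cG.unlock /calG /F_omega_t (frame_change fF sc sF sphi Wp cp).
by rewrite om.unlock mulmxA.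
Qed.

Lemma smooth_in_Wc {m q : nat} (h : M -> 'M[R]_(m, q)) :
  smooth_in c W h -> smooth_in c (W `&` cdom c) h.
Proof. by apply: smooth_in_sub => p []. Qed.

Lemma smooth_om : smooth_in c (W `&` cdom c) (om g (rphi d) c).
Proof.
have -> : om g (rphi d) c = fun p => invmx (gm g c p) *m (jac c (rphi d) p)^T.
  by apply/funext => p; rewrite om.unlock.
apply: smooth_in_mulmx => //; first exact: (smooth_invgram fF sc).
apply: smooth_in_trmx => //; apply: smooth_in_jac => //.
by apply: smooth_in_Wc; exact: sphi.
Qed.

Lemma smooth_F_phi : smooth_in c W (fun q => k *: (F q *m (rphi d q)^T)).
Proof.
apply: smooth_in_scale => //; apply: smooth_in_mulmx => //.
  exact: (smooth_frame fF sc).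
by apply: smooth_in_trmx => //; exact: sphi.
Qed.

Lemma smooth_cG : smooth_in c W (cG g F d).
Proof.
have sG : smooth_in c (W `&` cdom c) (cG g F d).
  apply: (@smooth_in_ext _ _ _ _ _ c _ (fun p => jac c F p *m om g (rphi d) c p
     + rbeta d p + k *: (F p *m (rphi d p)^T))) => //.
    by move=> q [Wq cq] _; rewrite calG_chart.
  apply: smooth_in_add => //; last by apply: smooth_in_Wc; exact: smooth_F_phi.
  apply: smooth_in_add => //; last by apply: smooth_in_Wc; exact: sbeta.
  apply: smooth_in_mulmx => //; last exact: smooth_om.
  by apply: smooth_in_Wc; exact: (smooth_jac fF sc).
by move=> s x [p [Wp cp] <-]; apply: sG; exists p.
Qed.

Section AtPoint.
Variables (p : M) (X : 'cV[R]_n).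
Hypotheses (Wp : W p) (cp : cdom c p).

Let Wcp : (W `&` cdom c) p. Proof. by []. Qed.
Let dJ : diffat c (jac c F) p. Proof. exact: (diffat_jac fF sc Wp cp). Qed.
Let dF : diffat c F p. Proof. exact: (diffat_F fF sc Wp cp). Qed.
Let dom : diffat c (om g (rphi d) c) p.
Proof. exact: smooth_in_diffat smooth_om Wcp cp. Qed.
Let dphi : diffat c (rphi d) p.
Proof. exact: smooth_in_diffat (sphi sc) Wp cp. Qed.
Let dbeta : diffat c (rbeta d) p.
Proof. exact: smooth_in_diffat (sbeta sc) Wp cp. Qed.
Let dFphi : diffat c (fun q => F q *m (rphi d q)^T) p.
Proof. by apply: diffat_mulmx => //; exact: diffat_trmx. Qed.

Lemma dd_cG : dd c (cG g F d) p X =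
  dd c (jac c F) p X *m om g (rphi d) c p
  + jac c F p *m dd c (om g (rphi d) c) p X + dd c (rbeta d) p X
  + k *: (jac c F p *m X *m (rphi d p)^T + F p *m (jac c (rphi d) p *m X)^T).
Proof.
rewrite (dd_ext _ oWc Wcp cp (h2 := fun q => jac c F q *m om g (rphi d) c q
  + rbeta d q + k *: (F q *m (rphi d q)^T))); last first.
  by move=> q [Wq cq] _; rewrite calG_chart.
have d1 : diffat c (fun q => jac c F q *m om g (rphi d) c q) p by exact: diffat_mulmx.
rewrite (dd_add _ (diffat_add d1 dbeta) (diffat_scale _ dFphi)) (dd_add _ d1 dbeta).
rewrite (dd_mulmx _ cp dJ dom) (dd_scale _ _ dFphi).
rewrite (dd_mulmx _ cp dF (diffat_trmx dphi)) (dd_trmx _ dphi).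
by rewrite (dd_jac _ dF) (dd_jac _ dphi).
Qed.

(** The condition of Codazzi type says that the derivative of [calG] has no
   normal part. *)
Lemma normal_dd_cG (v : 'cV[R]_l) :
  (1%:M - tproj g F c p) *m dd c (cG g F d) p X *m v
   = sff g F c p X (omega_t g d c p *m v)
     + nabla_perp g F c X (fun q => rbeta d q *m v) p.
Proof.
rewrite (sffE fF sc) // omega_tE /nabla_perp (normal_partE fF sc) // ddE.
rewrite (dd_mulmx _ cp dbeta (diffat_cst c v p)) dd_cst mulmx0 addr0.
have pT := tproj_jac fF sc Wp cp; have pF := tproj_F fF sc Wp cp.
rewrite dd_cG /sffm.
move: (tproj g F c p) pT pF => Q pT pF.
move: (dd c (rbeta d) p X) (dd c (jac c F) p X) (om g _ c p) (dd c (om _ _ _) p X) => B D O O'.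
move: (jac c F p) pT (jac c (rphi d) p) (rphi d p) => T pT w f.
have pF' (A : 'rV[R]_l) : Q *m (k *: (F p *m A)) = k *: (F p *m A).
  by rewrite -scalemxAr mulmxA scalemxAl pF -scalemxAl.
rewrite !scalerDr !mulmxBl !mul1mx !mulmxDr pF'.
have -> : Q *m (k *: (T *m X *m f^T)) = k *: (T *m X *m f^T).
  by rewrite -scalemxAr !mulmxA pT.
rewrite !mulmxDl !mulmxA pT; mxlin.
Qed.

Lemma gm_shape xi : is_normal F p xi ->
  gm g c p *m Defs.shape g F c p xi X = (dd c (jac c F) p X)^T *m xi.
Proof.
move=> nxi; rewrite /Defs.shape gmE mulKVmx ?(gram_unit fF sc) //.
transitivity ((sffm g F c p X)^T *m xi).
  apply/matrixP => j z; rewrite (ord1 z) [LHS]mxE (sffE fF sc) //.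
  by rewrite dot_mulmxl /dot -[basis_vec j]/(delta_mx j 0) trmx_delta -rowE mxE.
rewrite /sffm trmx_mul linearB /= trmx1 (tprojT fF sc) // -mulmxA mulmxBl mul1mx.
by rewrite (normal_tproj fF sc Wp cp nxi) subr0.
Qed.

(** The tangential part of the derivative of [calG v] is [F_* (Phi_v X)]. *)
Lemma tangent_dd_cG (v : 'cV[R]_l) :
  (jac c F p)^T *m dd c (cG g F d) p X *m v = gm g c p *m Phi g F d c v p X.
Proof.
have dov : diffat c (fun q => om g (rphi d) c q *m v) p.
  by apply: diffat_mulmx => //; exact: diffat_cst.
have -> : Phi g F d c v p X = nabla g c X (fun q => om g (rphi d) c q *m v) p
    - Defs.shape g F c p (rbeta d p *m v) X + (k * dot (rphi d p) v) *: X.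
  have oE : (fun q => omega_t g d c q *m v) = (fun q => om g (rphi d) c q *m v).
    by apply/funext => q; rewrite omega_tE.
  by rewrite /Phi oE.
rewrite mulmxDr mulmxBr (gram_nabla fF sc) // (gm_shape (nbeta Wp v)).
have -> : dd c (fun q => jac c F q *m (om g (rphi d) c q *m v)) p X
   = (dd c (jac c F) p X *m om g (rphi d) c p
      + jac c F p *m dd c (om g (rphi d) c) p X) *m v.
  rewrite (dd_mulmx _ cp dJ dov) (dd_mulmx _ cp dom (diffat_cst c v p)).
  by rewrite dd_cst mulmx0 addr0 mulmxDl !mulmxA.
have db : (jac c F p)^T *m dd c (rbeta d) p X = - ((dd c (jac c F) p X)^T *m rbeta d p).
  have : dd c (fun q => (jac c F q)^T *m rbeta d q) p X = 0.
    rewrite (dd_ext _ oWc Wcp cp (h2 := fun=> 0)) ?dd_cst // => q [Wq cq] _.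
    exact: beta_jac.
  rewrite (dd_mulmx _ cp (diffat_trmx dJ) dbeta) (dd_trmx _ dJ) addrC.
  by move/eqP; rewrite addr_eq0 => /eqP.
rewrite dd_cG.
have pF := position_normal fF sc Wp cp.
rewrite (gram_frame fF sc) // dot_scale.
move: (dd c (rbeta d) p X) (dd c (jac c F) p X) db (om g _ c p) (dd c (om _ _ _) p X) => B D db O O'.
move: (jac c F p) pF (rbeta d p) db (jac c (rphi d) p) (rphi d p) => T pF b db w f.
have pF' (A : 'rV[R]_l) : T^T *m (k *: (F p *m A)) = 0.
  by rewrite -scalemxAr mulmxA scalemxAl pF mul0mx.
rewrite !scalerDr !mulmxDr pF' db addr0 -!scalemxAr !mulmxDl !mulmxA mulNmx.
by rewrite -!scalemxAl !mulmxDr !mulmxA; mxlin.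
Qed.

End AtPoint.

End Weingarten.

(** * Linear algebra of a P-transform at a point *)

Lemma mulmx_eqr (R : pzRingType) m p q (A : 'M[R]_(m, p)) (B : 'M[R]_(p, q)) C :
  A *m B = C -> forall r (X : 'M[R]_(r, m)), X *m A *m B = X *m C.
Proof. by move=> <- r X; rewrite mulmxA. Qed.

Section Transposes.
Variables (R : pzRingType) (m p : nat).
Implicit Types A B : 'M[R]_(m, p).

Lemma trmxD A B : (A + B)^T = A^T + B^T.
Proof. by apply/matrixP => i j; rewrite !mxE. Qed.
Lemma trmxN A : (- A)^T = - A^T.
Proof. by apply/matrixP => i j; rewrite !mxE. Qed.
Lemma trmxZ a A : (a *: A)^T = a *: A^T.
Proof. by apply/matrixP => i j; rewrite !mxE. Qed.
End Transposes.

Ltac mxx := rewrite ?(mulmxDl, mulmxDr, mulNmx, mulmxN, mul0mx, mulmx0,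
  mul1mx, mulmx1, mulmxA, oppr0, addr0, add0r, opprK).
Ltac trx := rewrite ?(trmxD, trmxN, trmxZ, trmxK, trmx0, trmx1, trmx_mul).

Section ComplexStructure.
Context {R : realType}.

Lemma JmxJ m : (Jmx : 'M[R]_(m + m)) *m Jmx = - 1%:M.
Proof.
rewrite /Jmx mulmx_block !mul0mx !mulmx0 !mul1mx !mulmx1 !add0r !addr0.
by rewrite (@scalar_mx_block _ m m 1) opp_block_mx !oppr0.
Qed.

Lemma JmxT m : (Jmx : 'M[R]_(m + m))^T = - Jmx.
Proof. by rewrite /Jmx tr_block_mx opp_block_mx !trmx0 linearN /= !trmx1 opprK !oppr0. Qed.

(** A real subspace of half dimension of C^m on which the Kaehler form vanishes is
   Lagrangian: its image under the complex structure is its orthogonal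
   complement. *)
Lemma lagrangian_projection m (L : 'M[R]_(m + m, m)) :
  L^T *m L \in unitmx -> L^T *m Jmx *m L = 0 ->
  let Pi := L *m invmx (L^T *m L) *m L^T in Pi + Jmx *m Pi *m Jmx^T = 1%:M.
Proof.
move=> uG iso Pi; rewrite /Pi {Pi}; set J := Jmx in iso *; set G := L^T *m L in uG *.
have JTJ : J^T *m J = 1%:M by rewrite JmxT mulNmx JmxJ opprK.
have iso' : L^T *m J^T *m L = 0 by rewrite JmxT mulmxN mulNmx iso oppr0.
have : col_mx (invmx G *m L^T) (invmx G *m L^T *m J^T) *m row_mx L (J *m L) = 1%:M.
  rewrite mul_col_row -!mulmxA -/G mulVmx // (mulmxA J^T) JTJ mul1mx -/G mulVmx //.
  by rewrite !(mulmxA L^T) iso iso' !mulmx0 -scalar_mx_block.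
by move/mulmx1C; rewrite mul_row_col !mulmxA.
Qed.

End ComplexStructure.

(** The algebraic part of a P-transform at a point, for [beta = J H P]: then
   [calG = H + J H P] and [rho = P^t H^t H P]. *)
Definition linking {R : realType} {N l : nat} (J : 'M[R]_N) (H : 'M[R]_(N, l))
    (P Om : 'M[R]_l) : Prop :=
  Om + Om^T = (H + J *m H *m P)^T *m (H + J *m H *m P) /\
  Om^T *m P + P^T *m Om^T
    + (- P^T - invmx P^T) *m (P^T *m (H^T *m H) *m P) = 0.

Section Transform.
Context {R : realType} {N l : nat}.
Variables (J Pi : 'M[R]_N) (H : 'M[R]_(N, l)) (P Om : 'M[R]_l).
Hypotheses (JJ : J *m J = - 1%:M) (JT : J^T = - J).
Hypotheses (PiT : Pi^T = Pi) (PiJPi : Pi *m J *m Pi = 0).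
Hypotheses (PiH : Pi *m H = H) (uP : P \in unitmx) (uOm : Om \in unitmx).
Variables (S pi P' Q : 'M[R]_l) (G : 'M[R]_(N, l)).
Hypotheses (SE : S = H^T *m H) (GE : G = H + J *m H *m P) (piE : pi = invmx P).
Hypotheses (P'E : P' = P + pi) (QE : Q = 1%:M + P *m P).

Lemma piV : pi *m P = 1%:M. Proof. by rewrite piE mulVmx. Qed.
Lemma piVr : P *m pi = 1%:M. Proof. by rewrite piE mulmxV. Qed.

Lemma QP' : Q = P *m P'.
Proof. by rewrite QE P'E mulmxDr piVr addrC. Qed.

Lemma JTJ : J^T *m J = 1%:M.
Proof. by rewrite JT mulNmx JJ opprK. Qed.

Lemma ST : S^T = S.
Proof. by rewrite SE trmx_mul trmxK. Qed.

Lemma HPi : H^T *m Pi = H^T.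
Proof. by rewrite -[in RHS]PiH trmx_mul PiT. Qed.

Lemma HJPi : H^T *m J *m Pi = 0.
Proof. by rewrite -HPi -!mulmxA (mulmxA Pi) PiJPi mulmx0. Qed.

Lemma HJH : H^T *m J *m H = 0.
Proof. by rewrite -{2}PiH mulmxA HJPi mul0mx. Qed.

Lemma GHE : G^T *m H = S.
Proof.
rewrite GE linearD /= mulmxDl !trmx_mul JT !mulmxN !mulNmx -!mulmxA.
by rewrite (mulmxA H^T) HJH mulmx0 oppr0 addr0 SE.
Qed.

Lemma GG : G^T *m G = S + P^T *m S *m P.
Proof.
rewrite {2}GE mulmxDr GHE GE linearD /= mulmxDl !mulmxA HJH mul0mx add0r.
by rewrite !trmx_mul !mulmxA -(mulmxA _ J^T) JTJ mulmx1 SE !mulmxA.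
Qed.

Lemma GPi : G^T *m Pi = H^T.
Proof.
rewrite GE linearD /= mulmxDl HPi !trmx_mul JT !mulmxN !mulNmx -!mulmxA.
by rewrite (mulmxA H^T) HJPi mulmx0 oppr0 addr0.
Qed.

Lemma GJPi : G^T *m J *m Pi = P^T *m H^T.
Proof.
rewrite GE linearD /= !mulmxDl HJPi add0r !trmx_mul -!mulmxA (mulmxA J^T) JTJ mul1mx.
by rewrite HPi.
Qed.

Hypothesis hl : linking J H P Om.

Lemma OmOmT : Om + Om^T = G^T *m G.
Proof. by have [h _] := hl; rewrite GE. Qed.

Lemma OmT : Om^T = G^T *m G - Om.
Proof. by rewrite -OmOmT addrC addKr. Qed.

Lemma OmP : Om *m P + P^T *m Om = P^T *m S *m Q.
Proof.
have [_ /(congr1 trmx)] := hl; rewrite -SE -trmx_inv -piE.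
trx; rewrite ST mulmxDr !mulmxN -!mulmxA piVr; mxx => e.
rewrite QE; mxx; apply/eqP; rewrite -subr_eq0; apply/eqP.
by rewrite -[RHS]e; mxlin.
Qed.

Lemma SP' : S *m P' = pi^T *m Om + Om *m pi.
Proof.
have := congr1 (fun A => pi^T *m A *m pi) OmP.
rewrite mulmxDr mulmxDl !mulmxA (mulmx_eqr piVr) mulmx1 -trmx_mul piVr trmx1.
rewrite !mul1mx => ->; rewrite QP' P'E; mxx.
by rewrite !(mulmx_eqr piVr) !mulmx1.
Qed.

(** Write [Omega^t] as [S + P^t S P - Omega]; the terms with [S] are given by the
   second relation of [linking], in the forms [SP'] and [OmP]. *)
Lemma P'Om : P'^T *m Om = Om^T *m P'.
Proof.
rewrite OmT GG mulmxBl mulmxDl SP' -[_ *m P *m P']mulmxA -QP' -OmP.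
rewrite P'E linearD /= mulmxDl mulmxDr; mxlin.
Qed.

Lemma P'invOm : P' *m invmx Om = (invmx Om)^T *m P'^T.
Proof.
have uT : Om^T \in unitmx by rewrite unitmx_tr.
apply: (can_inj (mulKmx uT)); rewrite !mulmxA -trmx_mul mulVmx // trmx1 mul1mx.
by rewrite -P'Om mulmxK.
Qed.

Variable CP : 'M[R]_N.
Hypothesis CPE : CP = 1%:M - G *m invmx Om *m G^T.

Lemma CPT : CP^T = 1%:M - G *m (invmx Om)^T *m G^T.
Proof. by rewrite CPE linearB /= trmx1 !trmx_mul trmxK mulmxA. Qed.

Lemma OmVr : (invmx Om)^T *m Om^T = 1%:M.
Proof. by rewrite -trmx_mul mulmxV // trmx1. Qed.

Lemma CPG : CP *m G = - (G *m invmx Om *m Om^T).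
Proof.
rewrite CPE mulmxBl mul1mx OmT mulmxBr mulmxKV // -!mulmxA; mxlin.
Qed.

Lemma CPTG : CP^T *m G = - (G *m (invmx Om)^T *m Om).
Proof.
rewrite CPT mulmxBl mul1mx -[_ *m G^T *m G]mulmxA -OmOmT mulmxDr.
by rewrite (mulmx_eqr OmVr) mulmx1; mxlin.
Qed.

(** For symmetric [Omega] this is the reflection in the orthogonal complement of
   the range of [calG]; in general orthogonality is the relation
   [Omega + Omega^t = calG^t calG]. *)
Lemma CP_orth : CP^T *m CP = 1%:M.
Proof.
rewrite {2}CPE mulmxBr mulmx1 !mulmxA CPTG CPT !mulNmx mulmxK //; mxlin.
Qed.

Lemma CPPi : CP *m Pi = Pi - G *m invmx Om *m H^T.
Proof. by rewrite CPE mulmxBl mul1mx -!mulmxA GPi. Qed.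

(** Although the orthogonal map [CP] is not complex linear, it carries the
   Lagrangian subspace onto which [Pi] projects to a Lagrangian subspace. *)
Lemma JCP : J *m CP *m Pi = CP *m J *m (Pi - H *m Q *m invmx Om *m H^T).
Proof.
have JPi' : CP *m J *m Pi = J *m Pi - G *m invmx Om *m P^T *m H^T.
  by rewrite CPE !mulmxBl mul1mx -!mulmxA (mulmxA G^T) GJPi.
have JH' : CP *m J *m H = J *m H - G *m invmx Om *m P^T *m S.
  by rewrite -{1}PiH mulmxA JPi' mulmxBl -!mulmxA PiH SE.
have PSQ : P^T *m S *m Q *m invmx Om = Om *m P *m invmx Om + P^T.
  by rewrite -OmP mulmxDl mulmxK.
have GPSQ : G *m invmx Om *m P^T *m S *m Q *m invmx Om
    = G *m P *m invmx Om + G *m invmx Om *m P^T.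
  rewrite -(mulmxA _ P^T) -(mulmxA _ (P^T *m S)) -(mulmxA _ (P^T *m S *m Q)) PSQ.
  by rewrite mulmxDr !mulmxA mulmxKV.
have JG : J *m G = J *m H - H *m P.
  by rewrite GE mulmxDr !mulmxA JJ !mulNmx mul1mx.
rewrite -mulmxA CPPi !mulmxBr JPi' !mulmxA JH' !mulmxBl JG GPSQ.
rewrite GE QE; mxx; mxlin.
Qed.

Lemma QSQ : Q^T *m S *m Q = Q^T *m Om + Om^T *m Q.
Proof.
have e : Q = P' *m P by rewrite QE P'E mulmxDl piV addrC.
transitivity (P'^T *m (P^T *m S *m Q)); first by rewrite {1}QP' trmx_mul !mulmxA.
by rewrite -OmP mulmxDr !mulmxA P'Om -(mulmxA Om^T) -e -trmx_mul -QP' addrC.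
Qed.

Lemma CPT_J_CP : CP^T *m J *m CP *m Pi = J *m (Pi - H *m Q *m invmx Om *m H^T).
Proof.
by rewrite -!mulmxA (mulmxA J CP) JCP !mulmxA CP_orth mul1mx.
Qed.

Lemma CP_isotropic : Pi *m CP^T *m J *m CP *m Pi = 0.
Proof.
have e := CPT_J_CP; rewrite -!mulmxA in e *; rewrite e.
have iH : Pi *m (J *m H) = 0 by rewrite -{1}PiH !mulmxA PiJPi mul0mx.
have iP : Pi *m (J *m Pi) = 0 by rewrite !mulmxA PiJPi.
by rewrite mulmxBr mulmxBr iP (mulmxA J H) (mulmxA Pi) iH mul0mx subrr.
Qed.

(** The second fundamental form of the transformed immersion, paired with [J].
   By [JCP] the operator [J] passes through [CP] at the cost of a term with [H Q], and by
   [QSQ] this term cancels those that come from the derivative of [CP]. *)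
Lemma transform_shape n (T dT : 'M[R]_(N, n)) (D D' Gr a : 'M[R]_n) (z : 'M[R]_(n, l))
    (dG : 'M[R]_(N, l)) (dCP : 'M[R]_N) (v : 'M[R]_(l, n)) :
  Pi *m T = T -> H^T *m T = v -> T^T *m J^T *m dT = Gr *m a ->
  H^T *m J^T *m dT = v *m a -> dG = T *m z -> dG^T *m T = - (P'^T *m v *m a) ->
  dCP = - (CP *m dG *m invmx Om *m G^T) - G *m invmx Om *m dG^T ->
  (CP *m T *m D)^T *m J^T *m (dCP *m T *m D + CP *m dT *m D + CP *m T *m D')
    = D^T *m Gr *m a *m D.
Proof.
move=> PiTT HT TJdT HJdT dGE dGT dCPE.
have iso q (A : 'M[R]_(n, q)) : (CP *m T *m D)^T *m J^T *m (CP *m T *m A) = 0.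
  transitivity (- (D^T *m T^T *m (Pi *m CP^T *m J *m CP *m Pi) *m T *m A)).
    by rewrite -{1 2}PiTT JT; trx; rewrite PiT; mxx.
  by rewrite CP_isotropic mulmx0 !mul0mx oppr0.
pose K := T - H *m (Q *m invmx Om *m v).
have KE : (CP *m T *m D)^T *m J^T = D^T *m K^T *m J^T *m CP^T.
  have e : J *m CP *m T = CP *m J *m K.
    have := congr1 (mulmx^~ T) JCP.
    rewrite -(mulmxA (J *m CP)) PiTT => ->; rewrite -(mulmxA (CP *m J)) mulmxBl PiTT.
    by rewrite -(mulmxA _ H^T) HT /K !mulmxA.
  by rewrite -trmx_mul !mulmxA e !trmx_mul !mulmxA.
have CG : CP^T *m (G *m invmx Om *m P'^T) = - (G *m P' *m invmx Om).
  rewrite -(mulmxA G) mulmxA CPTG mulNmx !mulmxA mulmxK //.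
  by rewrite -(mulmxA _ _ P'^T) -P'invOm mulmxA.
have e1 : dCP *m T *m D = CP *m T *m (- (z *m invmx Om *m G^T *m T *m D))
    + G *m invmx Om *m P'^T *m (v *m a *m D).
  rewrite dCPE mulmxBl -(mulmxA _ dG^T) dGT mulmxBl dGE; mxx.
  by [].
rewrite e1 !mulmxDr !iso add0r addr0 KE -!(mulmxA (D^T *m K^T *m J^T)).
rewrite (mulmxA CP^T) CG -!(mulmxA CP) (mulmxA CP^T CP) CP_orth mul1mx.
have KdT : K^T *m J^T *m dT = Gr *m a - v^T *m (invmx Om)^T *m Q^T *m v *m a.
  rewrite /K; trx; rewrite !mulmxBl TJdT; congr (_ - _).
  by rewrite -!mulmxA (mulmxA H^T) HJdT !mulmxA.
have PiG : Pi *m J^T *m G = H *m P.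
  have e : Pi *m J *m H = 0 by rewrite -PiH mulmxA PiJPi mul0mx.
  by rewrite JT GE mulmxDr !mulmxN !mulNmx e oppr0 add0r !mulmxA -(mulmxA Pi J J) JJ mulmxN mulmx1 !mulNmx opprK PiH.
have TJG : T^T *m J^T *m G *m P' = v^T *m Q.
  rewrite -PiTT trmx_mul PiT -(mulmxA T^T) -(mulmxA T^T) PiG.
  by rewrite QP' -HT; trx; rewrite !mulmxA.
have HJG : H^T *m J^T *m G *m P' = S *m Q.
  rewrite -{1}PiH trmx_mul PiT -(mulmxA H^T) -(mulmxA H^T) PiG.
  by rewrite QP' SE !mulmxA.
have VO : (invmx Om)^T *m Om^T = 1%:M by rewrite -trmx_mul mulmxV // trmx1.
have KG : K^T *m J^T *m (G *m P' *m invmx Om) = - (v^T *m (invmx Om)^T *m Q^T).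
  have KP' : K^T *m J^T *m G *m P' = v^T *m Q - v^T *m (invmx Om)^T *m Q^T *m (S *m Q).
    by rewrite /K -TJG -HJG; trx; rewrite !mulmxBl !mulmxA.
  rewrite !mulmxA KP' (mulmxA _ S) -(mulmxA _ Q^T S) -(mulmxA _ (Q^T *m S)) QSQ.
  by rewrite mulmxDr !mulmxA (mulmx_eqr VO) mulmx1 mulmxBl mulmxDl mulmxK //; mxlin.
rewrite -(mulmxA D^T K^T) -!(mulmxA D^T) -mulmxDr; congr (_ *m _).
rewrite (mulmxA _ dT) KdT (mulmxA _ (- _)) mulmxN KG; mxx; mxlin.
Qed.

End Transform.

Section Spectrum.
Context {R : realType}.

(** An eigenvalue [0] would be its own opposite. *)
Lemma spectrum_unit l (P : 'M[R]_l) : spectrum_condition P -> P \in unitmx.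
Proof.
move=> sp; rewrite -(map_unitmx (real_complex R)); set PC := map_mx _ P.
rewrite -row_free_unit -kermx_eq0; apply/negPn/negP => nu.
have {}sp : ~ (eigenvalue PC 0 /\ eigenvalue PC (- 0)) := sp 0.
apply: sp; rewrite oppr0; suff h : eigenvalue PC 0 by split.
have [v vP v0] : exists2 v : 'rV_l, v *m PC = 0 & v != 0.
  by move: nu => /rowV0Pn[v /sub_kermxP ? ?]; exists v.
by apply/eigenvalueP; exists v => //; rewrite scale0r.
Qed.

(** On the complex numbers the characteristic polynomial of [P] splits, and none of
   its roots is the opposite of an eigenvalue. *)
Lemma spectrum_horner l (P : 'M[R]_l.+1) : spectrum_condition P ->
  horner_mx (- P^T) (char_poly P) \in unitmx.
Proof.
move=> sp; rewrite -(map_unitmx (real_complex R)) map_horner_mx.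
set PC := map_mx (real_complex R) P.
have {}sp z : ~ (eigenvalue PC z /\ eigenvalue PC (- z)) := sp z.
rewrite map_char_poly -/PC.
have -> : map_mx (real_complex R) (- P^T) = - PC^T by rewrite map_mxN map_trmx.
have [rs E] := closed_field_poly_normal (char_poly PC).
rewrite E (monicP (char_poly_monic PC)) scale1r rmorph_prod /=.
have hr z : z \in rs -> eigenvalue PC z.
  move=> zr; rewrite eigenvalue_root_char E (monicP (char_poly_monic PC)) scale1r.
  by rewrite root_prod_XsubC.
elim: rs {E} hr => [|z rs IH] hr; first by rewrite big_nil unitmx1.
rewrite big_cons unitmx_mul IH ?andbT; last first.
  by move=> y yr; apply: hr; rewrite in_cons yr orbT.
rewrite rmorphB /= horner_mx_X horner_mx_C.
have ez : eigenvalue PC z by apply: hr; rewrite mem_head.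
rewrite -unitmx_tr trmxD !trmxN trmxK tr_scalar_mx.
rewrite -row_free_unit -kermx_eq0; apply/negPn/negP => /rowV0Pn[v /sub_kermxP vP v0].
suff h : eigenvalue PC (- z) by exact: (sp z (conj ez h)).
apply/eigenvalueP; exists v => //.
move/eqP: vP; rewrite mulmxBr mulmxN mul_mx_scalar -opprD oppr_eq0 addr_eq0 => /eqP ->.
by rewrite scaleNr.
Qed.

Lemma spectrum_sub l m (P : 'M[R]_l) (Q : 'M[R]_m) (E : 'M[R]_(l, m)) :
  E^T *m E = 1%:M -> E^T *m P = Q *m E^T ->
  spectrum_condition P -> spectrum_condition Q.
Proof.
move=> EE EP sp; rewrite /spectrum_condition /= => z [a b].
have sub w : eigenvalue (map_mx (real_complex R) Q) w ->
    eigenvalue (map_mx (real_complex R) P) w.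
  move=> /eigenvalueP[v vQ v0]; apply/eigenvalueP.
  exists (v *m map_mx (real_complex R) E^T).
    by rewrite -mulmxA -map_mxM EP map_mxM mulmxA vQ scalemxAl.
  apply: contraNneq v0 => /(congr1 (mulmx^~ (map_mx (real_complex R) E))).
  by rewrite mul0mx -mulmxA -map_mxM EE map_mx1 mulmx1 => ->.
exact: (sp z (conj (sub _ a) (sub _ b))).
Qed.

(** Sylvester's argument: [q (- P^T) Om = Om (q P)] on [Z] for the characteristic
   polynomial [q] of [P], which annihilates [P]. *)
Lemma intertwine_zero l (P Om : 'M[R]_l) (Z : 'cV[R]_l -> Prop) :
  spectrum_condition P ->
  (forall x, Z x -> Z (P *m x) /\ P^T *m Om *m x = - (Om *m P *m x)) ->
  forall x, Z x -> Om *m x = 0.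
Proof.
case: l P Om Z => [|l] P Om Z sP Zs; first by move=> x _; rewrite [LHS]flatmx0.
have hx q x : Z x -> horner_mx (- P^T) q *m (Om *m x)
    = Om *m (horner_mx P q *m x).
  elim/poly_ind: q x => [|q c IH] x Zx; first by rewrite !rmorph0 !mul0mx mulmx0.
  have [Z1 Zc] := Zs _ Zx.
  rewrite !rmorphD !rmorphM /= !horner_mx_X !horner_mx_C -!mulmxE !mulmxDl.
  rewrite -!mulmxA mulNmx (mulmxA P^T) Zc opprK -(mulmxA Om) IH // mulmxDr.
  by rewrite !mul_scalar_mx -scalemxAr.
move=> x Zx; have := hx (char_poly P) x Zx.
rewrite Cayley_Hamilton mul0mx mulmx0 => e.
by rewrite -(mulKmx (spectrum_horner sP) (Om *m x)) e mulmx0.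
Qed.

End Spectrum.

Section Blocks.
Context {R : realType} {N l : nat}.
Variables (J Pi : 'M[R]_N) (H : 'M[R]_(N, l)) (P Om : 'M[R]_l).
Hypotheses (JJ : J *m J = - 1%:M) (JT : J^T = - J).
Hypotheses (PiT : Pi^T = Pi) (PiJPi : Pi *m J *m Pi = 0).
Hypotheses (PiH : Pi *m H = H) (sP : spectrum_condition P) (uOm : Om \in unitmx).
Hypothesis hl : linking J H P Om.

Let uP : P \in unitmx := spectrum_unit sP.
Let G := H + J *m H *m P.
Let S := H^T *m H.

(** Both relations are restricted to an invariant subspace of [P]. *)
Lemma linking_sub m (E : 'M[R]_(l, m)) (Pj : 'M[R]_m) :
  E^T *m E = 1%:M -> E^T *m P = Pj *m E^T -> P *m E = E *m Pj ->
  linking J (H *m E) Pj (E^T *m Om *m E).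
Proof.
move=> EE EP PE.
have uPj : Pj \in unitmx by apply: spectrum_unit; exact: spectrum_sub EE EP sP.
have PET : P^T *m E = E *m Pj^T by rewrite -[LHS]trmxK trmx_mul trmxK EP trmx_mul trmxK.
have EPT : E^T *m P^T = Pj^T *m E^T by have := congr1 trmx PE; rewrite !trmx_mul.
have EPV : E^T *m (invmx P)^T = (invmx Pj)^T *m E^T.
  have uT : Pj^T \in unitmx by rewrite unitmx_tr.
  rewrite !trmx_inv; apply: (can_inj (mulKmx uT)).
  by rewrite mulmxA -EPT mulmxK ?unitmx_tr // mulKVmx.
have [h1 h2] := hl; split.
  have GE : H *m E + J *m (H *m E) *m Pj = (H + J *m H *m P) *m E.
    by mxx; rewrite -!mulmxA -PE !mulmxA.
  transitivity (E^T *m (Om + Om^T) *m E); first by trx; mxx.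
  by rewrite h1 GE (trmx_mul (H + _)) !mulmxA.
have := congr1 (fun A => E^T *m A *m E) h2; rewrite /= mulmx0 mul0mx => <-.
rewrite -!trmx_inv; trx; mxx.
rewrite !(mulmx_eqr PE) EPT EPV !mulmxA !(mulmx_eqr EPT) !mulmxA; mxlin.
Qed.

(** A vector of [ker Om_jj] is killed by [G], so [ker Om_jj] is invariant under [P], and on
   it [Om] intertwines [P] and [- P^T]; as these have disjoint spectra,
   [Om] vanishes there. *)
Lemma block_unit m (E : 'M[R]_(l, m)) (Pj : 'M[R]_m) :
  E^T *m E = 1%:M -> E^T *m P = Pj *m E^T -> P *m E = E *m Pj ->
  E^T *m Om *m E \in unitmx.
Proof.
move=> EE EP PE.
pose Z (x : 'cV[R]_l) := (exists w, x = E *m w) /\ E^T *m Om *m x = 0.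
have GE : G = H + J *m H *m P by [].
have SE : S = H^T *m H by [].
have EPT : E^T *m P^T = Pj^T *m E^T by have := congr1 trmx PE; rewrite !trmx_mul.
have mm := OmP uP SE erefl erefl hl.
have quad x : dot x (Om *m x) + dot x (Om *m x)
    = dot (H *m x) (H *m x) + dot (H *m P *m x) (H *m P *m x).
  have -> : dot x (Om *m x) + dot x (Om *m x) = dot x ((Om + Om^T) *m x).
    by rewrite mulmxDl dotDr; congr (_ + _); rewrite dotC dot_mulmxl.
  rewrite (OmOmT GE hl) (GG JJ JT PiT PiJPi PiH SE GE) mulmxDl dotDr !dot_mulmxl.
  by rewrite SE; trx; rewrite !mulmxA.
have Zdot x : Z x -> dot x (Om *m x) = 0.
  by move=> [[w ->] h]; rewrite dot_mulmxl mulmxA h dot0r.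
have Zker x : Z x -> H *m x = 0 /\ H *m P *m x = 0.
  move=> Zx; have := quad x; rewrite Zdot // addr0 => /esym /eqP.
  rewrite paddr_eq0 ?dot_ge0 // => /andP[/eqP a /eqP b].
  by split; exact: dot_eq0.
have Zstep x : Z x -> Z (P *m x) /\ P^T *m Om *m x = - (Om *m P *m x).
  move=> Zx; have [Hx HPx] := Zker x Zx; have [[w xE] Ox] := Zx.
  have e : Om *m P *m x + P^T *m Om *m x = P^T *m H^T *m (H *m P *m (P *m x)).
    rewrite -mulmxDl mm SE; mxx; by rewrite -(mulmxA _ H x) Hx mulmx0 add0r.
  have e1 : E^T *m Om *m (P *m x) = E^T *m P^T *m H^T *m (H *m P *m (P *m x)).
    have := congr1 (mulmx E^T) e; rewrite mulmxDr !mulmxA EPT.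
    by rewrite -(mulmxA Pj^T) -(mulmxA Pj^T) Ox mulmx0 addr0 => ->.
  have PxE : P *m x = E *m (Pj *m w) by rewrite xE !mulmxA PE.
  have e2 : dot (P *m x) (Om *m (P *m x)) = dot (H *m P *m (P *m x)) (H *m P *m (P *m x)).
    rewrite {1}PxE dot_mulmxl mulmxA e1; have -> : H *m P *m (P *m x) = H *m P *m (E *m (Pj *m w)) by rewrite PxE.
    move: (Pj *m w) => y; set u := H *m P *m _; rewrite {2}/u.
    rewrite [RHS]dot_mulmxl; rewrite [RHS]dot_mulmxl.
    by trx; rewrite !mulmxA.
  have HPPx : H *m P *m (P *m x) = 0.
    have := quad (P *m x); rewrite e2 (mulmxA H P x) HPx dot0r add0r => /eqP.
    by rewrite -subr_eq0 addrK => /eqP /dot_eq0.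
  split; last first.
    by move: e; rewrite HPPx mulmx0 addrC => /eqP; rewrite addr_eq0 => /eqP.
  by split; [exists (Pj *m w)|rewrite e1 HPPx mulmx0].
have Z0 := intertwine_zero sP Zstep.
rewrite -unitmx_tr -row_free_unit -kermx_eq0; apply/negPn/negP.
move=> /rowV0Pn[v /sub_kermxP vk v0].
have Zv : Z (E *m v^T).
  split; first by exists v^T.
  by rewrite mulmxA -[LHS]trmxK trmx_mul trmxK vk trmx0.
have : E *m v^T = 0 by rewrite -(mulKmx uOm (E *m v^T)) Z0 // mulmx0.
move=> /(congr1 (mulmx E^T)); rewrite mulmxA EE mul1mx mulmx0.
by move=> /(congr1 trmx); rewrite trmxK trmx0 => v00; rewrite v00 eqxx in v0.
Qed.

Section Bar.
Variables (li lj : nat) (Ei : 'M[R]_(l, li)) (Ej : 'M[R]_(l, lj)).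
Variables (Pi' : 'M[R]_li) (Pj : 'M[R]_lj).
Hypotheses (EiEi : Ei^T *m Ei = 1%:M) (EjEj : Ej^T *m Ej = 1%:M).
Hypotheses (EiEj : Ei^T *m Ej = 0) (EjEi : Ej^T *m Ei = 0).
Hypothesis EE1 : Ei *m Ei^T + Ej *m Ej^T = 1%:M.
Hypotheses (EiP : Ei^T *m P = Pi' *m Ei^T) (PEi : P *m Ei = Ei *m Pi').
Hypotheses (EjP : Ej^T *m P = Pj *m Ej^T) (PEj : P *m Ej = Ej *m Pj).

Variables (Ojj : 'M[R]_lj) (Oij : 'M[R]_(li, lj)) (Oji : 'M[R]_(lj, li)).
Variables (Ob : 'M[R]_li) (Y Y' : 'M[R]_(l, li)) (CP : 'M[R]_N).
Hypotheses (OjjE : Ojj = Ej^T *m Om *m Ej) (OijE : Oij = Ei^T *m Om *m Ej).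
Hypotheses (OjiE : Oji = Ej^T *m Om *m Ei).
Hypothesis ObE : Ob = Ei^T *m Om *m Ei - Oij *m invmx Ojj *m Oji.
Hypothesis YE : Y = Ei - Ej *m (invmx Ojj)^T *m Oij^T.
Hypothesis Y'E : Y' = Ei - Ej *m invmx Ojj *m Oji.
Hypothesis CPE : CP = 1%:M - (G *m Ej) *m invmx Ojj *m (G *m Ej)^T.

Let uOjj : Ojj \in unitmx.
Proof. by rewrite OjjE; exact: block_unit EjEj EjP PEj. Qed.
Let sPj : spectrum_condition Pj.
Proof. exact: spectrum_sub EjEj EjP sP. Qed.
Let sPi : spectrum_condition Pi'.
Proof. exact: spectrum_sub EiEi EiP sP. Qed.
Let uPj : Pj \in unitmx := spectrum_unit sPj.
Let uPi : Pi' \in unitmx := spectrum_unit sPi.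

Let hlj : linking J (H *m Ej) Pj Ojj.
Proof. by rewrite OjjE; exact: linking_sub. Qed.

Let PiHj : Pi *m (H *m Ej) = H *m Ej.
Proof. by rewrite mulmxA PiH. Qed.

Let GjE : G *m Ej = H *m Ej + J *m (H *m Ej) *m Pj.
Proof. by rewrite mulmxDl -!mulmxA PEj. Qed.

Lemma bar_T : Ob^T = Ei^T *m Om^T *m Ei - Oji^T *m (invmx Ojj)^T *m Oij^T.
Proof. by rewrite ObE; trx; rewrite !mulmxA. Qed.

Lemma EjOmTY : Ej^T *m Om^T *m Y = 0.
Proof.
have e : Ej^T *m Om^T *m Ej *m (invmx Ojj)^T = 1%:M.
  have -> : Ej^T *m Om^T *m Ej = Ojj^T by rewrite OjjE; trx; rewrite !mulmxA.
  by rewrite -trmx_mul mulVmx // trmx1.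
by rewrite YE mulmxBr !mulmxA e mul1mx OijE; trx; rewrite !mulmxA subrr.
Qed.

(** Block elimination: [Y] removes the block [Omega_ij], and [Y'] the block
   [Omega_ji]; the Schur complement remains. *)
Lemma OmTY : Om^T *m Y = Ei *m Ob^T.
Proof.
rewrite -[LHS]mul1mx -EE1 mulmxDl -!mulmxA (mulmxA Ej^T) EjOmTY mulmx0 addr0.
by congr (_ *m _); rewrite bar_T YE !mulmxBr OjiE; trx; rewrite !mulmxA.
Qed.

Lemma OmY' : Om *m Y' = Ei *m Ob.
Proof.
have e : Ej^T *m Om *m Y' = 0.
  by rewrite Y'E mulmxBr !mulmxA -OjjE mulmxV // mul1mx OjiE subrr.
rewrite -[LHS]mul1mx -EE1 mulmxDl -!mulmxA (mulmxA Ej^T) e mulmx0 addr0.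
by congr (_ *m _); rewrite ObE Y'E !mulmxBr !mulmxA OijE.
Qed.

Lemma EiY' : Ei^T *m Y' = 1%:M.
Proof. by rewrite Y'E mulmxBr EiEi !mulmxA EiEj !mul0mx subr0. Qed.

Lemma bar_inv : Ei^T *m invmx Om *m Ei *m Ob = 1%:M.
Proof. by rewrite -mulmxA -OmY' -mulmxA mulKmx // EiY'. Qed.

Lemma bar_unit : Ob \in unitmx.
Proof. by have [] := mulmx1_unit bar_inv. Qed.

Lemma bar_invE : invmx Ob = Ei^T *m invmx Om *m Ei.
Proof. by rewrite -[RHS]mulmx1 -(mulmxV bar_unit) mulmxA bar_inv mul1mx. Qed.

Lemma bar_orth : CP^T *m CP = 1%:M.
Proof. exact: (CP_orth uOjj GjE hlj CPE). Qed.

(** [calG] of the second transform. *)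
Lemma bar_G : CP *m (G *m Y) = G *m Y'.
Proof.
have CPGj := CPG uOjj GjE hlj CPE.
have e : Ej^T *m G^T *m G *m Ei = Oji + Oij^T.
  by rewrite -(mulmxA _ G^T) -(OmOmT (erefl G) hl) OjiE OijE; trx; mxx.
rewrite YE !mulmxBr !mulmxA -(mulmxA CP G Ej) CPGj.
have -> : CP *m G *m Ei = G *m Ei - G *m Ej *m invmx Ojj *m (Oji + Oij^T).
  by rewrite -e CPE mulmxBl mulmxBl mul1mx; trx; rewrite !mulmxA.
have e2 : Ojj^T *m (invmx Ojj)^T = 1%:M by rewrite -trmx_mul mulVmx // trmx1.
rewrite Y'E mulmxBr !mulNmx (mulmx_eqr e2) mulmx1; mxx; mxlin.
Qed.

(** [Y] does not intertwine [P] with its block [P_i]; the defect lies in [V_j] and has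
   exactly the form of the defect in the twisted commutation [JCP]. *)
Lemma bar_commute : P *m Y = Y *m Pi'
  - Ej *m (1%:M + Pj *m Pj) *m invmx Ojj *m (H *m Ej)^T *m (H *m Y *m Pi').
Proof.
have SE : S = H^T *m H by [].
have Sp := SP' uP SE erefl erefl erefl hl.
pose C := (invmx Ojj)^T *m Oij^T.
pose piP := invmx P; pose piJ := invmx Pj.
have EjpT : Ej^T *m piP^T = piJ^T *m Ej^T.
  have e : piP *m Ej = Ej *m piJ.
    by apply: (can_inj (mulKmx uP)); rewrite mulKVmx // mulmxA PEj mulmxK.
  by have := congr1 trmx e; rewrite !trmx_mul.
have EjPT : Ej^T *m P^T = Pj^T *m Ej^T by have := congr1 trmx PEj; rewrite !trmx_mul.
have piY : piP *m Y *m Pi' = Ei - Ej *m piJ *m C *m Pi'.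
  have e1 : piP *m Ei *m Pi' = Ei by rewrite -mulmxA -PEi mulKmx.
  have e2 : piP *m Ej = Ej *m piJ.
    by apply: (can_inj (mulKmx uP)); rewrite mulKVmx // mulmxA PEj mulmxK.
  by rewrite YE mulmxBr mulmxBl e1 /C !mulmxA e2.
have QO : (1%:M + Pj *m Pj) *m invmx Ojj = Pj *m (invmx Ojj)^T *m (Pj + piJ)^T.
  have GHj : (H *m Ej)^T *m (H *m Ej) = (H *m Ej)^T *m (H *m Ej) by [].
  rewrite (QP' uPj erefl erefl erefl) -mulmxA.
  rewrite (P'invOm JJ JT PiT PiJPi PiHj uPj uOjj GHj GjE erefl erefl erefl hlj).
  by rewrite mulmxA.
have SpT : (P + piP)^T *m S = Om^T *m piP + piP^T *m Om^T.
  have := congr1 trmx Sp; rewrite trmx_mul (ST SE) => ->; trx.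
  by [].
have main : (Pj + piJ)^T *m (H *m Ej)^T *m (H *m Y *m Pi')
   = Oij^T - Ojj^T *m piJ *m C *m Pi'.
  have -> : (Pj + piJ)^T *m (H *m Ej)^T *m (H *m Y *m Pi')
     = Ej^T *m ((P + piP)^T *m S) *m Y *m Pi'.
    have e0 : (Pj + piJ)^T *m Ej^T = Ej^T *m (P + piP)^T.
      by rewrite !trmxD mulmxDl mulmxDr EjpT EjPT.
    by rewrite (trmx_mul H) (mulmxA _ Ej^T) e0 /S !mulmxA.
  rewrite SpT mulmxDr !mulmxDl !mulmxA EjpT -(mulmxA piJ^T) -(mulmxA piJ^T) EjOmTY.
  rewrite mulmx0 mul0mx addr0 -!mulmxA (mulmxA piP) piY.
  rewrite mulmxA mulmxBr; congr (_ - _); first by rewrite OijE; trx; rewrite !mulmxA.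
  by rewrite /C OjjE; trx; rewrite !mulmxA.
rewrite -(mulmxA Ej) QO.
have -> : Ej *m (Pj *m (invmx Ojj)^T *m (Pj + piJ)^T) *m (H *m Ej)^T *m (H *m Y *m Pi')
   = Ej *m Pj *m (invmx Ojj)^T *m ((Pj + piJ)^T *m (H *m Ej)^T *m (H *m Y *m Pi')).
  by rewrite !mulmxA.
have e2 : (invmx Ojj)^T *m Ojj^T = 1%:M by rewrite -trmx_mul mulmxV // trmx1.
have e3 : Pj *m piJ = 1%:M by rewrite mulmxV.
rewrite main YE mulmxBr mulmxBl PEi !mulmxA PEj mulmxBr ?mulmxA /C ?mulmxA.
rewrite (mulmx_eqr e2) mulmx1 (mulmx_eqr e3) mulmx1; mxlin.
Qed.

Let Hb := CP *m (H *m Y).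

(** The two defects cancel. *)
Lemma bar_beta : CP *m (J *m H *m P *m Y) = J *m Hb *m Pi'.
Proof.
have GHj : (H *m Ej)^T *m (H *m Ej) = (H *m Ej)^T *m (H *m Ej) by [].
have Jc := JCP JJ JT PiT PiJPi PiHj uPj uOjj GHj GjE erefl erefl hlj CPE.
have -> : J *m Hb *m Pi' = J *m CP *m Pi *m (H *m Y *m Pi').
  by rewrite /Hb !mulmxA -(mulmxA _ Pi H) PiH.
have -> : J *m H *m P *m Y = J *m H *m (P *m Y) by rewrite mulmxA.
by rewrite bar_commute Jc !mulmxBr !mulmxBl !mulmxA -(mulmxA _ Pi H) PiH.
Qed.

Lemma bar_GE : Hb + J *m Hb *m Pi' = G *m Y'.
Proof.
by rewrite -bar_beta -bar_G /Hb -mulmxDr /G; congr (_ *m _); mxx.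
Qed.

(** Block inversion of [Om]: the reason why the two transforms compose to the
   given one. *)
Lemma bar_compose : Ej *m invmx Ojj *m Ej^T + Y' *m invmx Ob *m Y^T = invmx Om.
Proof.
apply: (can_inj (mulKmx uOm)); rewrite mulmxDr mulmxV // !mulmxA OmY'.
rewrite mulmxK ?bar_unit //.
have OE : Om *m Ej = Ei *m Oij + Ej *m Ojj.
  by rewrite -[LHS]mul1mx -EE1 mulmxDl OijE OjjE !mulmxA.
have YT : Y^T = Ei^T - Oij *m invmx Ojj *m Ej^T by rewrite YE; trx; rewrite !mulmxA.
rewrite OE YT !mulmxDl mulmxBr !mulmxA mulmxK // -EE1; mxlin.
Qed.

(** The first relation is a congruence by [Y'].  The second is read on the inverses:
   it says that [P Omega^-1 + Omega^-1 P^t = Omega^-1 rho Omega^-t (P + P^-1)^t] for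
   [rho = P^t S P], and the inverse of the Schur complement is a block of [Omega^-1]. *)
Lemma bar_linking : linking J Hb Pi' Ob.
Proof.
have SE : S = H^T *m H by [].
have GE : G = H + J *m H *m P by [].
have GbE := bar_GE.
have Y'Ei : Y'^T *m Ei = 1%:M by rewrite -[LHS]trmxK trmx_mul trmxK EiY' trmx1.
split.
  rewrite GbE trmx_mul -mulmxA (mulmxA _ G) -(OmOmT GE hl) mulmxDl mulmxDr OmY'.
  rewrite mulmxA Y'Ei mul1mx; congr (_ + _).
  by rewrite mulmxA -trmx_mul OmY' trmx_mul -mulmxA EiY' mulmx1.
pose rho := P^T *m S *m P.
have rhoY : Y^T *m rho *m Y = Pi'^T *m (Hb^T *m Hb) *m Pi'.
  have e q (A : 'M[R]_(N, q)) : (CP *m (J *m A))^T *m (CP *m (J *m A)) = A^T *m A.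
    rewrite trmx_mul -mulmxA (mulmxA CP^T) bar_orth mul1mx.
    by rewrite trmx_mul -mulmxA (mulmxA J^T) (JTJ JJ JT) mul1mx.
  have e1 q (A : 'M[R]_(N, q)) : (J *m A)^T *m (J *m A) = A^T *m A.
    by rewrite trmx_mul -mulmxA (mulmxA J^T) (JTJ JJ JT) mul1mx.
  have -> : Y^T *m rho *m Y = (H *m P *m Y)^T *m (H *m P *m Y).
    by rewrite /rho /S; trx; rewrite !mulmxA.
  have -> : Pi'^T *m (Hb^T *m Hb) *m Pi' = (Hb *m Pi')^T *m (Hb *m Pi').
    by trx; rewrite !mulmxA.
  have b : J *m (Hb *m Pi') = CP *m (J *m (H *m P *m Y)).
    by rewrite mulmxA -bar_beta !mulmxA.
  by rewrite -(e _ (H *m P *m Y)) -(e1 _ (Hb *m Pi')) b.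
pose X := invmx Ob; pose p' := Pi' + invmx Pi'; pose P' := P + invmx P.
have EX : Ei^T *m invmx Om = X *m Y^T.
  have := congr1 trmx OmTY; rewrite !trmx_mul !trmxK => YO.
  by rewrite -[Y^T](mulmxK uOm) YO !mulmxA /X mulVmx ?bar_unit // mul1mx.
have XE : (invmx Om)^T *m Ei = Y *m X^T.
  by have := congr1 trmx EX; rewrite !trmx_mul !trmxK.
have Eip : Ei^T *m P' = p' *m Ei^T.
  rewrite /P' /p' mulmxDr mulmxDl EiP; congr (_ + _).
  apply: (can_inj (mulKmx uPi)).
  by rewrite [in RHS]mulmxA mulmxV // mul1mx mulmxA -EiP mulmxK.
have P'Ei : P'^T *m Ei = Ei *m p'^T.
  by have := congr1 trmx Eip; rewrite !trmx_mul trmxK.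
have KO := P'invOm JJ JT PiT PiJPi PiH uP uOm SE GE erefl erefl erefl hl.
have Kb : p' *m X = X^T *m p'^T.
  rewrite /X bar_invE !trmx_mul trmxK.
  by rewrite !mulmxA -Eip -!mulmxA -P'Ei (mulmxA P') KO !mulmxA.
have main : Ob *m Pi' + Pi'^T *m Ob = Pi'^T *m (Hb^T *m Hb) *m Pi' *m p'.
  have e1 : P *m invmx Om + invmx Om *m P^T = invmx Om *m rho *m ((invmx Om)^T *m P'^T).
    have -> : (invmx Om)^T *m P'^T = P' *m invmx Om by rewrite KO.
    have := congr1 (fun A => invmx Om *m A *m invmx Om) (OmP uP SE erefl erefl hl).
    rewrite (mulmxDr _ (Om *m P)) (mulmxDl (_ *m (Om *m P))) !mulmxA mulVmx // mul1mx.
    rewrite (mulmx_eqr (mulmxV uOm)) mulmx1 => ->.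
    by rewrite (QP' uP erefl erefl erefl) /rho /S !mulmxA.
  have PTEi : P^T *m Ei = Ei *m Pi'^T by have := congr1 trmx EiP; rewrite !trmx_mul trmxK.
  have e2 : Pi' *m X + X *m Pi'^T = X *m (Y^T *m rho *m Y) *m (p' *m X).
    have -> : Pi' *m X = Ei^T *m (P *m invmx Om) *m Ei.
      by rewrite /X bar_invE !mulmxA EiP.
    have -> : X *m Pi'^T = Ei^T *m (invmx Om *m P^T) *m Ei.
      by rewrite /X bar_invE -!mulmxA PTEi.
    rewrite -mulmxDl -mulmxDr e1 Kb -!mulmxA P'Ei (mulmxA _ Ei) XE.
    by rewrite (mulmxA Ei^T) EX !mulmxA.
  have ObX : Ob *m X = 1%:M by rewrite mulmxV // bar_unit.
  have XOb : X *m Ob = 1%:M by rewrite mulVmx // bar_unit.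
  move: e2; rewrite rhoY; move: (Pi'^T *m (Hb^T *m Hb) *m Pi') => sb e2.
  have := congr1 (fun A => Ob *m A *m Ob) e2.
  by rewrite mulmxDr mulmxDl !mulmxA ObX !(mulmx_eqr XOb) !mulmx1 !mul1mx => ->.
have := congr1 trmx main; rewrite trmxD !trmx_mul !trmxK addrC => ->.
rewrite -trmx_inv /p'; trx; mxx; mxlin.
Qed.

End Bar.

End Blocks.

(** * Lagrangian immersions of constant curvature *)

Lemma dotZr (R : realType) m (a : R) (u v : 'cV[R]_m) : dot u (a *: v) = a * dot u v.
Proof. by rewrite /dot -scalemxAr mxE. Qed.

Lemma mx11_skew (R : realType) (A : 'M[R]_1) : A^T = - A -> A = 0.
Proof.
move=> e; apply/matrixP => i j; rewrite (ord1 i) (ord1 j).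
by have /matrixP/(_ 0 0) := e; rewrite !mxE => {}e; lra.
Qed.

Section Polarization.
Context {R : realType} {n : nat}.
Variables (G : 'M[R]_n) (a : 'cV[R]_n -> 'M[R]_n).
Hypothesis uG : G \in unitmx.
Hypothesis aD : forall X Y, a (X + Y) = a X + a Y.
Hypothesis aC : forall X Y, a X *m Y = a Y *m X.
Hypothesis aT : forall X, (G *m a X)^T = G *m a X.
Hypothesis q0 : forall X Y, dot X (G *m (a X *m a Y - a Y *m a X) *m Y) = 0.

Let s (X Y Z W : 'cV[R]_n) := dot (a X *m Y) (G *m (a Z *m W)).

Lemma pairing_sym : G^T = G -> forall X Y Z W, s X Y Z W = s Z W X Y.
Proof. by move=> GT X Y Z W; rewrite /s dotC dot_mulmxl GT. Qed.

(** A tensor with the symmetries of a curvature tensor vanishes if its sectional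
   curvatures do. *)
Lemma commute_of_sectional : G^T = G -> forall X Y, a X *m a Y = a Y *m a X.
Proof.
move=> GT.
have sC1 X Y Z W : s X Y Z W = s Y X Z W by rewrite /s aC.
have sC2 X Y Z W : s X Y Z W = s X Y W Z by rewrite /s (aC Z).
have sS := pairing_sym GT.
have sD X X' Y Z W : s (X + X') Y Z W = s X Y Z W + s X' Y Z W.
  by rewrite /s aD mulmxDl dotC dotDr !(dotC (G *m _)).
have sD2 X Y Y' Z W : s X (Y + Y') Z W = s X Y Z W + s X Y' Z W.
  by rewrite sC1 sD !(sC1 _ X).
have sD3 X Y Z Z' W : s X Y (Z + Z') W = s X Y Z W + s X Y Z' W.
  by rewrite sS sD !(sS _ _ X).
have sD4 X Y Z W W' : s X Y Z (W + W') = s X Y Z W + s X Y Z W'.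
  by rewrite sC2 sD3 !(sC2 _ _ _ Z).
have form X Y Z W : dot W (G *m (a X *m a Y - a Y *m a X) *m Z) = s Y Z X W - s X Z Y W.
  have t U V : dot W (G *m (a U *m V)) = dot V (G *m (a U *m W)).
    rewrite mulmxA dotC dot_mulmxl; congr dot.
    by rewrite aT mulmxA.
  rewrite mulmxBr mulmxBl dotDr dotNr -!mulmxA !t; congr (_ - _).
have q X Y : s Y Y X X = s X Y X Y.
  have := q0 X Y; rewrite form => /eqP; rewrite subr_eq0 => /eqP ->.
  by rewrite [LHS]sC2.
have q2 X W Y : s Y Y X W = s X Y W Y.
  have := q (X + W) Y; rewrite !(sD, sD2, sD3, sD4) !q (sC2 Y Y W X) (sS W Y X Y); lra.
have q3 X W Y Z : s Y Z X W + s Y Z X W = s X Y W Z + s X Z W Y.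
  have := q2 X W (Y + Z); rewrite !(sD, sD2, sD3, sD4) !q2 (sC1 Z Y X W); lra.
have eqs X Y Z W : s Y Z X W = s X Z Y W.
  have e1 := q3 X W Y Z; have e2 := q3 Y W X Z; have e3 := q3 Z W X Y.
  move: e1 e2 e3; rewrite (sC1 Y X) (sC1 Z X) (sC1 Z Y) !(sC2 _ _ W); lra.
move=> X Y; apply/eqP; rewrite -subr_eq0; apply/eqP.
apply: (can_inj (mulKmx uG)); rewrite mulmx0.
apply: eq_col_mul => Z; rewrite mul0mx; apply: dot_eq0.
by rewrite form eqs subrr.
Qed.

End Polarization.

Lemma smooth_chart_at {R : realType} {n : nat} {M : manifold R n} (p : M) :
  smooth_chart (chart_at p).
Proof. by move=> q; exact: chart_at_compatible. Qed.

Definition positive_setting {R : realType} (S : setting R) : Prop :=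
  match S with Lagrangian => True | Horizontal c => 0 < c end.

(** The shape operator in the direction [J F_* X]. *)
HB.lock Definition aop {R : realType} {n : nat} {M : manifold R n} {S : setting R}
    (g : M -> 'M[R]_n) (F : M -> ambient R n S) (c : chart R n M) (p : M)
    (X : 'cV[R]_n) : 'M[R]_n :=
  invmx (gm g c p) *m ((jac c F p)^T *m Jmx^T *m dd c (jac c F) p X).

Section LagrangianFrames.
Context {R : realType} {n : nat} {M : manifold R n}.
Variables (S : setting R) (W : set M) (g : M -> 'M[R]_n).
Variable F : M -> ambient R n S.
Local Notation k := (curv S).
Local Notation J := (Jmx : 'M[R]_(cdim n S + cdim n S)).

(** Both cases at once: the tangent space, together with the position
   vector in the horizontal case, is a Lagrangian subspace. *)
Definition lframed : Prop :=
  [/\ positive_setting S, framed W g F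
    & forall p, W p -> k *: ((F p)^T *m J *m diffl F p) = 0 /\
        (diffl F p)^T *m J *m diffl F p = 0].

Hypothesis lF : lframed.
Let fF : framed W g F. Proof. by case: lF. Qed.
Let oW : open W. Proof. by case: fF. Qed.

Variable c : chart R n M.
Hypothesis sc : smooth_chart c.

Lemma jac_isotropic p : W p -> cdom c p ->
  k *: ((F p)^T *m J *m jac c F p) = 0 /\ (jac c F p)^T *m J *m jac c F p = 0.
Proof.
move=> Wp cp; have [_ sF _ _ _] := fF; have [_ _ /(_ p Wp)[a b]] := lF.
rewrite (jac_diffl sc sF Wp cp); split.
  by rewrite mulmxA scalemxAl a mul0mx.
rewrite trmx_mul; move: b; move: (diffl F p) => T b.
by rewrite !mulmxA -(mulmxA _ T^T) -(mulmxA _ (T^T *m J)) b mulmx0 mul0mx.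
Qed.

Lemma quad_Jmx (x : ambient R n S) : x^T *m J *m x = 0.
Proof.
by apply: mx11_skew; rewrite !trmx_mul trmxK JmxT mulNmx mulmxN mulmxA.
Qed.

(** In the horizontal case the Lagrangian frame consists of the position
   vector and the coordinate vectors, and its Gram matrix is block diagonal. *)
Lemma tproj_lagrangian p : W p -> cdom c p ->
  tproj g F c p + J *m tproj g F c p *m J^T = 1%:M.
Proof.
move=> Wp cp; have [iF iT] := jac_isotropic Wp cp.
have ug := gram_unit fF sc Wp cp; have gE := gram_frame fF sc Wp cp.
have TF := position_normal fF sc Wp cp.
have [_ _ _ _ /(_ p Wp)[_ kk]] := fF; have [pS _ _] := lF.
have qF := quad_Jmx (F p).
rewrite /tproj; move: (F p) (jac c F p) (gm g c p) ug gE TF kk iF iT qF pS.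
clear; case: S => [|c0] /= x T G uG GE TF kk xT iT qF.
  move=> _; rewrite scale0r addr0 GE in uG *.
  exact: lagrangian_projection uG iT.
move=> c00; have c0n : c0 != 0 by rewrite gt_eqF.
have xx : x^T *m x = (c0^-1)%:M.
  rewrite dotE; congr (_%:M); apply: (mulfI c0n); apply: (mulfI c0n).
  by rewrite kk mulfV // mulr1.
have Tx : T^T *m x = 0 by move/eqP: TF; rewrite scaler_eq0 (negPf c0n) => /eqP.
have xT0 : x^T *m Jmx *m T = 0 by move/eqP: xT; rewrite scaler_eq0 (negPf c0n) => /eqP.
have xT' : x^T *m T = 0 by rewrite -[LHS]trmxK trmx_mul trmxK Tx trmx0.
have TJx : T^T *m Jmx *m x = 0.
  have := congr1 trmx xT0; rewrite !trmx_mul trmxK JmxT mulNmx mulmxN trmx0 mulmxA.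
  by move/eqP; rewrite oppr_eq0 => /eqP.
pose L : 'M[R]_(n.+1 + n.+1, 1 + n) := row_mx x T.
have LL : L^T *m L = block_mx (c0^-1)%:M 0 0 G.
  by rewrite tr_row_mx mul_col_row xx Tx xT' -GE.
have uc : ((c0^-1)%:M : 'M[R]_1) \in unitmx.
  by rewrite unitmxE det_scalar1 unitfE invr_eq0.
have uL : L^T *m L \in unitmx by rewrite LL block_diag_mx_unit uc.
have iL : L^T *m Jmx *m L = 0.
  rewrite tr_row_mx mul_col_mx mul_col_row qF xT0 TJx iT.
  exact: block_mx0.
have := lagrangian_projection uL iL.
have -> : L *m invmx (L^T *m L) *m L^T = T *m invmx G *m T^T + c0 *: (x *m x^T).
  rewrite LL invmx_block_diag -?LL // invmx_scalar invrK.
  rewrite /L mul_row_block !mulmx0 addr0 add0r tr_row_mx mul_row_col mul_mx_scalar.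
  by rewrite addrC scalemxAl.
by [].
Qed.

Section AtPoint.
Variable p : M.
Hypotheses (Wp : W p) (cp : cdom c p).
Local Notation Pr := (tproj g F c p).
Local Notation T := (jac c F p).

Let PrT : Pr^T = Pr. Proof. exact: (tprojT fF sc Wp cp). Qed.
Let PrJac : Pr *m T = T. Proof. exact: (tproj_jac fF sc Wp cp). Qed.

Lemma tproj_idem : Pr *m Pr = Pr.
Proof.
have pF := tproj_F fF sc Wp cp.
rewrite {2}/tproj mulmxDr !mulmxA PrJac -scalemxAr mulmxA scalemxAl pF.
by rewrite -scalemxAl.
Qed.

Lemma tproj_Jl : J *m Pr = (1%:M - Pr) *m J.
Proof.
have JJ' : J^T *m J = 1%:M by rewrite JmxT mulNmx JmxJ opprK.
have := congr1 (mulmx^~ J) (tproj_lagrangian Wp cp).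
rewrite (mulmxDl Pr) -(mulmxA _ J^T) JJ' mulmx1 mul1mx mulmxBl mul1mx => e.
by rewrite -{2}e addrAC subrr add0r.
Qed.

Lemma tproj_J : Pr *m J *m Pr = 0.
Proof. by rewrite -mulmxA tproj_Jl mulmxA mulmxBr mulmx1 tproj_idem subrr mul0mx. Qed.

(** Derivatives of the isotropy relations.  The second one is the total symmetry of the
   cubic form [<dT(X) Y, J F_* Z>]. *)
Lemma dd_isotropic X :
  k *: ((F p)^T *m J *m dd c (jac c F) p X) = 0 /\
  (T^T *m J^T *m dd c (jac c F) p X)^T = T^T *m J^T *m dd c (jac c F) p X.
Proof.
have dJ := diffat_jac fF sc Wp cp; have dF := diffat_F fF sc Wp cp.
have cJ : diffat c (fun=> J) p by exact: diffat_cst.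
have dTJ : diffat c (fun q => (jac c F q)^T *m J) p.
  by apply: diffat_mulmx => //; exact: diffat_trmx.
have dFJ : diffat c (fun q => (F q)^T *m J) p.
  by apply: diffat_mulmx => //; exact: diffat_trmx.
have e1 : dd c (fun q => (jac c F q)^T *m J *m jac c F q) p X = 0.
  rewrite (dd_ext _ oW Wp cp (h2 := fun=> 0)) ?dd_cst // => q Wq cq.
  by have [] := jac_isotropic Wq cq.
have e2 : dd c (fun q => k *: ((F q)^T *m J *m jac c F q)) p X = 0.
  rewrite (dd_ext _ oW Wp cp (h2 := fun=> 0)) ?dd_cst // => q Wq cq.
  by have [] := jac_isotropic Wq cq.
have [_ iT] := jac_isotropic Wp cp.
move: e1 e2; rewrite (dd_mulmx _ cp dTJ dJ) (dd_scale _ _ (diffat_mulmx dFJ dJ)).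
rewrite (dd_mulmx _ cp dFJ dJ) (dd_mulmx _ cp (diffat_trmx dJ) cJ).
rewrite (dd_mulmx _ cp (diffat_trmx dF) cJ) !dd_cst !mulmx0 !addr0.
rewrite (dd_trmx _ dJ) (dd_trmx _ dF) (dd_jac _ dF).
move: (dd c (jac c F) p X) => D e1 e2; split.
  move: e2; rewrite trmx_mul -(mulmxA X^T) -(mulmxA X^T) iT mulmx0 add0r //.
rewrite !trmx_mul !trmxK JmxT; move/eqP: e1.
by rewrite addr_eq0 mulmxN mulNmx !mulmxA => /eqP.
Qed.

Local Notation aop := (aop g F c p).

Lemma aopE X : aop X = invmx (gm g c p) *m (T^T *m J^T *m dd c (jac c F) p X).
Proof. by rewrite aop.unlock. Qed.

Lemma aopD X Y : aop (X + Y) = aop X + aop Y.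
Proof.
have dJ := diffat_jac fF sc Wp cp.
rewrite !aopE !(dd_lin _ dJ) -!mulmxDr -big_split /=; congr (_ *m (_ *m _)).
by apply: eq_bigr => i _; rewrite mxE scalerDl.
Qed.

Lemma aopZ t X : aop (t *: X) = t *: aop X.
Proof.
have dJ := diffat_jac fF sc Wp cp.
rewrite !aopE !(dd_lin _ dJ) !scalemxAr scaler_sumr; congr (_ *m (_ *m _)).
by apply: eq_bigr => i _; rewrite mxE scalerA.
Qed.

Lemma aopC X Y : aop X *m Y = aop Y *m X.
Proof. by rewrite !aopE -!mulmxA (dd_jac_sym fF sc). Qed.

Lemma gm_aop X : gm g c p *m aop X = T^T *m J^T *m dd c (jac c F) p X.
Proof. by rewrite !aopE mulKVmx // (gram_unit fF sc). Qed.

Lemma aop_sym X : (gm g c p *m aop X)^T = gm g c p *m aop X.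
Proof. by rewrite !gm_aop; have [] := dd_isotropic X. Qed.

(** The normal space is [J] applied to the Lagrangian subspace. *)
Lemma sffm_aop X : sffm g F c p X = J *m (T *m aop X).
Proof.
have [kD _] := dd_isotropic X.
rewrite /sffm (_ : 1%:M - Pr = J *m Pr *m J^T); last first.
  by rewrite -(tproj_lagrangian Wp cp) addrAC subrr add0r.
rewrite {1}/tproj aopE.
rewrite mulmxDr !mulmxDl !mulmxA -[RHS]addr0; congr (_ + _).
rewrite -!scalemxAr -!scalemxAl -!mulmxA (mulmxA _ J^T) scalemxAr scalemxAr.
by rewrite JmxT mulmxN mulNmx scalerN kD oppr0 !mulmx0.
Qed.

Lemma gm_sym : (gm g c p)^T = gm g c p.
Proof. exact: (gram_sym fF sc Wp cp). Qed.

Lemma curvature_aop X Y Z :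
  curvature g c p X Y Z = (aop X *m aop Y - aop Y *m aop X) *m Z
    + k *: (X *m (Y^T *m gm g c p *m Z)) - k *: (Y *m (X^T *m gm g c p *m Z)).
Proof.
have uG := gram_unit fF sc Wp cp.
apply: (can_inj (mulKmx uG)); rewrite (gauss_equation fF sc) // !sffm_aop.
have e U V : (dd c (jac c F) p U)^T *m (J *m (T *m aop V) *m Z)
    = gm g c p *m (aop U *m aop V *m Z).
  rewrite !mulmxA -aop_sym gm_aop; trx; by rewrite !mulmxA.
rewrite !e mulmxBr mulmxDr mulmxBl mulmxBr -!scalemxAr !mulmxA; mxlin.
Qed.

Lemma gm_pos X : dot X (gm g c p *m X) = 0 -> X = 0.
Proof.
rewrite (gram_frame fF sc) // -mulmxA -dot_mulmxl => /(@dot_eq0 _ _ (T *m X)) e.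
have uG := gram_unit fF sc Wp cp.
rewrite -[X](mulKmx uG) (gram_frame fF sc) // -mulmxA.
by rewrite e !mulmx0.
Qed.

(** The sectional curvature differs from [k] by the commutator of the shape
   operators. *)
Lemma gdot_curvature X Y :
  gdot g c p (curvature g c p X Y Y) X
    = dot X (gm g c p *m (aop X *m aop Y - aop Y *m aop X) *m Y)
      + k * area2 g c p X Y.
Proof.
rewrite /area2 /gdot gmE curvature_aop; move: (gm g c p) gm_sym => G GT.
have e A B : A^T *m G *m B = (dot A (G *m B))%:M by rewrite -mulmxA dotE.
rewrite !e !mul_mx_scalar dotC !dotDr dotNr !dotZr !dot_mulmxl GT !mulmxA.
rewrite expr2; ring.
Qed.

(** Degenerate planes, on which the sectional curvature says nothing, are
   spanned by dependent vectors, for which the commutator vanishes anyway. *)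
Lemma aop_commute_at : (forall X Y, area2 g c p X Y != 0 ->
    sectional_curvature g c p X Y = k) ->
  forall X Y, aop X *m aop Y = aop Y *m aop X.
Proof.
move=> cc; apply: (commute_of_sectional (gram_unit fF sc Wp cp) aopD aopC aop_sym _ gm_sym).
move=> X Y; have [a0|a0] := eqVneq (area2 g c p X Y) 0; last first.
  have := cc X Y a0; rewrite /sectional_curvature gdot_curvature.
  move/(congr1 (fun z => z * area2 g c p X Y)); rewrite divfK // => /eqP.
  by rewrite -subr_eq0 addrK => /eqP.
have [X0|X0] := eqVneq (dot X (gm g c p *m X)) 0.
  by rewrite (gm_pos X0) /dot trmx0 mul0mx mxE.
pose t := dot X (gm g c p *m Y) / dot X (gm g c p *m X).
have -> : Y = t *: X.
  apply/eqP; rewrite -subr_eq0; apply/eqP; apply: gm_pos.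
  move: a0; rewrite /area2 /gdot gmE => a0.
  have sG : dot Y (gm g c p *m X) = dot X (gm g c p *m Y).
    by rewrite dotC dot_mulmxl gm_sym.
  rewrite mulmxBr -scalemxAr dotDr dotNr dotZr !(dotC (Y - _)) !dotDr !dotNr !dotZr.
  rewrite !(dotC (gm g c p *m _)) sG /t; move: X0 a0.
  move: (dot X _) (dot Y _) (dot X _) => x y z X0 a0.
  by apply: (mulfI X0); rewrite mulr0 -[RHS]a0; field.
have -> : aop X *m aop (t *: X) - aop (t *: X) *m aop X = 0.
  by rewrite aopZ -scalemxAr -scalemxAl subrr.
by rewrite mulmx0 mul0mx dot0r.
Qed.

Lemma sectional_of_commute :
  (forall X Y, aop X *m aop Y = aop Y *m aop X) ->
  forall X Y, area2 g c p X Y != 0 -> sectional_curvature g c p X Y = k.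
Proof.
move=> ac X Y a0; rewrite /sectional_curvature gdot_curvature ac subrr mulmx0 mul0mx.
by rewrite dot0r add0r mulfK.
Qed.

End AtPoint.

Lemma aop_commute : constant_curvature g W k -> forall p, W p -> cdom c p ->
  forall X Y, aop g F c p X *m aop g F c p Y = aop g F c p Y *m aop g F c p X.
Proof.
by move=> cc p Wp cp; apply: aop_commute_at => // X Y; apply: cc.
Qed.

End LagrangianFrames.

Section Admissible.
Context {R : realType} {n : nat} {M : manifold R n}.
Variables (S : setting R) (W : set M) (g : M -> 'M[R]_n).
Variable F : M -> ambient R n S.
Local Notation k := (curv S).
Local Notation J := (Jmx : 'M[R]_(cdim n S + cdim n S)).

Lemma metric_unit (G : 'M[R]_n) :
  (forall X : 'cV[R]_n, X != 0 -> 0 < dot X (G *m X)) -> G \in unitmx.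
Proof.
move=> pG; rewrite -unitmx_tr -row_free_unit -kermx_eq0; apply/negPn/negP.
move=> /rowV0Pn[v /sub_kermxP vk v0].
have vT0 : v^T != 0 by apply: contraNneq v0 => e; rewrite -[v]trmxK e trmx0.
have := pG _ vT0; suff -> : G *m v^T = 0 by rewrite dot0r ltxx.
by rewrite -[LHS]trmxK trmx_mul trmxK vk trmx0.
Qed.

Lemma framed_of_admissible : admissible_immersion W g F -> framed W g F.
Proof.
move=> [oW [pg _] _ [sF iF] hS]; split => //.
  by move=> p Wp; apply: metric_unit; have [_] := pg p Wp.
move=> p Wp; clear iF pg.
have dF : diffat (chart_at p) F p.
  exact: smooth_in_diffat (sF _ (smooth_chart_at p)) Wp (chart_at_dom p).
move: dF sF hS; move: (F) => F'; case: S F' => [|c] F' dF sF /= hS.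
  by rewrite scale0r !mul0r.
have [c0 h] := hS; have [FF _] := h p Wp.
have cn : c != 0 by rewrite gt_eqF.
split; last by rewrite FF mulfV // mulr1.
have e : dd (chart_at p) (fun q => (F' q)^T *m F' q) p = fun=> 0.
  apply/funext => X.
  rewrite (dd_ext _ oW Wp (chart_at_dom p) (h2 := fun=> (c^-1)%:M)) ?dd_cst //.
  by move=> q Wq _; rewrite dotE; have [-> _] := h q Wq.
rewrite [X in _ *: X](_ : _ = 0) ?scaler0 //.
have e1 (X : 'cV[R]_n) : (F' p)^T *m (jac (chart_at p) F' p *m X) = 0.
  have := congr1 (fun f => f X) e.
  rewrite (dd_mulmx _ (chart_at_dom p) (diffat_trmx dF) dF) (dd_trmx _ dF) (dd_jac _ dF).
  rewrite -[X in X + _]trmxK trmx_mul trmxK => /eqP; rewrite addr_eq0 => /eqP.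
  exact: mx11_skew.
rewrite -[LHS]trmxK trmx_mul trmxK; suff -> : (F' p)^T *m diffl F' p = 0 by rewrite trmx0.
apply: eq_col_mul => X; rewrite -mulmxA mul0mx -(e1 X).
by rewrite -jacE.
Qed.

(** The form [<X, J Y>] on the tangent space is skew; differentiating the orthogonality of [J F]
   and [F_* Y] shows that it is also symmetric, the second derivatives being so. *)
Lemma isotropic_of_horizontal : framed W g F ->
  (forall p, W p -> (F p)^T *m J *m diffl F p = 0) ->
  forall p, W p -> (diffl F p)^T *m J *m diffl F p = 0.
Proof.
move=> fF h p Wp; have [oW sF _ _ _] := fF; pose c := chart_at p.
have sc : smooth_chart c := smooth_chart_at p.
have cp : cdom c p := chart_at_dom p.
have dJ := diffat_jac fF sc Wp cp; have dF := diffat_F fF sc Wp cp.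
have dFJ : diffat c (fun q => (F q)^T *m J) p.
  by apply: diffat_mulmx; [exact: diffat_trmx|exact: diffat_cst].
have e X : (jac c F p *m X)^T *m J *m jac c F p = - ((F p)^T *m J *m dd c (jac c F) p X).
  have : dd c (fun q => (F q)^T *m J *m jac c F q) p X = 0.
    rewrite (dd_ext _ oW Wp cp (h2 := fun=> 0)) ?dd_cst // => q Wq cq.
    by rewrite (jac_diffl sc sF Wq cq) mulmxA h // mul0mx.
  rewrite (dd_mulmx _ cp dFJ dJ) (dd_mulmx _ cp (diffat_trmx dF) (diffat_cst c J p)).
  rewrite dd_cst mulmx0 addr0 (dd_trmx _ dF) (dd_jac _ dF).
  by move/eqP; rewrite addr_eq0 => /eqP.
have -> : diffl F p = jac c F p by rewrite -jacE.
set A := _^T *m J *m _.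
have AT : A^T = - A.
  by rewrite /A !trmx_mul trmxK JmxT; mxx.
have sA (X Y : 'cV[R]_n) : X^T *m A *m Y = Y^T *m A *m X.
  have eA (U V : 'cV[R]_n) :
      U^T *m A *m V = - ((F p)^T *m J *m (dd c (jac c F) p U *m V)).
    by rewrite [in RHS]mulmxA -mulNmx -e trmx_mul /A !mulmxA.
  by rewrite !eA (dd_jac_sym fF sc).
clearbody A; apply: eq_col_mul => Y; rewrite mul0mx; apply: dot_eq0.
have XAY (X : 'cV[R]_n) : X^T *m A *m Y = 0.
  apply: mx11_skew; rewrite [in RHS]sA !trmx_mul trmxK AT.
  by rewrite mulNmx mulmxN mulmxA.
by rewrite /dot mulmxA XAY mxE.
Qed.

Lemma lframed_of_admissible : admissible_immersion W g F -> lframed W g F.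
Proof.
move=> ha; have fF := framed_of_admissible ha.
have [oW _ _ [sF _] hS] := ha.
have hpos : positive_setting S by move: hS; clear; case: S F => //= c F' [].
have hk p : W p -> k != 0 -> (F p)^T *m J *m diffl F p = 0.
  move=> Wp; move: hS; clear -Wp; move: (F) => F'; case: S F' => [|c] F' /= hS.
    by rewrite eqxx.
  move=> _; have [c0 /(_ p Wp) [_ [h _]]] := hS.
  have sn : Num.sqrt c != 0 by rewrite sqrtr_eq0 -ltNge.
  move/eqP: h; rewrite -scalemxAr scaler_eq0 (negPf sn) => /eqP /(congr1 trmx).
  rewrite !trmx_mul trmxK JmxT trmx0; mxx => /eqP.
  by rewrite oppr_eq0 => /eqP.
split => // p Wp; have [k0|k0] := eqVneq k 0; last first.
  rewrite hk // scaler0; split => //.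
  by apply: isotropic_of_horizontal fF _ _ Wp => q Wq; exact: hk.
rewrite k0 scale0r; split => //.
move: hS k0 hpos; clear -Wp; move: (F) => F'; case: S F' => [|c] F' /= hS k0 hpos.
  apply: eq_col_mul => X; rewrite mul0mx -!mulmxA.
  by have [_ /(_ (ex_intro _ X erefl)) []] := hS p Wp (Jmx *m (diffl F' p *m X)).
by rewrite k0 ltxx in hpos.
Qed.

(** A vector orthogonal to the tangent space is [J] of a tangent vector, as the
   tangent space and its image under [J] span the whole space. *)
Lemma horizontal_of_lframed : lframed W g F ->
  (forall p, W p -> match S with
     Lagrangian => True | Horizontal c => dot (F p) (F p) = c^-1 end) ->
  lagrangian_or_horizontal W F.
Proof.
move=> lF hF; have [hp fF h] := lF.
have tl p Wp := tproj_lagrangian lF (smooth_chart_at p) Wp (chart_at_dom p).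
have gf p Wp := normal_jac fF (smooth_chart_at p) Wp (chart_at_dom p).
move: hp h hF tl; clear gf lF fF; move: (F) => F'; case: S F' => [|c] F' /= hp h hF tl.
  move=> p Wp xi; split.
    move=> [nx _]; exists (invmx (gm g (chart_at p) p) *m ((jac (chart_at p) F' p)^T *m (Jmx^T *m xi))).
    have := congr1 (mulmx^~ xi) (tl p Wp); rewrite mul1mx mulmxDl /tproj /= scale0r addr0.
    rewrite -!mulmxA -jacE -[Jac _ _ _]/(diffl F' p) nx !mulmx0 add0r => e.
    by rewrite -[LHS]e.
  move=> [X ->]; split => //; have [_ iT] := h p Wp.
  by rewrite !mulmxA iT mul0mx.
split => // p Wp; split; first exact: hF.
have [kF _] := h p Wp; have cn : c != 0 by rewrite gt_eqF.
split.
  move/eqP: kF; rewrite scaler_eq0 (negPf cn) => /eqP /(congr1 trmx).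
  rewrite !trmx_mul trmxK JmxT trmx0 mulNmx mulmxN => /eqP; rewrite oppr_eq0 => /eqP kF.
  by rewrite -scalemxAr kF scaler0.
have := quad_Jmx (F' p); rewrite -mulmxA dotE => e.
rewrite dotZr; have -> : dot (F' p) (Jmx *m F' p) = 0.
  by have /matrixP/(_ 0 0) := e; rewrite !mxE eqxx mulr1n.
by rewrite mulr0.
Qed.

End Admissible.

(** * The differential of calG *)

(** In both cases [beta = J H P] and [calG = H + J H P] for this section [H] of
   V^* (x) C^m; in the horizontal case the position vector contributes to it as one
   more tangent direction. *)
HB.lock Definition cH {R : realType} {n : nat} {M : manifold R n} {S : setting R}
    (g : M -> 'M[R]_n) (F : M -> ambient R n S) {l : nat}
    (d : ribdata R M (cdim n S + cdim n S) l) (c : chart R n M) (p : M)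
    : 'M[R]_(cdim n S + cdim n S, l) :=
  jac c F p *m om g (rphi d) c p + curv S *: (F p *m (rphi d p)^T).

Section BetaCondition.
Context {R : realType} {n : nat} {M : manifold R n}.
Variables (S : setting R) (W : set M) (g : M -> 'M[R]_n).
Variable F : M -> ambient R n S.
Hypothesis lF : lframed W g F.
Context {l : nat}.
Variable d : ribdata R M (cdim n S + cdim n S) l.
Hypothesis sphi : smooth_on W (rphi d).
Variable P : 'M[R]_l.
Variable c : chart R n M.
Hypothesis sc : smooth_chart c.
Variable p : M.
Hypotheses (Wp : W p) (cp : cdom c p).
Local Notation J := (Jmx : 'M[R]_(cdim n S + cdim n S)).

Lemma F_omega_tE : F_omega_t g F d p = jac c F p *m om g (rphi d) c p.
Proof.
have [_ fF _] := lF; have [_ sF _ _ _] := fF.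
by rewrite /F_omega_t (frame_change fF sc sF sphi Wp cp) om.unlock mulmxA.
Qed.

(** In the horizontal case the projection of the definition acts trivially on
   [J F_* X], which is orthogonal to the position vector, and the two factors
   [sqrt c] combine to [c]. *)
Lemma beta_conditionE :
  beta_condition g F d P p <-> rbeta d p = J *m cH g F d c p *m P.
Proof.
have FE := F_omega_tE; have [hp _ _] := lF; have [iF _] := jac_isotropic lF sc Wp cp.
rewrite cH.unlock /beta_condition; move: FE hp iF.
move: (jac c F p) (om g _ c p) => T O; clear lF; move: (F) d sphi T.
case: S => [|c0] F' d' sphi' T /= FE hp iF; rewrite FE.
  by rewrite scale0r addr0 mulmxA.
have cn : c0 != 0 by rewrite gt_eqF.
have {}iF : (F' p)^T *m Jmx *m T = 0 by move/eqP: iF; rewrite scaler_eq0 (negPf cn) => /eqP.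
suff -> : (Jmx - c0 *: (F' p *m (F' p)^T *m Jmx)) *m (T *m O) +
    Num.sqrt c0 *: (Num.sqrt c0 *: (Jmx *m F' p) *m (rphi d' p)^T)
  = Jmx *m (T *m O + c0 *: (F' p *m (rphi d' p)^T)) by [].
have -> : (Jmx - c0 *: (F' p *m (F' p)^T *m Jmx)) *m (T *m O) = Jmx *m (T *m O).
  rewrite mulmxA mulmxBl -scalemxAl -(mulmxA (F' p)) -(mulmxA (F' p) _ T) iF.
  by rewrite mulmx0 scaler0 subr0 mulmxA.
rewrite (mulmxDr Jmx); congr (_ + _).
by rewrite -scalemxAl scalerA -expr2 sqr_sqrtr ?ltW // -scalemxAr mulmxA.
Qed.

Section ChartFormulas.
Local Notation Pr := (tproj g F c p).
Local Notation T := (jac c F p).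
Local Notation H := (cH g F d c p).
Local Notation O := (om g (rphi d) c p).
Local Notation k := (curv S).
Let fF : framed W g F. Proof. by case: lF. Qed.

Lemma tproj_cH : Pr *m H = H.
Proof.
have e1 := tproj_jac fF sc Wp cp; have e2 := tproj_F fF sc Wp cp.
rewrite cH.unlock mulmxDr mulmxA e1 -scalemxAr mulmxA; congr (_ + _).
by rewrite scalemxAl e2 -scalemxAl.
Qed.

Lemma om_gm : gm g c p *m O = (jac c (rphi d) p)^T.
Proof. by rewrite om.unlock mulKVmx // (gram_unit fF sc). Qed.

Lemma om_gmT : O^T *m gm g c p = jac c (rphi d) p.
Proof. by rewrite -[LHS]trmxK trmx_mul trmxK (gm_sym lF sc Wp cp) om_gm trmxK. Qed.

Lemma cH_jac : H^T *m T = jac c (rphi d) p.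
Proof.
have e1 := position_normal fF sc Wp cp.
have e2 : k *: ((F p)^T *m T) = 0.
  by rewrite -[LHS]trmxK trmxZ trmx_mul trmxK e1 trmx0.
rewrite cH.unlock; trx; rewrite mulmxDl -mulmxA -(gram_frame fF sc) // om_gmT.
by rewrite -scalemxAl -mulmxA scalemxAr e2 mulmx0 addr0.
Qed.

Lemma cH_F : k *: (H^T *m F p) = k *: rphi d p.
Proof.
have e1 := position_normal fF sc Wp cp; have [_ _ _ _ /(_ p Wp)[_ kk]] := fF.
rewrite cH.unlock; trx; rewrite mulmxDl scalerDr -mulmxA scalemxAr e1 mulmx0 add0r.
by rewrite -scalemxAl -mulmxA dotE mul_mx_scalar !scalerA -mulrA kk.
Qed.

Lemma cH_sq : H^T *m H = omega_omega_t g d p + k *: (rphi d p *m (rphi d p)^T).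
Proof.
have [_ sF _ _ _] := fF.
rewrite /omega_omega_t (frame_change fF sc sphi sphi Wp cp) {2}cH.unlock mulmxDr.
rewrite mulmxA cH_jac om.unlock mulmxA; congr (_ + _).
by rewrite -scalemxAr mulmxA scalemxAl cH_F -scalemxAl.
Qed.

Lemma cG_of_beta : rbeta d p = J *m H *m P -> cG g F d p = H + J *m H *m P.
Proof.
move=> b; rewrite (calG_chart fF sphi sc Wp cp) b.
by rewrite {2}cH.unlock addrAC; congr (_ + _).
Qed.

End ChartFormulas.

End BetaCondition.

Section PTransforms.
Context {R : realType} {n : nat} {M : manifold R n}.
Variables (S : setting R) (W : set M) (g : M -> 'M[R]_n).
Variable F : M -> ambient R n S.
Context {l : nat}.
Variable d : ribdata R M (cdim n S + cdim n S) l.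
Variable P : 'M[R]_l.
Hypothesis hP : P_transform W g F d P.
Local Notation k := (curv S).
Local Notation J := (Jmx : 'M[R]_(cdim n S + cdim n S)).

Lemma ptransform_lframed : lframed W g F.
Proof. by case: hP => ha _ _ _ _; exact: lframed_of_admissible. Qed.
Let lF := ptransform_lframed.
Let fF : framed W g F. Proof. by case: lF. Qed.
Let oW : open W. Proof. by case: fF. Qed.
Let sphi : smooth_on W (rphi d). Proof. by case: hP => _ [[]]. Qed.
Let sbeta : smooth_on W (rbeta d). Proof. by case: hP => _ [[]]. Qed.
Lemma ptransform_unit p : W p -> rOmega d p \in unitmx.
Proof. by case: hP => _ [_ [_ [_ [h _]]]] _ _ _; exact: h. Qed.
Lemma ptransform_spectrum : spectrum_condition P.
Proof. by case: hP. Qed.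
Let uP : P \in unitmx := spectrum_unit ptransform_spectrum.

Variable c : chart R n M.
Hypothesis sc : smooth_chart c.

Lemma smooth_cG_P : smooth_in c W (cG g F d).
Proof. exact: (smooth_cG fF sphi sbeta sc). Qed.

Section AtPoint.
Variable p : M.
Hypotheses (Wp : W p) (cp : cdom c p).
Local Notation Pr := (tproj g F c p).
Local Notation T := (jac c F p).
Local Notation H := (cH g F d c p).
Local Notation G := (cG g F d p).
Local Notation O := (om g (rphi d) c p).
Local Notation a := (aop g F c p).

Lemma P_aopC X Y : a X *m a Y = a Y *m a X.
Proof.
by apply: (aop_commute lF sc _ Wp cp); case: hP => -[_ _ cc _ _] _ _ _ _.
Qed.

Lemma betaE : rbeta d p = J *m H *m P.
Proof. by apply/(beta_conditionE lF sphi P sc Wp cp); case: hP => _ _ _ h _; exact: h. Qed.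

Lemma cG_cH : G = H + J *m H *m P.
Proof. exact: (cG_of_beta lF sphi sc Wp cp betaE). Qed.

Lemma P_linking : linking J H P (rOmega d p).
Proof.
have [_ [_ [_ [_ [_ [_ h1]]]]] _ _ h2] := hP; split.
  by rewrite -cG_cH h1 // cG.unlock.
have := h2 p Wp; rewrite /P_rho (cH_sq lF sphi sc Wp cp).
rewrite (_ : _ + k *: _ = P^T *m (omega_omega_t g d p + k *: (rphi d p *m (rphi d p)^T)) *m P) //.
by rewrite mulmxDr mulmxDl -scalemxAr -scalemxAl !mulmxA.
Qed.

Lemma P_dOm X : dd c (rOmega d) p X = G^T *m dd c (cG g F d) p X.
Proof.
have [_ [_ [_ [_ [_ [h _]]]]] _ _ _] := hP.
by have := h c sc p Wp cp X; rewrite !ddE cGE.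
Qed.

Lemma P_normal_dG X : (1%:M - Pr) *m dd c (cG g F d) p X = 0.
Proof.
apply: eq_col_mul => v; rewrite mul0mx (normal_dd_cG fF sphi sbeta sc) //.
have [_ [_ [_ [h _]]] _ _ _] := hP.
by have [] := h c sc p Wp cp X 0 v.
Qed.

(** The normal part of [d calG] vanishes, and that of [dH] is [J F_* a_X omega^t];
   as [calG = H + J H P] and [P] is invertible, this determines the tangential part of [dH].
   In other words, [Phi_v] is the shape operator in the direction
   [- J F_* omega^t (P + P^-1) v]. *)
Lemma P_dG X : dd c (cG g F d) p X = - (T *m a X *m O *m (P + invmx P)).
Proof.
have oWc : open (W `&` cdom c) by apply: openI => //; exact: cdom_open.
have Wcp : (W `&` cdom c) p by [].
have dJ := diffat_jac fF sc Wp cp; have dF := diffat_F fF sc Wp cp.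
have dom : diffat c (om g (rphi d) c) p.
  exact: smooth_in_diffat (smooth_om fF sphi sc) Wcp cp.
have dphi : diffat c (rphi d) p by exact: smooth_in_diffat (sphi sc) Wp cp.
have dFphi : diffat c (fun q => F q *m (rphi d q)^T) p.
  by apply: diffat_mulmx => //; exact: diffat_trmx.
pose Hf q := jac c F q *m om g (rphi d) c q + k *: (F q *m (rphi d q)^T).
have dHf : diffat c Hf p.
  by apply: diffat_add; [exact: diffat_mulmx|exact: diffat_scale].
have dHE : dd c Hf p X = dd c (jac c F) p X *m O + T *m dd c (om g (rphi d) c) p X
    + k *: (T *m X *m (rphi d p)^T + F p *m (jac c (rphi d) p *m X)^T).
  rewrite (dd_add _ (diffat_mulmx dJ dom) (diffat_scale _ dFphi)).
  rewrite (dd_mulmx _ cp dJ dom) (dd_scale _ _ dFphi).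
  rewrite (dd_mulmx _ cp dF (diffat_trmx dphi)) (dd_trmx _ dphi).
  by rewrite (dd_jac _ dF) (dd_jac _ dphi).
have nH : (1%:M - Pr) *m dd c Hf p X = J *m (T *m a X *m O).
  have nT : (1%:M - Pr) *m T = 0.
    by rewrite mulmxBl mul1mx (tproj_jac fF sc) // subrr.
  have nF : k *: ((1%:M - Pr) *m F p) = 0.
    by rewrite mulmxBl mul1mx scalerBr (tproj_F fF sc) // subrr.
  rewrite dHE !mulmxDr !mulmxA nT mul0mx addr0 -/(sffm g F c p X) (sffm_aop lF sc Wp cp).
  rewrite -scalemxAr mulmxDr !mulmxA nT !mul0mx add0r scalemxAl nF mul0mx addr0.
  by [].
have cJ : diffat c (fun=> J) p by exact: diffat_cst.
have cP : diffat c (fun=> P) p by exact: diffat_cst.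
have dG : dd c (cG g F d) p X = dd c Hf p X + J *m dd c Hf p X *m P.
  rewrite (dd_ext _ oWc Wcp cp (h2 := fun q => Hf q + J *m Hf q *m P)); last first.
    move=> q [Wq cq] _.
    rewrite (calG_chart fF sphi sc Wq cq) /Hf.
    have -> : rbeta d q = J *m cH g F d c q *m P.
      apply/(beta_conditionE lF sphi P sc Wq cq).
      by case: hP => _ _ _ h _; exact: h.
    by rewrite cH.unlock addrAC.
  rewrite (dd_add _ dHf (diffat_mulmx (diffat_mulmx cJ dHf) cP)).
  rewrite (dd_mulmx _ cp (diffat_mulmx cJ dHf) cP) (dd_mulmx _ cp cJ dHf) !dd_cst.
  by rewrite mul0mx add0r mulmx0 addr0.
have n0 := P_normal_dG X; rewrite dG in n0 *.
move: n0 nH; rewrite mulmxDr; move: (dd c Hf p X) (T *m a X *m O) => h t n0 nh.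
have JPr := tproj_Jl lF sc Wp cp.
move: n0; rewrite nh !mulmxA -JPr => n0.
have JJ := @JmxJ R (cdim n S).
clear dHE; move: (tproj g F c p) n0 nh JPr => Q n0 nh JPr.
have Pih : Q *m h *m P = - t.
  have := congr1 (mulmx (- J)) n0; rewrite mulmx0 mulmxDr !mulmxA !mulNmx JJ; mxx.
  by move=> /eqP; rewrite addrC addr_eq0 => /eqP.
have Pih' : Q *m h = - (t *m invmx P) by rewrite -mulNmx -Pih mulmxK.
have hE : h = J *m t - t *m invmx P.
  by rewrite -Pih' -nh mulmxBl mul1mx subrK.
rewrite {1}hE {1}hE mulmxBr mulmxBl !mulmxA JJ !mulNmx mul1mx mulmxKV // mulmxDr; mxlin.
Qed.

End AtPoint.

End PTransforms.

(** * The geometry of the transform *)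

Section RegularPoints.
Context {R : realType}.

(** Over the reals a Gram matrix has the rank of the vectors. *)
Lemma gram_rank m n (T : 'M[R]_(m, n)) : (\rank T = n) <-> T^T *m T \in unitmx.
Proof.
split=> h; last first.
  apply/eqP; rewrite eqn_leq rank_leq_col /=.
  by rewrite -{1}(mxrank_unit h) mxrankM_maxr.
rewrite -unitmx_tr trmx_mul trmxK -row_free_unit -kermx_eq0; apply/negPn/negP.
move=> /rowV0Pn[v /sub_kermxP vk v0].
have e : T *m v^T = 0.
  by apply: dot_eq0; rewrite /dot trmx_mul trmxK mulmxA -(mulmxA v) vk mul0mx mxE.
have : row_free T^T by rewrite /row_free mxrank_tr h.
move=> /row_free_inj/(_ v 0) i; rewrite i ?eqxx // in v0.
by rewrite mul0mx -[LHS]trmxK trmx_mul trmxK e trmx0.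
Qed.

Context {n : nat} {M : manifold R n}.

Lemma diffl_rank m (W : set M) (F : M -> 'cV[R]_m) c p :
  smooth_on W F -> smooth_chart c -> W p -> cdom c p ->
  \rank (diffl F p) = \rank (jac c F p).
Proof.
move=> sF sc Wp cp; rewrite (jac_diffl sc sF Wp cp) mxrankMfree // row_free_unit.
by apply: jac_unit.
Qed.

Lemma regular_open m (W : set M) (F : M -> 'cV[R]_m) :
  open W -> smooth_on W F -> open (regular_points W F).
Proof.
move=> oW sF; rewrite openE => p [Wp /= rp].
pose c := chart_at p; have cp : cdom c p := chart_at_dom p.
have sc : smooth_chart c := smooth_chart_at p.
have dJ : diffat c (jac c F) p.
  exact: smooth_in_diffat (smooth_in_jac oW (sF c sc)) Wp cp.
have nu := near_unitmx (diffat_mulmx (diffat_trmx dJ) dJ).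
have {nu} nu : \forall y \near cmap c p, (jac c F (cinv c y))^T *m jac c F (cinv c y) \in unitmx.
  apply: nu; rewrite /= cmapK //; apply/gram_rank.
  by rewrite -(diffl_rank sF sc Wp cp).
have nW : \forall q \near p, W q by exact: open_nbhs_nbhs.
have nc : \forall q \near p, cdom c q.
  by apply: open_nbhs_nbhs; split => //; exact: cdom_open.
have nq : \forall q \near p, (jac c F (cinv c (cmap c q)))^T *m jac c F (cinv c (cmap c q)) \in unitmx.
  exact: (cmap_continuous cp nu).
apply: filterS3 nW nc nq => q Wq cq; rewrite cmapK // => uq; split => //=.
by rewrite (diffl_rank sF sc Wq cq); apply/gram_rank.
Qed.

Lemma admissible_of_lframed (S : setting R) (W : set M) (F : M -> ambient R n S) :
  lframed W (induced_metric F) F -> constant_curvature (induced_metric F) W (curv S) ->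
  admissible_immersion W (induced_metric F) F.
Proof.
move=> lF cc; have [pS fF _] := lF; have [oW sF _ ug kF] := fF; split => //.
- split=> [p Wp|c sc].
    split; first by rewrite /induced_metric trmx_mul trmxK.
    move=> X; apply: contraNT; rewrite -leNgt /induced_metric -mulmxA -dot_mulmxl => h.
    have := dot_ge0 (diffl F p *m X) => h'.
    have e : diffl F p *m X = 0 by apply: dot_eq0; apply/eqP; rewrite eq_le h h'.
    have u := ug p Wp; rewrite -[X](mulKmx u) /induced_metric -mulmxA e !mulmx0.
    by rewrite eqxx.
  rewrite (_ : gram _ c = gm (induced_metric F) c); last by apply/funext => q; rewrite gmE.
  exact: (smooth_gram fF sc).
- apply: horizontal_of_lframed lF _ => p Wp; have [_] := kF p Wp.
  move: pS; clear; case: S F => [|c] F //= c0.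
  have cn : c != 0 by rewrite gt_eqF.
  move=> h; have /(mulfI cn) e : c * (c * dot (F p) (F p)) = c * 1 by rewrite mulr1.
  by apply: (mulfI cn); rewrite e mulfV.
Qed.

End RegularPoints.

Lemma congruent_inv (R : realType) n (D G : 'M[R]_n) : D \in unitmx -> G \in unitmx ->
  D *m invmx (D^T *m G *m D) *m D^T = invmx G.
Proof.
move=> uD uG; have uDT : D^T \in unitmx by rewrite unitmx_tr.
have u : D^T *m G *m D \in unitmx by rewrite !unitmx_mul uDT uG.
apply: (can_inj (mulKmx uG)); apply: (can_inj (mulKmx uDT)).
by rewrite mulmxV // mulmx1 !mulmxA mulmxV // mul1mx.
Qed.

Section TransformGeometry.
Context {R : realType} {n : nat} {M : manifold R n}.
Variables (S : setting R) (W : set M) (g : M -> 'M[R]_n).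
Variable F : M -> ambient R n S.
Context {l : nat}.
Variable d : ribdata R M (cdim n S + cdim n S) l.
Variable P : 'M[R]_l.
Hypothesis hP : P_transform W g F d P.
Variable Ft : M -> ambient R n S.
Hypothesis FtE : forall p, Ft p = F p - cG g F d p *m invmx (rOmega d p) *m rphi d p.
Variable CP : M -> 'M[R]_(cdim n S + cdim n S).
Hypothesis CPE : forall p,
  CP p = 1%:M - cG g F d p *m invmx (rOmega d p) *m (cG g F d p)^T.
Local Notation k := (curv S).
Local Notation J := (Jmx : 'M[R]_(cdim n S + cdim n S)).

Let lF := ptransform_lframed hP.
Let fF : framed W g F. Proof. by case: lF. Qed.
Let oW : open W. Proof. by case: fF. Qed.
Let sphi : smooth_on W (rphi d). Proof. by case: hP => _ [[]]. Qed.
Let sOm : smooth_on W (rOmega d). Proof. by case: hP => _ [[]]. Qed.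
Let uP : P \in unitmx := spectrum_unit (ptransform_spectrum hP).
Let uOm p (Wp : W p) : rOmega d p \in unitmx := ptransform_unit hP Wp.
Let JJ : J *m J = - 1%:M := @JmxJ R (cdim n S).
Let JT : J^T = - J := @JmxT R (cdim n S).

(** The direction in which the shape operator measures how much the transform
   distorts the tangent spaces. *)
Definition twist (c : chart R n M) (p : M) : 'cV[R]_n :=
  om g (rphi d) c p *m (P + invmx P) *m invmx (rOmega d p) *m rphi d p.

Definition distortion (c : chart R n M) (p : M) : 'M[R]_n :=
  1%:M + aop g F c p (twist c p).

Section InChart.
Variable c : chart R n M.
Hypothesis sc : smooth_chart c.

Let smooth_invOm : smooth_in c W (fun q => invmx (rOmega d q)).
Proof. by apply: smooth_in_invmx => //; exact: sOm. Qed.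

Lemma smooth_transform : smooth_in c W Ft.
Proof.
apply: (@smooth_in_ext _ _ _ _ _ c W (fun p =>
  F p - cG g F d p *m invmx (rOmega d p) *m rphi d p)) => //.
apply: smooth_in_add => //; first exact: (smooth_frame fF sc).
apply: smooth_in_opp => //; apply: smooth_in_mulmx => //; last exact: sphi.
apply: smooth_in_mulmx => //; exact: (smooth_cG_P hP sc).
Qed.

Section AtPoint.
Variable p : M.
Hypotheses (Wp : W p) (cp : cdom c p).
Local Notation Pr := (tproj g F c p).
Local Notation T := (jac c F p).
Local Notation H := (cH g F d c p).
Local Notation G := (cG g F d p).
Local Notation O := (om g (rphi d) c p).
Local Notation a := (aop g F c p).
Local Notation Om := (rOmega d p).
Local Notation D := (distortion c p).

Let PrT : Pr^T = Pr. Proof. exact: (tprojT fF sc Wp cp). Qed.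
Let PrJac : Pr *m T = T. Proof. exact: (tproj_jac fF sc Wp cp). Qed.
Let PrJPr : Pr *m J *m Pr = 0. Proof. exact: (tproj_J lF sc Wp cp). Qed.
Let prH : Pr *m H = H. Proof. exact: (tproj_cH lF d sc Wp cp). Qed.
Let GE : G = H + J *m H *m P. Proof. exact: (cG_cH hP sc Wp cp). Qed.
Let hl : linking J H P Om. Proof. exact: (P_linking hP sc Wp cp). Qed.
Let dG : diffat c (cG g F d) p.
Proof. exact: smooth_in_diffat (smooth_cG_P hP sc) Wp cp. Qed.
Let dOm : diffat c (rOmega d) p. Proof. exact: smooth_in_diffat (sOm sc) Wp cp. Qed.
Let dphi : diffat c (rphi d) p. Proof. exact: smooth_in_diffat (sphi sc) Wp cp. Qed.
Let dinv : diffat c (fun q => invmx (rOmega d q)) p.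
Proof. by apply: diffat_invmx => //; exact: uOm. Qed.
Let dFt : diffat c Ft p. Proof. exact: smooth_in_diffat smooth_transform Wp cp. Qed.

Lemma cG_jac : G^T *m T = jac c (rphi d) p.
Proof.
have e := GPi JT PrT PrJPr prH GE.
by rewrite -[in LHS]PrJac mulmxA e (cH_jac lF d sc).
Qed.

Lemma calP_orth : (CP p)^T *m CP p = 1%:M.
Proof. exact: (CP_orth (uOm Wp) GE hl (CPE p)). Qed.

(** [calP] carries the tangent spaces to those of the transform. *)
Lemma jac_transform : jac c Ft p = CP p *m T *m D.
Proof.
apply: eq_col_mul => X; rewrite -(dd_jac _ dFt).
have dF := diffat_F fF sc Wp cp.
have dGi := diffat_mulmx dG dinv.
rewrite (dd_ext _ oW Wp cp (h2 := fun q =>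
  F q - cG g F d q *m invmx (rOmega d q) *m rphi d q)) //.
rewrite (dd_add _ dF (diffat_opp (diffat_mulmx dGi dphi))) (dd_opp _ (diffat_mulmx dGi dphi)).
rewrite (dd_mulmx _ cp dGi dphi) (dd_mulmx _ cp dG dinv) (dd_invmx _ cp dOm) ?uOm //.
rewrite (P_dOm hP sc) // (dd_jac _ dF) (dd_jac _ dphi) -cG_jac.
have PG := P_dG hP sc Wp cp X; rewrite {}PG.
have aE : a X *m O *m (P + invmx P) *m invmx Om *m rphi d p = a (twist c p) *m X.
  by rewrite -!mulmxA -(aopC lF sc Wp cp) /twist !mulmxA.
have -> : CP p *m T *m D *m X = CP p *m T *m X
    + CP p *m T *m (a X *m O *m (P + invmx P) *m invmx Om *m rphi d p).
  by rewrite aE /distortion mulmxDr mulmx1 mulmxDl !mulmxA.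
rewrite CPE.
move: (a X) (cG g F d p) (jac c F p) O (P + invmx P) (invmx Om) (rphi d p) => A G' T' O' P' i f.
mxx; mxlin.
Qed.

Lemma gram_transform : (jac c Ft p)^T *m jac c Ft p = D^T *m gm g c p *m D.
Proof.
rewrite jac_transform (gram_frame fF sc) //; move: D => D'; trx.
by rewrite !mulmxA -(mulmxA _ (CP p)^T) calP_orth mulmx1.
Qed.

Lemma transform_F : k *: Ft p = k *: (CP p *m F p).
Proof.
have pF := tproj_F fF sc Wp cp.
have e : k *: (G^T *m F p) = k *: rphi d p.
  have e1 := GPi JT PrT PrJPr prH GE.
  by rewrite scalemxAr -pF -scalemxAr mulmxA e1 (cH_F lF d sc).
rewrite CPE mulmxBl mul1mx -(mulmxA _ G^T) FtE !scalerBr; congr (_ - _).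
by rewrite [in RHS]scalemxAr e -scalemxAr.
Qed.

Hypothesis rp : \rank (jac c Ft p) == n.

Lemma distortion_unit : D \in unitmx.
Proof.
have /gram_rank := eqP rp; rewrite gram_transform !unitmx_mul.
by case/andP.
Qed.

End AtPoint.
End InChart.

Local Notation Wt := (regular_points W Ft).
Local Notation gt := (induced_metric Ft).

Let sFt : smooth_on W Ft. Proof. by move=> c sc; exact: smooth_transform. Qed.
Let oWt : open Wt. Proof. exact: regular_open. Qed.
Let Wtsub : Wt `<=` W. Proof. by move=> p []. Qed.

Lemma regular_jac c p : smooth_chart c -> Wt p -> cdom c p -> \rank (jac c Ft p) == n.
Proof.
by move=> sc [Wp rp] cp; apply/eqP; rewrite -(diffl_rank sFt sc Wp cp).
Qed.

Lemma framed_transform : framed Wt gt Ft.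
Proof.
split => //.
- by move=> c sc; apply: smooth_in_sub Wtsub _; exact: smooth_transform.
- by move=> p [Wp rp]; rewrite /induced_metric; apply/gram_rank.
move=> p [Wp rp]; pose c := chart_at p; have sc : smooth_chart c := smooth_chart_at p.
have cp : cdom c p := chart_at_dom p.
have jE : diffl Ft p = jac c Ft p by rewrite -jacE.
have e := transform_F sc Wp cp; have o := calP_orth sc Wp cp.
split.
  rewrite scalemxAr e -scalemxAr jE (jac_transform sc Wp cp); trx.
  rewrite !mulmxA -(mulmxA _ (CP p)^T) o mulmx1 -mulmxA scalemxAr.
  by rewrite (position_normal fF sc Wp cp) mulmx0.
have [_ _ _ _ /(_ p Wp)[_ kk]] := fF.
have kd (x : ambient R n S) : k * (k * dot x x) = dot (k *: x) (k *: x).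
  by rewrite dotZr dotC dotZr.
by rewrite -[RHS]kk kd e -kd dot_mulmxl mulmxA o mul1mx.
Qed.

Lemma lframed_transform : lframed Wt gt Ft.
Proof.
have [hp _ _] := lF; split => //; first exact: framed_transform.
move=> p rp; have Wp := Wtsub rp; pose c := chart_at p.
have sc : smooth_chart c := smooth_chart_at p.
have cp : cdom c p := chart_at_dom p.
have jE : diffl Ft p = jac c Ft p by rewrite -jacE.
have ci := CP_isotropic JJ JT (tprojT fF sc Wp cp) (tproj_J lF sc Wp cp)
  (tproj_cH lF d sc Wp cp) uP (uOm Wp) erefl (cG_cH hP sc Wp cp) erefl erefl
  (P_linking hP sc Wp cp) (CPE p).
have PT := tprojT fF sc Wp cp; have Pj := tproj_jac fF sc Wp cp.
have pF := tproj_F fF sc Wp cp.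
rewrite jE (jac_transform sc Wp cp); move: (distortion c p) => D; split.
  have -> : k *: ((Ft p)^T *m J *m (CP p *m jac c F p *m D))
    = k *: ((F p)^T *m (tproj g F c p *m (CP p)^T *m J *m CP p *m tproj g F c p)
        *m jac c F p *m D).
    have Fk : k *: (Ft p)^T = k *: ((F p)^T *m tproj g F c p *m (CP p)^T).
      rewrite -trmxZ (transform_F sc Wp cp) scalemxAr -pF -scalemxAr trmxZ.
      by rewrite !trmx_mul PT.
    by rewrite !scalemxAl Fk -{1}Pj -!scalemxAl !mulmxA.
  by rewrite ci mulmx0 !mul0mx scaler0.
transitivity (D^T *m (jac c F p)^T *m (tproj g F c p *m (CP p)^T *m J *m CP p *m tproj g F c p)
   *m jac c F p *m D).
  by rewrite -{1 2}Pj !trmx_mul PT !mulmxA.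
by rewrite ci mulmx0 !mul0mx.
Qed.

(** The transform preserves the second fundamental form, read through [J]. *)
Lemma aop_transform c p : smooth_chart c -> Wt p -> cdom c p ->
  forall X, aop gt Ft c p X = aop g F c p X.
Proof.
move=> sc rp cp X; have Wp := Wtsub rp.
have uD := distortion_unit sc Wp cp (regular_jac sc rp cp).
have uG := gram_unit fF sc Wp cp.
have oWc : open (W `&` cdom c) by apply: openI => //; exact: cdom_open.
have Wcp : (W `&` cdom c) p by [].
have dJ := diffat_jac fF sc Wp cp; have dF := diffat_F fF sc Wp cp.
have dJt := diffat_jac framed_transform sc rp cp.
have dG : diffat c (cG g F d) p := smooth_in_diffat (smooth_cG_P hP sc) Wp cp.
have dOm : diffat c (rOmega d) p := smooth_in_diffat (sOm sc) Wp cp.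
have dinv : diffat c (fun q => invmx (rOmega d q)) p.
  by apply: diffat_invmx => //; exact: uOm.
have dGi := diffat_mulmx dG dinv; have dGT := diffat_trmx dG.
have dQ := diffat_mulmx dGi dGT.
have d1 : diffat c (fun=> 1%:M : 'M[R]_(cdim n S + cdim n S)) p by exact: diffat_cst.
have dCP : diffat c CP p.
  apply: (diffat_ext oW Wp cp (fun q _ _ => esym (CPE q))).
  exact: (diffat_add d1 (diffat_opp dQ)).
have CPd : dd c CP p X = - (CP p *m dd c (cG g F d) p X *m invmx (rOmega d p) *m (cG g F d p)^T)
    - cG g F d p *m invmx (rOmega d p) *m (dd c (cG g F d) p X)^T.
  rewrite (dd_ext _ oW Wp cp (h2 := fun q => 1%:M
    - cG g F d q *m invmx (rOmega d q) *m (cG g F d q)^T)) //.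
  rewrite (dd_add _ d1 (diffat_opp dQ)) (dd_opp _ dQ) dd_cst add0r.
  rewrite (dd_mulmx _ cp dGi dGT) (dd_mulmx _ cp dG dinv) (dd_invmx _ cp dOm) ?uOm //.
  rewrite (dd_trmx _ dG) (P_dOm hP sc) // CPE.
  by move: (dd c (cG g F d) p X) (cG g F d p) (invmx _) => B G i; mxx; mxlin.
(* near [p], [D] is the product of the inverse metric, [F_*^T calP^T] and the
   Jacobian of the transform, hence differentiable *)
pose E q := invmx (gm g c q) *m ((jac c F q)^T *m (CP q)^T *m jac c Ft q).
have EE q : W q -> cdom c q -> E q = distortion c q.
  move=> Wq cq; rewrite /E (jac_transform sc Wq cq).
  have o := calP_orth sc Wq cq; have ug := gram_unit fF sc Wq cq.
  rewrite !mulmxA -(mulmxA _ _ (CP q)) o mulmx1 -(mulmxA _ _ (jac c F q)).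
  by rewrite -(gram_frame fF sc Wq cq) mulVmx // mul1mx.
have dE : diffat c E p.
  apply: diffat_mulmx; first exact: smooth_in_diffat (smooth_invgram fF sc) Wcp cp.
  by apply: diffat_mulmx => //; apply: diffat_mulmx; exact: diffat_trmx.
have dCJ := diffat_mulmx dCP dJ.
have ddJt : dd c (jac c Ft) p X = dd c CP p X *m jac c F p *m distortion c p
    + CP p *m dd c (jac c F) p X *m distortion c p
    + CP p *m jac c F p *m dd c E p X.
  rewrite (dd_ext _ oW Wp cp (h2 := fun q => CP q *m jac c F q *m E q)); last first.
    by move=> q Wq cq; rewrite EE // (jac_transform sc Wq cq).
  by rewrite (dd_mulmx _ cp dCJ dE) (dd_mulmx _ cp dCP dJ) mulmxDl EE.
have dGE := P_dG hP sc Wp cp X.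
have HJ : (cH g F d c p)^T *m J^T *m dd c (jac c F) p X
    = jac c (rphi d) p *m aop g F c p X.
  have [kD _] := dd_isotropic lF sc Wp cp X.
  have om_T := om_gmT lF d sc Wp cp.
  rewrite -om_T -(mulmxA _ (gm g c p)) (gm_aop lF sc Wp cp) cH.unlock; trx; rewrite !mulmxDl.
  have -> : k *: (rphi d p *m (F p)^T) *m J^T *m dd c (jac c F) p X = 0.
    rewrite JT mulmxN mulNmx -!scalemxAl -!mulmxA (mulmxA (F p)^T) scalemxAr kD.
    by rewrite mulmx0 oppr0.
  by rewrite addr0 !mulmxA.
have dGT' : (dd c (cG g F d) p X)^T *m jac c F p
   = - ((P + invmx P)^T *m jac c (rphi d) p *m aop g F c p X).
  have om_T := om_gmT lF d sc Wp cp; have as_ := aop_sym lF sc Wp cp X.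
  have gs := gm_sym lF sc Wp cp.
  rewrite dGE; rewrite -om_T -!mulmxA -as_ (gram_frame fF sc) //.
  trx; rewrite mulNmx; congr (- _); by rewrite !mulmxA.
have dGE' : dd c (cG g F d) p X
   = jac c F p *m - (aop g F c p X *m om g (rphi d) c p *m (P + invmx P)).
  by rewrite dGE mulmxN !mulmxA.
have main := transform_shape JJ JT (tprojT fF sc Wp cp) (tproj_J lF sc Wp cp)
  (tproj_cH lF d sc Wp cp) uP (uOm Wp) erefl (cG_cH hP sc Wp cp) erefl erefl erefl
  (P_linking hP sc Wp cp) (CPE p) (distortion c p) (dd c E p X)
  (tproj_jac fF sc Wp cp) (cH_jac lF d sc Wp cp) (esym (gm_aop lF sc Wp cp X)) HJ dGE' dGT' CPd.
have aC : aop g F c p X *m distortion c p = distortion c p *m aop g F c p X.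
  by rewrite /distortion mulmxDr mulmxDl mulmx1 mul1mx (P_aopC hP sc Wp cp).
rewrite (aopE gt Ft c p X) (gram_frame framed_transform sc rp cp) (gram_transform sc Wp cp).
rewrite ddJt {1}(jac_transform sc Wp cp) main -(mulmxA _ (aop g F c p X)) aC.
move: (distortion c p) uD => D uD; have uDT : D^T \in unitmx by rewrite unitmx_tr.
by rewrite (mulmxA _ D) mulKmx // !unitmx_mul uDT uG.
Qed.

Theorem transform_admissible : admissible_immersion Wt gt Ft.
Proof.
apply: admissible_of_lframed; first exact: lframed_transform.
move=> c sc p rp cp; apply: (sectional_of_commute lframed_transform sc rp cp) => X Y.
by rewrite !(aop_transform sc rp cp); apply: (P_aopC hP sc _ cp); exact: Wtsub.
Qed.

End TransformGeometry.

(** * The first and the second transform *)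

Section Characterization.
Context {R : realType} {n : nat} {M : manifold R n}.
Variables (S : setting R) (W : set M) (g : M -> 'M[R]_n).
Variable F : M -> ambient R n S.
Context {l : nat}.
Variable d : ribdata R M (cdim n S + cdim n S) l.
Variable P : 'M[R]_l.
Local Notation k := (curv S).
Local Notation J := (Jmx : 'M[R]_(cdim n S + cdim n S)).

Hypothesis hF : admissible_immersion W g F.
Hypotheses (sphi : smooth_on W (rphi d)) (sbeta : smooth_on W (rbeta d)).
Hypothesis sOm : smooth_on W (rOmega d).
Hypothesis uOm : forall p, W p -> rOmega d p \in unitmx.
Hypothesis sP : spectrum_condition P.

Hypothesis structure : forall c, smooth_chart c -> forall p, W p -> cdom c p ->
  [/\ rbeta d p = J *m cH g F d c p *m P,
      linking J (cH g F d c p) P (rOmega d p),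
      exists (B : 'M[R]_n) (Z : 'M[R]_(n, l)),
        (forall X, aop g F c p X *m B = B *m aop g F c p X) /\
        forall X, dd c (cG g F d) p X = jac c F p *m (B *m aop g F c p X *m Z)
    & forall X, dd c (rOmega d) p X = (cG g F d p)^T *m dd c (cG g F d) p X].

Let lF : lframed W g F := lframed_of_admissible hF.
Let fF : framed W g F. Proof. by case: lF. Qed.

(** [J] maps the Lagrangian subspace to its orthogonal complement. *)
Lemma beta_normal p : W p -> forall v, is_normal F p (rbeta d p *m v).
Proof.
move=> Wp v; pose c := chart_at p; have sc : smooth_chart c := smooth_chart_at p.
have cp : cdom c p := chart_at_dom p.
have [b _ _ _] := structure sc Wp cp.
have jE : diffl F p = jac c F p by rewrite -jacE.
have PH := tproj_cH lF d sc Wp cp; have PT := tprojT fF sc Wp cp.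
have Pj := tproj_J lF sc Wp cp; have Pjac := tproj_jac fF sc Wp cp.
have pF := tproj_F fF sc Wp cp.
have z : tproj g F c p *m (rbeta d p *m v) = 0.
  by rewrite b -PH !mulmxA Pj !mul0mx.
have e1 : (diffl F p)^T *m (rbeta d p *m v) = 0.
  by rewrite jE -Pjac trmx_mul PT -mulmxA z mulmx0.
have e2 : k *: ((F p)^T *m (rbeta d p *m v)) = 0.
  rewrite scalemxAl -trmxZ -pF trmxZ trmx_mul PT -scalemxAl -mulmxA z.
  by rewrite mulmx0 scaler0.
split => //; have [pS _ _] := lF.
move: e2 pS; rewrite dotE; move: (dot _ _) => x; clear; case: S => [|c0] //= e c00.
have := congr1 (fun A : 'M[R]_1 => A 0 0) e; rewrite !mxE eqxx mulr1n => /eqP.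
by rewrite mulf_eq0 gt_eqF //= => /eqP.
Qed.

(** The criterion by which the transforms below are recognized: the conditions
   of Codazzi type and of commutation both come from the form of the
   derivative of [calG]. *)
Lemma P_transform_intro : P_transform W g F d P.
Proof.
have nb := beta_normal.
split => //.
- split; first by split.
  split; first exact: nb.
  split.
    move=> c sc p Wp cp X u v.
    have [_ _ [B [Z [BC dGE]]] _] := structure sc Wp cp.
    have PhiE w Y : Phi g F d c w p Y = B *m aop g F c p (Z *m w) *m Y.
      apply: (can_inj (mulKmx (gram_unit fF sc Wp cp))).
      rewrite -(tangent_dd_cG fF sphi sbeta nb sc Y Wp cp) dGE (gram_frame fF sc) //.
      by rewrite -(mulmxA B _ Y) (aopC lF sc Wp cp) !mulmxA.
    split.
      rewrite -(normal_dd_cG fF sphi sbeta sc X Wp cp) dGE mulmxA mulmxBl mul1mx.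
      by rewrite (tproj_jac fF sc Wp cp) subrr !mul0mx.
    rewrite !PhiE; have aC := aop_commute lF sc _ Wp cp.
    have {}aC : forall X Y, aop g F c p X *m aop g F c p Y = aop g F c p Y *m aop g F c p X.
      by apply: aC; case: hF.
    have comm Y Y' : B *m aop g F c p Y *m (B *m aop g F c p Y')
      = B *m B *m (aop g F c p Y *m aop g F c p Y').
      by rewrite !mulmxA -(mulmxA B _ B) BC !mulmxA.
    by rewrite !(mulmxA _ _ X) !comm aC.
  split => //; split.
    move=> c sc p Wp cp X; have [_ _ _ e] := structure sc Wp cp.
    by rewrite !ddE cGE e.
  move=> p Wp; have sc := smooth_chart_at p; have cp := chart_at_dom p.
  have [b [e _] _ _] := structure sc Wp cp.
  by rewrite e cGE (cG_of_beta lF sphi sc Wp cp b).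
- move=> p Wp; have sc := smooth_chart_at p; have cp := chart_at_dom p.
  have [b _ _ _] := structure sc Wp cp.
  by apply/(beta_conditionE lF sphi P sc Wp cp).
- move=> p Wp; have sc := smooth_chart_at p; have cp := chart_at_dom p.
  have [_ [_ e] _ _] := structure sc Wp cp.
  rewrite -[RHS]e (cH_sq lF sphi sc Wp cp) /P_rho; congr (_ + _ *m _).
  by rewrite mulmxDr mulmxDl -scalemxAr -scalemxAl !mulmxA.
Qed.

End Characterization.

Section SubTransform.
Context {R : realType} {n : nat} {M : manifold R n}.
Variables (S : setting R) (W : set M) (g : M -> 'M[R]_n).
Variable F : M -> ambient R n S.
Context {l : nat}.
Variable d : ribdata R M (cdim n S + cdim n S) l.
Variable P : 'M[R]_l.
Hypothesis hP : P_transform W g F d P.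
Local Notation J := (Jmx : 'M[R]_(cdim n S + cdim n S)).

Let lF := ptransform_lframed hP.
Let fF : framed W g F. Proof. by case: lF. Qed.
Let oW : open W. Proof. by case: fF. Qed.
Let sphi : smooth_on W (rphi d). Proof. by case: hP => _ [[]]. Qed.
Let sbeta : smooth_on W (rbeta d). Proof. by case: hP => _ [[]]. Qed.
Let sOm : smooth_on W (rOmega d). Proof. by case: hP => _ [[]]. Qed.
Let sP := ptransform_spectrum hP.

Context {m : nat}.
Variables (E : 'M[R]_(l, m)) (Pj : 'M[R]_m).
Hypotheses (EE : E^T *m E = 1%:M) (EP : E^T *m P = Pj *m E^T) (PE : P *m E = E *m Pj).
Variable ds : ribdata R M (cdim n S + cdim n S) m.
Hypotheses (phiE : forall p, rphi ds p = E^T *m rphi d p)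
  (betasE : forall p, rbeta ds p = rbeta d p *m E)
  (OmE : forall p, rOmega ds p = E^T *m rOmega d p *m E).

Let smooth_sub_phi : smooth_on W (rphi ds).
Proof.
move=> c sc; apply: (smooth_in_ext oW (fun q _ _ => esym (phiE q))).
by apply: smooth_in_mulmx => //; [exact: smooth_in_cst|exact: sphi].
Qed.

Section InChart.
Variable c : chart R n M.
Hypothesis sc : smooth_chart c.

Lemma jac_sub p : W p -> cdom c p -> jac c (rphi ds) p = E^T *m jac c (rphi d) p.
Proof.
move=> Wp cp; apply: eq_col_mul => X.
have dphi : diffat c (rphi d) p by exact: smooth_in_diffat (sphi sc) Wp cp.
have cE : diffat c (fun=> E^T) p by exact: diffat_cst.
have dphis : diffat c (rphi ds) p.
  apply: (diffat_ext oW Wp cp (fun q _ _ => esym (phiE q))).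
  exact: diffat_mulmx cE dphi.
rewrite -(dd_jac _ dphis) (dd_ext _ oW Wp cp (fun q _ _ => phiE q)).
by rewrite (dd_mulmx _ cp cE dphi) dd_cst mul0mx add0r (dd_jac _ dphi) mulmxA.
Qed.

Lemma cH_sub p : W p -> cdom c p -> cH g F ds c p = cH g F d c p *m E.
Proof.
move=> Wp cp; rewrite cH.unlock phiE om.unlock jac_sub //.
by rewrite mulmxDl -scalemxAl !trmx_mul trmxK !mulmxA.
Qed.

Lemma beta_sub p : W p -> cdom c p -> rbeta ds p = J *m cH g F ds c p *m Pj.
Proof.
move=> Wp cp; rewrite betasE (betaE hP sc Wp cp) cH_sub //.
by rewrite -!mulmxA PE.
Qed.

Lemma cG_sub p : W p -> cdom c p -> cG g F ds p = cG g F d p *m E.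
Proof.
move=> Wp cp.
rewrite (cG_of_beta lF smooth_sub_phi sc Wp cp (beta_sub Wp cp)) (cG_cH hP sc Wp cp) cH_sub //.
by rewrite mulmxDl -!mulmxA PE.
Qed.

End InChart.

(** Columns of [H] and [calG] are selected by [E]. *)
Lemma sub_transform : P_transform W g F ds Pj.
Proof.
have hF : admissible_immersion W g F by case: hP.
have Jl := @JmxJ R (cdim n S); have JTl := @JmxT R (cdim n S).
apply: P_transform_intro => //.
- move=> c sc; apply: (smooth_in_ext oW (fun q _ _ => esym (betasE q))).
  by apply: smooth_in_mulmx => //; [exact: sbeta|exact: smooth_in_cst].
- move=> c sc; apply: (smooth_in_ext oW (fun q _ _ => esym (OmE q))).
  apply: smooth_in_mulmx => //; last exact: smooth_in_cst.
  by apply: smooth_in_mulmx => //; [exact: smooth_in_cst|exact: sOm].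
- move=> p Wp; have sc := smooth_chart_at p; have cp := chart_at_dom p.
  rewrite OmE; exact: (block_unit Jl JTl (tprojT fF sc Wp cp) (tproj_J lF sc Wp cp)
    (tproj_cH lF d sc Wp cp) sP (ptransform_unit hP Wp) (P_linking hP sc Wp cp) EE EP PE).
- exact: (spectrum_sub EE EP sP).
move=> c sc p Wp cp.
have cE : diffat c (fun=> E) p by exact: diffat_cst.
have cET : diffat c (fun=> E^T) p by exact: diffat_cst.
have dG : diffat c (cG g F d) p := smooth_in_diffat (smooth_cG_P hP sc) Wp cp.
have dOm : diffat c (rOmega d) p := smooth_in_diffat (sOm sc) Wp cp.
have dGE X : dd c (cG g F ds) p X = dd c (cG g F d) p X *m E.
  rewrite (dd_ext _ oW Wp cp (fun q Wq cq => cG_sub sc Wq cq)).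
  by rewrite (dd_mulmx _ cp dG cE) dd_cst mulmx0 addr0.
split.
- exact: beta_sub.
- rewrite (cH_sub sc Wp cp) OmE.
  exact: (linking_sub sP (P_linking hP sc Wp cp) EE EP PE).
- exists 1%:M, (- (om g (rphi d) c p *m (P + invmx P) *m E)); split.
    by move=> X; rewrite mulmx1 mul1mx.
  by move=> X; rewrite dGE (P_dG hP sc Wp cp) mul1mx !mulmxN mulNmx !mulmxA.
- move=> X; rewrite dGE (cG_sub sc Wp cp) (dd_ext _ oW Wp cp (fun q _ _ => OmE q)).
  rewrite (dd_mulmx _ cp (diffat_mulmx cET dOm) cE) (dd_mulmx _ cp cET dOm) !dd_cst.
  by rewrite mul0mx add0r mulmx0 addr0 (P_dOm hP sc) // trmx_mul !mulmxA.
Qed.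

End SubTransform.

Section BarTransform.
Context {R : realType} {n : nat} {M : manifold R n}.
Variables (S : setting R) (W : set M) (g : M -> 'M[R]_n).
Variable F : M -> ambient R n S.
Context {l : nat}.
Variable d : ribdata R M (cdim n S + cdim n S) l.
Variable P : 'M[R]_l.
Hypothesis hP : P_transform W g F d P.
Local Notation k := (curv S).
Local Notation J := (Jmx : 'M[R]_(cdim n S + cdim n S)).

Context {li lj : nat}.
Variables (Ei : 'M[R]_(l, li)) (Ej : 'M[R]_(l, lj)).
Variables (Pi' : 'M[R]_li) (Pj : 'M[R]_lj).
Hypotheses (EiEi : Ei^T *m Ei = 1%:M) (EjEj : Ej^T *m Ej = 1%:M).
Hypotheses (EiEj : Ei^T *m Ej = 0) (EjEi : Ej^T *m Ei = 0).
Hypothesis EE1 : Ei *m Ei^T + Ej *m Ej^T = 1%:M.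
Hypotheses (EiP : Ei^T *m P = Pi' *m Ei^T) (PEi : P *m Ei = Ei *m Pi').
Hypotheses (EjP : Ej^T *m P = Pj *m Ej^T) (PEj : P *m Ej = Ej *m Pj).

Variable dj : ribdata R M (cdim n S + cdim n S) lj.
Hypotheses (phijE : forall p, rphi dj p = Ej^T *m rphi d p)
  (betajE : forall p, rbeta dj p = rbeta d p *m Ej)
  (OmjE : forall p, rOmega dj p = Ej^T *m rOmega d p *m Ej).
Variable Fj : M -> ambient R n S.
Hypothesis FjE : forall p,
  Fj p = F p - cG g F dj p *m invmx (rOmega dj p) *m rphi dj p.
Variable CP : M -> 'M[R]_(cdim n S + cdim n S).
Hypothesis CPE : forall p,
  CP p = 1%:M - cG g F dj p *m invmx (rOmega dj p) *m (cG g F dj p)^T.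

(* Block elimination: the Schur complement of [Omega_jj] is [Y^t Omega Y']. *)
Variables (Y Y' : M -> 'M[R]_(l, li)).
Hypothesis YE : forall p,
  Y p = Ei - Ej *m (invmx (rOmega dj p))^T *m (Ei^T *m rOmega d p *m Ej)^T.
Hypothesis Y'E : forall p,
  Y' p = Ei - Ej *m invmx (rOmega dj p) *m (Ej^T *m rOmega d p *m Ei).
Variable db : ribdata R M (cdim n S + cdim n S) li.
Hypotheses (phibE : forall p, rphi db p = (Y p)^T *m rphi d p)
  (betabE : forall p, rbeta db p = CP p *m (rbeta d p *m Y p))
  (OmbE : forall p, rOmega db p = Ei^T *m rOmega d p *m Ei
     - Ei^T *m rOmega d p *m Ej *m invmx (rOmega dj p) *m (Ej^T *m rOmega d p *m Ei)).

Let lF := ptransform_lframed hP.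
Let fF : framed W g F. Proof. by case: lF. Qed.
Let oW : open W. Proof. by case: fF. Qed.
Let sphi : smooth_on W (rphi d). Proof. by case: hP => _ [[]]. Qed.
Let sbeta : smooth_on W (rbeta d). Proof. by case: hP => _ [[]]. Qed.
Let sOm : smooth_on W (rOmega d). Proof. by case: hP => _ [[]]. Qed.
Let sP := ptransform_spectrum hP.
Let uP : P \in unitmx := spectrum_unit sP.
Let uOm p (Wp : W p) : rOmega d p \in unitmx := ptransform_unit hP Wp.
Let hj : P_transform W g F dj Pj := sub_transform hP EjEj EjP PEj phijE betajE OmjE.
Let sOmj : smooth_on W (rOmega dj). Proof. by case: hj => _ [[]]. Qed.
Let uOmj p (Wp : W p) : rOmega dj p \in unitmx := ptransform_unit hj Wp.
Let JJ := @JmxJ R (cdim n S).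
Let JT := @JmxT R (cdim n S).

Let YTE p : (Y p)^T = Ei^T - Ei^T *m rOmega d p *m Ej *m invmx (rOmega dj p) *m Ej^T.
Proof. by rewrite YE linearB /= !trmx_mul !trmxK !mulmxA. Qed.

Let P'Ej : (P + invmx P) *m Ej = Ej *m (Pj + invmx Pj).
Proof.
have uPj : Pj \in unitmx := spectrum_unit (ptransform_spectrum hj).
rewrite mulmxDl mulmxDr PEj; congr (_ + _).
by apply: (can_inj (mulKmx uP)); rewrite mulKVmx // mulmxA PEj mulmxK.
Qed.

Section InChart.
Variable c : chart R n M.
Hypothesis sc : smooth_chart c.

Let smooth_invOmj : smooth_in c W (fun q => invmx (rOmega dj q)).
Proof. by apply: smooth_in_invmx => //; exact: sOmj. Qed.

Let smooth_block a b (A : 'M[R]_(a, l)) (B : 'M[R]_(l, b)) :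
  smooth_in c W (fun q => A *m rOmega d q *m B).
Proof.
apply: smooth_in_mulmx => //; last exact: smooth_in_cst.
by apply: smooth_in_mulmx => //; [exact: smooth_in_cst|exact: sOm].
Qed.

Lemma smooth_Y : smooth_in c W Y.
Proof.
apply: (smooth_in_ext oW (fun q _ _ => esym (YE q))).
apply: smooth_in_add => //; first exact: smooth_in_cst.
apply: smooth_in_opp => //; apply: smooth_in_mulmx => //.
  apply: smooth_in_mulmx => //; first exact: smooth_in_cst.
  exact: smooth_in_trmx.
exact: smooth_in_trmx.
Qed.

Lemma smooth_bar_phi : smooth_in c W (rphi db).
Proof.
apply: (smooth_in_ext oW (fun q _ _ => esym (phibE q))).
by apply: smooth_in_mulmx => //; [apply: smooth_in_trmx => //; exact: smooth_Y|exact: sphi].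
Qed.

Lemma smooth_calP : smooth_in c W CP.
Proof.
apply: (smooth_in_ext oW (fun q _ _ => esym (CPE q))).
have sG := smooth_cG_P hj sc.
apply: smooth_in_add => //; first exact: smooth_in_cst.
apply: smooth_in_opp => //; apply: smooth_in_mulmx => //; last exact: smooth_in_trmx.
exact: smooth_in_mulmx.
Qed.

Lemma smooth_bar_beta : smooth_in c W (rbeta db).
Proof.
apply: (smooth_in_ext oW (fun q _ _ => esym (betabE q))).
apply: smooth_in_mulmx => //; first exact: smooth_calP.
by apply: smooth_in_mulmx => //; [exact: sbeta|exact: smooth_Y].
Qed.

Lemma smooth_bar_Omega : smooth_in c W (rOmega db).
Proof.
apply: (smooth_in_ext oW (fun q _ _ => esym (OmbE q))).
apply: smooth_in_add => //; apply: smooth_in_opp => //.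
by apply: smooth_in_mulmx => //; apply: smooth_in_mulmx.
Qed.

Section AtPoint.
Variable p : M.
Hypotheses (Wp : W p) (cp : cdom c p).
Local Notation T := (jac c F p).
Local Notation O := (om g (rphi d) c p).
Local Notation Om := (rOmega d p).
Local Notation Ojj := (rOmega dj p).
Local Notation D := (distortion g F dj Pj c p).

Let dOm : diffat c (rOmega d) p := smooth_in_diffat (sOm sc) Wp cp.
Let dOmj : diffat c (rOmega dj) p := smooth_in_diffat (sOmj sc) Wp cp.
Let dphi : diffat c (rphi d) p := smooth_in_diffat (sphi sc) Wp cp.
Let dinv : diffat c (fun q => invmx (rOmega dj q)) p :=
  smooth_in_diffat smooth_invOmj Wp cp.
Let dblock a b (A : 'M[R]_(a, l)) (B : 'M[R]_(l, b)) :
  diffat c (fun q => A *m rOmega d q *m B) p :=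
  smooth_in_diffat (smooth_block A B) Wp cp.

Let dd_block a b (A : 'M[R]_(a, l)) (B : 'M[R]_(l, b)) X :
  dd c (fun q => A *m rOmega d q *m B) p X = A *m dd c (rOmega d) p X *m B.
Proof.
have cA := diffat_cst c A p; have cB := diffat_cst c B p.
rewrite (dd_mulmx _ cp (diffat_mulmx cA dOm) cB) (dd_mulmx _ cp cA dOm) !dd_cst.
by rewrite mul0mx add0r mulmx0 addr0.
Qed.

Let dd_inv X : dd c (fun q => invmx (rOmega dj q)) p X
  = - (invmx Ojj *m (Ej^T *m dd c (rOmega d) p X *m Ej) *m invmx Ojj).
Proof.
rewrite (dd_invmx _ cp dOmj (uOmj Wp)) (dd_ext _ oW Wp cp (fun q _ _ => OmjE q)).
by rewrite dd_block.
Qed.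

Lemma dd_YT X : dd c (fun q => (Y q)^T) p X
  = - ((Y p)^T *m dd c (rOmega d) p X *m Ej *m invmx Ojj *m Ej^T).
Proof.
rewrite (dd_ext _ oW Wp cp (fun q _ _ => YTE q)).
have cEi := diffat_cst c Ei^T p; have cEj := diffat_cst c Ej^T p.
have dB := dblock Ei^T Ej; have dBi := diffat_mulmx dB dinv.
have dBE := diffat_mulmx dBi cEj.
rewrite (dd_add _ cEi (diffat_opp dBE)) (dd_opp _ dBE) dd_cst add0r.
rewrite (dd_mulmx _ cp dBi cEj) (dd_mulmx _ cp dB dinv) dd_cst mulmx0 addr0.
rewrite dd_block dd_inv YTE; move: (dd c (rOmega d) p X) (invmx Ojj) (rOmega d p) => o i w.
by mxx; mxlin.
Qed.

Lemma dd_Y' X : dd c Y' p X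
  = - (Ej *m invmx Ojj *m Ej^T *m dd c (rOmega d) p X *m Y' p).
Proof.
rewrite (dd_ext _ oW Wp cp (fun q _ _ => Y'E q)).
have cEi := diffat_cst c Ei p; have cEj := diffat_cst c Ej p.
have dB := dblock Ej^T Ei; have dBi := diffat_mulmx cEj dinv.
have dBE := diffat_mulmx dBi dB.
rewrite (dd_add _ cEi (diffat_opp dBE)) (dd_opp _ dBE) dd_cst add0r.
rewrite (dd_mulmx _ cp dBi dB) (dd_mulmx _ cp cEj dinv) dd_cst mul0mx add0r.
rewrite dd_block dd_inv Y'E; move: (dd c (rOmega d) p X) (invmx Ojj) (rOmega d p) => o i w.
by mxx; mxlin.
Qed.

Lemma dd_bar_Omega X : dd c (rOmega db) p X
  = (Y p)^T *m dd c (rOmega d) p X *m Y' p.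
Proof.
rewrite (dd_ext _ oW Wp cp (fun q _ _ => OmbE q)).
have dBii := dblock Ei^T Ei; have dBij := dblock Ei^T Ej; have dBji := dblock Ej^T Ei.
have dBi := diffat_mulmx dBij dinv; have dBE := diffat_mulmx dBi dBji.
rewrite (dd_add _ dBii (diffat_opp dBE)) (dd_opp _ dBE).
rewrite (dd_mulmx _ cp dBi dBji) (dd_mulmx _ cp dBij dinv).
rewrite !dd_block dd_inv YTE Y'E.
move: (dd c (rOmega d) p X) (invmx Ojj) (rOmega d p) => o i w.
by mxx; mxlin.
Qed.

(** The derivative of [Y^t phi] acquires, besides [Y^t d phi], a term from [d Omega]; by
   [P_dG] it is the same distortion as in the differential of the first transform. *)
Lemma jac_bar_phi : jac c (rphi db) p = (Y p)^T *m jac c (rphi d) p *m D.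
Proof.
have dYT : diffat c (fun q => (Y q)^T) p.
  by apply: diffat_trmx; exact: smooth_in_diffat smooth_Y Wp cp.
have dphib : diffat c (rphi db) p := smooth_in_diffat smooth_bar_phi Wp cp.
have aC := aopC lF sc Wp cp.
apply: eq_col_mul => X; rewrite -(dd_jac _ dphib).
rewrite (dd_ext _ oW Wp cp (fun q _ _ => phibE q)) (dd_mulmx _ cp dYT dphi) dd_YT.
rewrite (P_dOm hP sc) // (dd_jac _ dphi) (P_dG hP sc Wp cp).
have e : twist g dj Pj c p = O *m (P + invmx P) *m Ej *m invmx Ojj *m Ej^T *m rphi d p.
  rewrite /twist phijE om.unlock (jac_sub hP phijE sc Wp cp) trmx_mul trmxK.
  by rewrite -!mulmxA (mulmxA Ej) -P'Ej !mulmxA.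
have aE : aop g F c p X *m O *m (P + invmx P) *m Ej *m invmx Ojj *m Ej^T *m rphi d p
   = aop g F c p (twist g dj Pj c p) *m X by rewrite -aC e !mulmxA.
have -> : (Y p)^T *m jac c (rphi d) p *m D *m X = (Y p)^T *m jac c (rphi d) p *m X
  + (Y p)^T *m jac c (rphi d) p *m (aop g F c p X *m O *m (P + invmx P) *m Ej
     *m invmx Ojj *m Ej^T *m rphi d p).
  by rewrite aE /distortion mulmxDr mulmx1 mulmxDl !mulmxA.
rewrite -(cG_jac hP sc Wp cp).
move: (aop _ _ _ _ X) (cG g F d p) T O (P + invmx P) (Y p) (invmx Ojj) (rphi d p).
by move=> a G t o P' y i f; mxx; mxlin.
Qed.

End AtPoint.
End InChart.

Local Notation Wj := (regular_points W Fj).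
Local Notation gj := (induced_metric Fj).

Let Wjsub : Wj `<=` W. Proof. by move=> p []. Qed.
Let fFj : framed Wj gj Fj := framed_transform hj FjE CPE.
Let oWj : open Wj. Proof. by case: fFj. Qed.

Section RegularPoint.
Variable c : chart R n M.
Hypothesis sc : smooth_chart c.
Variable p : M.
Hypotheses (rp : Wj p) (cp : cdom c p).
Local Notation T := (jac c F p).
Local Notation H := (cH g F d c p).
Local Notation G := (cG g F d p).
Local Notation O := (om g (rphi d) c p).
Let Wp : W p := Wjsub rp.

Let bargs := And3 (tprojT fF sc Wp cp) (tproj_J lF sc Wp cp) (tproj_cH lF d sc Wp cp).
Let GE : G = H + J *m H *m P. Proof. exact: (cG_cH hP sc Wp cp). Qed.
Let hl : linking J H P (rOmega d p) := P_linking hP sc Wp cp.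

Let CPE' : CP p = 1%:M
  - (H + J *m H *m P) *m Ej *m invmx (rOmega dj p) *m ((H + J *m H *m P) *m Ej)^T.
Proof. by rewrite -GE -(cG_sub hP PEj phijE betajE sc Wp cp). Qed.

(** The factors [D] in the Jacobians of [phi] and of the first transform cancel
   against the metric. *)
Lemma cH_bar : cH gj Fj db c p = CP p *m (H *m Y p).
Proof.
have uD := distortion_unit hj FjE CPE sc Wp cp (regular_jac hj FjE sc rp cp).
have uG := gram_unit fF sc Wp cp.
have e := transform_F hj FjE CPE sc Wp cp.
rewrite !cH.unlock om.unlock (gram_frame fFj sc rp cp) (gram_transform hj FjE CPE sc Wp cp).
rewrite (jac_transform hj FjE CPE sc Wp cp) (jac_bar_phi sc Wp cp).
rewrite phibE mulmxDl mulmxDr; congr (_ + _).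
  rewrite -(congruent_inv uD uG).
  by move: (distortion g F dj Pj c p) => D; rewrite !trmx_mul trmxK !mulmxA.
by rewrite scalemxAl e trmx_mul trmxK -!scalemxAl -scalemxAr !mulmxA.
Qed.

Lemma beta_bar : rbeta db p = J *m cH gj Fj db c p *m Pi'.
Proof.
have [h1 h2 h3] := bargs.
rewrite betabE cH_bar (betaE hP sc Wp cp).
exact: (bar_beta JJ JT h1 h2 h3 sP (uOm Wp) hl EjEj PEi EjP PEj (OmjE p) erefl (YE p) CPE').
Qed.

Lemma cG_bar : cG gj Fj db p = G *m Y' p.
Proof.
have [h1 h2 h3] := bargs.
have sphib : smooth_on Wj (rphi db).
  by move=> c' sc'; apply: smooth_in_sub Wjsub _; exact: smooth_bar_phi.
rewrite (cG_of_beta (lframed_transform hj FjE CPE) sphib sc rp cp beta_bar) cH_bar GE.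
exact: (bar_GE JJ JT h1 h2 h3 sP (uOm Wp) hl EjEj PEi EjP PEj (OmjE p) erefl erefl
  (YE p) (Y'E p) CPE').
Qed.

Lemma calP_cG : CP p *m (G *m Y p) = G *m Y' p.
Proof.
have [h1 h2 h3] := bargs; rewrite GE.
exact: (bar_G JJ JT h1 h2 h3 sP (uOm Wp) hl EjEj EjP PEj (OmjE p) erefl erefl
  (YE p) (Y'E p) CPE').
Qed.

Lemma linking_bar : linking J (cH gj Fj db c p) Pi' (rOmega db p).
Proof.
have [h1 h2 h3] := bargs; rewrite cH_bar.
exact: (bar_linking JJ JT h1 h2 h3 sP (uOm Wp) hl EiEi EjEj EiEj EE1 EiP PEi EjP PEj
  (OmjE p) erefl erefl (OmbE p) (YE p) (Y'E p) CPE').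
Qed.

Lemma Omega_bar_unit : rOmega db p \in unitmx.
Proof.
have [h1 h2 h3] := bargs.
exact: (bar_unit JJ JT h1 h2 h3 sP (uOm Wp) hl EiEi EjEj EiEj EE1 EjP PEj
  (OmjE p) erefl erefl (OmbE p) (Y'E p)).
Qed.

Lemma ribaucour_bar : Fj p - cG gj Fj db p *m invmx (rOmega db p) *m rphi db p
  = F p - cG g F d p *m invmx (rOmega d p) *m rphi d p.
Proof.
have [h1 h2 h3] := bargs.
have <- := bar_compose JJ JT h1 h2 h3 sP (uOm Wp) hl EiEi EjEj EiEj EE1 EjP PEj
  (OmjE p) erefl erefl (OmbE p) (YE p) (Y'E p).
rewrite FjE cG_bar (cG_sub hP PEj phijE betajE sc Wp cp) phijE phibE.
by rewrite mulmxDr mulmxDl !mulmxA opprD addrA.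
Qed.

End RegularPoint.

(** The derivative of [Y'] completes [d calG] to [calP_j d calG]. *)
Lemma dd_cG_bar c p X : smooth_chart c -> Wj p -> cdom c p ->
  dd c (cG gj Fj db) p X = CP p *m dd c (cG g F d) p X *m Y' p.
Proof.
move=> sc rp cp; have Wp := Wjsub rp.
have dG : diffat c (cG g F d) p := smooth_in_diffat (smooth_cG_P hP sc) Wp cp.
have dOm : diffat c (rOmega d) p := smooth_in_diffat (sOm sc) Wp cp.
have dY' : diffat c Y' p.
  have smi : smooth_in c W (fun q => invmx (rOmega dj q)).
    by apply: smooth_in_invmx => //; exact: sOmj.
  apply: (diffat_ext oW Wp cp (fun q _ _ => esym (Y'E q))).
  have cEi := diffat_cst c Ei p; have cEj := diffat_cst c Ej p.
  have cEjT := diffat_cst c Ej^T p.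
  apply: diffat_add => //; apply: diffat_opp; apply: diffat_mulmx.
    by apply: diffat_mulmx => //; exact: smooth_in_diffat smi Wp cp.
  by apply: diffat_mulmx => //; exact: diffat_mulmx.
have e q : Wj q -> cdom c q -> cG gj Fj db q = cG g F d q *m Y' q.
  by move=> rq cq; exact: cG_bar.
rewrite (dd_ext _ oWj rp cp e) (dd_mulmx _ cp dG dY') dd_Y' // (P_dOm hP sc) //.
rewrite CPE (cG_sub hP PEj phijE betajE sc Wp cp) trmx_mul.
by move: (dd c _ p X) (cG g F d p) (invmx _) (Y' p) => B G' i y; mxx; mxlin.
Qed.

Lemma bar_transform : P_transform Wj gj Fj db Pi'.
Proof.
have hFj : admissible_immersion Wj gj Fj by exact: (transform_admissible hj FjE CPE).
apply: P_transform_intro => //.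
- by move=> c sc; apply: smooth_in_sub Wjsub _; exact: smooth_bar_phi.
- by move=> c sc; apply: smooth_in_sub Wjsub _; exact: smooth_bar_beta.
- by move=> c sc; apply: smooth_in_sub Wjsub _; exact: smooth_bar_Omega.
- by move=> p rp; exact: (Omega_bar_unit (smooth_chart_at p) rp (chart_at_dom p)).
- exact: (spectrum_sub EiEi EiP sP).
move=> c sc p rp cp; have Wp := Wjsub rp.
have uD := distortion_unit hj FjE CPE sc Wp cp (regular_jac hj FjE sc rp cp).
have aE := aop_transform hj FjE CPE sc rp cp.
have aC := P_aopC hj sc Wp cp.
split.
- exact: beta_bar.
- exact: linking_bar.
- exists (invmx (distortion g F dj Pj c p)),
    (- (om g (rphi d) c p *m (P + invmx P) *m Y' p)); split => X.
    rewrite !aE; apply: (can_inj (mulKmx uD)); rewrite mulKVmx //.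
    rewrite mulmxA; have -> : distortion g F dj Pj c p *m aop g F c p X
      = aop g F c p X *m distortion g F dj Pj c p.
      by rewrite /distortion mulmxDl mulmxDr mul1mx mulmx1 aC.
    by rewrite mulmxK.
  rewrite (dd_cG_bar _ sc rp cp) (P_dG hP sc Wp cp) (jac_transform hj FjE CPE sc Wp cp) aE.
  move: (distortion g F dj Pj c p) uD => D uD.
  by rewrite !mulmxA mulmxK // !mulmxN mulNmx !mulmxA.
- move=> X; rewrite (dd_bar_Omega sc Wp cp) (dd_cG_bar _ sc rp cp) (cG_bar sc rp cp).
  rewrite -(calP_cG sc rp cp) (P_dOm hP sc) //; have o := calP_orth hj CPE sc Wp cp.
  rewrite trmx_mul -!mulmxA (mulmxA (CP p)^T) o mul1mx.
  by rewrite trmx_mul !mulmxA.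
Qed.

End BarTransform.

(** * Principal coordinates and the decomposition theorem *)

Section PrincipalCoordinates.
Context {R : realType} {n : nat} {M : manifold R n}.
Variables (S : setting R) (W : set M) (g : M -> 'M[R]_n).
Variable F : M -> ambient R n S.
Hypothesis lF : lframed W g F.
Variable u : chart R n M.
Hypotheses (su : smooth_chart u) (Wu : W `<=` cdom u).
Local Notation J := (Jmx : 'M[R]_(cdim n S + cdim n S)).
Let fF : framed W g F. Proof. by case: lF. Qed.
Let oW : open W. Proof. by case: fF. Qed.

(** The operators [aop X] of principal coordinates are diagonal, with the
   components of [X] on the diagonal. *)
Definition diagonal_aop : Prop := forall p, W p -> forall i j : 'I_n,
  aop g F u p (basis_vec i) *m basis_vec j = (basis_vec i : 'cV[R]_n) *+ (i == j).

Lemma sff_aop p (Wp : W p) X Y : sff g F u p X Y = J *m (jac u F p *m (aop g F u p X *m Y)).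
Proof.
by rewrite (sffE fF su) ?(sffm_aop lF su) // ?mulmxA //; exact: Wu.
Qed.

Lemma diagonal_of_principal v : principal_coordinates W g F u v -> diagonal_aop.
Proof.
move=> [_ _ h] p Wp i j; have [_ _] := h p Wp i j.
have up := Wu Wp.
rewrite sff_aop // jacE => /(congr1 (mulmx ((jac u F p)^T *m J^T))).
have e (X : 'cV[R]_n) : (jac u F p)^T *m J^T *m (J *m (jac u F p *m X)) = gm g u p *m X.
  have J1 : J^T *m J = 1%:M by rewrite JmxT mulNmx JmxJ opprK.
  by rewrite (gram_frame fF su Wp up) !mulmxA -(mulmxA _ J^T) J1 mulmx1.
rewrite e => h1; apply: (can_inj (mulKmx (gram_unit fF su Wp up))); rewrite h1.
by case: (i == j); rewrite ?mulr1n ?e // !mulr0n !mulmx0.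
Qed.

Definition chart_length (i : 'I_n) (p : M) : R := Num.sqrt (gm g u p i i).

(** The metric is then diagonal, as its products with these operators are
   symmetric. *)
Lemma principal_of_diagonal : diagonal_aop -> principal_coordinates W g F u chart_length.
Proof.
move=> hd; split=> // p Wp i j; have up := Wu Wp.
have gE a b : (gm g u p *m basis_vec b) a 0 = gm g u p a b.
  by rewrite /basis_vec -colE mxE.
have gpos a : 0 < gm g u p a a.
  have dE : dot (basis_vec a) (gm g u p *m basis_vec a) = gm g u p a a.
    by rewrite /dot /basis_vec trmx_delta -colE -rowE !mxE.
  rewrite lt_neqAle -dE; apply/andP; split; last first.
    by rewrite (gram_frame fF su Wp up) -mulmxA -dot_mulmxl dot_ge0.
  apply/negP => /eqP/esym/(gm_pos lF su Wp up) /matrixP/(_ a 0).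
  by rewrite /basis_vec !mxE !eqxx /= => /eqP; rewrite oner_eq0.
split.
- by rewrite /chart_length sqrtr_gt0.
- rewrite gmE /chart_length; have [<-|ij] := eqVneq i j.
    by rewrite mulr1n sqr_sqrtr // ltW.
  have /matrixP/(_ i j) := aop_sym lF su Wp up (basis_vec i).
  have aE b a : (gm g u p *m aop g F u p (basis_vec i)) a b
      = (gm g u p *m (aop g F u p (basis_vec i) *m basis_vec b)) a 0.
    by rewrite mulmxA /basis_vec -colE [in RHS]mxE.
  rewrite mxE !aE !hd // eqxx (negPf ij) mulr1n mulr0n mulmx0 [X in _ = X]mxE gE => e.
  by rewrite mulr0n -[LHS]/((gm g u p) i j) -(gm_sym lF su Wp up) mxE.
- rewrite sff_aop // hd // jacE.
  by case: (i == j); rewrite ?mulr1n // !mulr0n !mulmx0.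
Qed.

Definition ones : 'cV[R]_n := \sum_(i < n) basis_vec i.

Lemma ones_aop : diagonal_aop -> forall p, W p -> aop g F u p ones = 1%:M.
Proof.
move=> hd p Wp; have up := Wu Wp; apply: eq_col_mul => X.
rewrite (aopC lF su Wp up) /ones mulmx_sumr mul1mx.
have XE : X = \sum_(i < n) X i 0 *: basis_vec i.
  by rewrite [LHS]matrix_sum_delta; apply: eq_bigr => i _; rewrite big_ord1.
rewrite [RHS]XE; apply: eq_bigr => j _; rewrite -(aopC lF su Wp up).
rewrite [in LHS]XE mulmx_sumr (bigD1 j) //= big1 ?addr0.
  by rewrite -scalemxAr hd // eqxx mulr1n.
move=> i ij; rewrite -scalemxAr hd //.
by rewrite eq_sym (negPf ij) mulr0n scaler0.
Qed.

Hypothesis k0 : curv S = 0.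
Hypothesis hd : diagonal_aop.
Hypothesis F1 : forall p, W p -> dot (F p) (F p) = 1.

(** A Lagrangian immersion into the unit sphere is orthogonal to its tangent
   spaces; by the Lagrangian condition and the choice of coordinates its
   position vector is [- J F_*] of the sum of the coordinate fields. *)
Lemma position_ones p : W p -> F p = - (J *m (jac u F p *m ones)).
Proof.
move=> Wp; have up := Wu Wp.
have nF q : W q -> (jac u F q)^T *m F q = 0.
  move=> Wq; have uq := Wu Wq; have dF := diffat_F fF su Wq uq.
  have e1 (X : 'cV[R]_n) : (F q)^T *m (jac u F q *m X) = 0.
    have : dd u (fun q => (F q)^T *m F q) q X = 0.
      rewrite (dd_ext _ oW Wq uq (h2 := fun=> 1%:M)) ?dd_cst // => r Wr _.
      by rewrite dotE F1.
    rewrite (dd_mulmx _ uq (diffat_trmx dF) dF) (dd_trmx _ dF) (dd_jac _ dF).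
    rewrite -[X in X + _]trmxK trmx_mul trmxK => /eqP; rewrite addr_eq0 => /eqP.
    exact: mx11_skew.
  rewrite -[LHS]trmxK trmx_mul trmxK; apply/eqP; rewrite trmx_eq0; apply/eqP.
  by apply: eq_col_mul => X; rewrite -mulmxA e1 mul0mx.
have dF := diffat_F fF su Wp up; have dJ := diffat_jac fF su Wp up.
have dT X : (dd u (jac u F) p X)^T *m F p = - (gm g u p *m X).
  have : dd u (fun q => (jac u F q)^T *m F q) p X = 0.
    by rewrite (dd_ext _ oW Wp up (h2 := fun=> 0)) ?dd_cst // => r Wr _; exact: nF.
  rewrite (dd_mulmx _ up (diffat_trmx dJ) dF) (dd_trmx _ dJ) (dd_jac _ dF) mulmxA.
  by rewrite (gram_frame fF su Wp up) => /eqP; rewrite addr_eq0 => /eqP.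
pose y := invmx (gm g u p) *m ((jac u F p)^T *m (J^T *m F p)).
have FE : F p = J *m (jac u F p *m y).
  have := congr1 (mulmx^~ (F p)) (tproj_lagrangian lF su Wp up).
  rewrite mul1mx mulmxDl /tproj k0 scale0r addr0.
  by rewrite -!mulmxA nF // !mulmx0 add0r.
suff yE : y = - ones by rewrite {1}FE yE !mulmxN.
clearbody y; have := dT ones.
have -> : (dd u (jac u F) p ones)^T *m F p = gm g u p *m y.
  rewrite FE -[in RHS](mulmx1 (gm g u p)) -(ones_aop hd Wp) -(aop_sym lF su Wp up).
  by rewrite (gm_aop lF su Wp up) !trmx_mul !trmxK !mulmxA.
by rewrite -mulmxN => /(can_inj (mulKmx (gram_unit fF su Wp up))).
Qed.

Context {l : nat}.
Variable d : ribdata R M (cdim n S + cdim n S) l.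
Variable P : 'M[R]_l.
Hypothesis hP : P_transform W g F d P.

(** Since [calG^t J] restricted to the Lagrangian subspace is [P^t H^t]. *)
Lemma cG_position p : W p -> (cG g F d p)^T *m F p = - (P^T *m jac u (rphi d) p *m ones).
Proof.
move=> Wp; have up := Wu Wp.
have e := GJPi (@JmxJ R (cdim n S)) (@JmxT R (cdim n S)) (tprojT fF su Wp up)
  (tproj_J lF su Wp up) (tproj_cH lF d su Wp up) (cG_cH hP su Wp up).
rewrite {1}(position_ones Wp) mulmxN -(tproj_jac fF su Wp up) !mulmxA e.
by rewrite -(mulmxA P^T _ (jac u F p)) (cH_jac lF d su Wp up).
Qed.

Lemma star_sum v p : (forall i, v i p != 0) -> diffat u (rphi d) p ->
  rphi d p + \sum_(i < n) v i p *:
     (P^T *m ((v i p)^-1 *: Dc u (rphi d) p (basis_vec i)))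
  = rphi d p + P^T *m jac u (rphi d) p *m ones.
Proof.
move=> v0 dphi; congr (_ + _); rewrite /ones mulmx_sumr; apply: eq_bigr => i _.
by rewrite -scalemxAr scalerA mulfV // scale1r ddE (dd_jac _ dphi) mulmxA.
Qed.

End PrincipalCoordinates.

Section Final.

Lemma sum_pair (R : realType) m (A : 'I_2 -> 'M[R]_m) i j :
  i != j -> \sum_(a < 2) A a = A i + A j.
Proof.
move=> ij; rewrite (bigD1 i) //= (bigD1 j) //= 1?eq_sym //= big1 ?addr0 //.
move=> a /andP[ai aj]; exfalso; move: ij ai aj; move: i j a.
by do 3![case; case=> [|[|//]] ?].
Qed.

Lemma jac_ext (R : realType) n (M : manifold R n) m (h1 h2 : M -> 'cV[R]_m)
    (W : set M) c p : open W -> W p -> cdom c p ->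
  (forall q, W q -> h1 q = h2 q) -> jac c h1 p = jac c h2 p.
Proof.
move=> oW Wp cp e; apply/matrixP => a i; rewrite !jac_entry.
by rewrite (dd_ext _ oW Wp cp (fun q Wq _ => e q Wq)).
Qed.

Variables (R : realType) (n : nat) (M : manifold R n) (S : setting R).
Variables (g : M -> 'M[R]_n) (F : M -> ambient R n S).
Variables (k : nat) (d : ribdata R M (cdim n S + cdim n S) k) (P : 'M[R]_k).
Variables (kd : 'I_2 -> nat) (E : forall j : 'I_2, 'M[R]_(k, kd j)).
Variable Pd : forall j : 'I_2, 'M[R]_(kd j).
Hypothesis hE : orthogonal_decomposition E.
Hypothesis hPE : P = direct_sum_endo E Pd.

Let EE j : (E j)^T *m E j = 1%:M. Proof. by case: hE. Qed.
Let Eij i j : i != j -> (E i)^T *m E j = 0. Proof. by case: hE => _ h _; exact: h. Qed.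
Let E1 i j : i != j -> E i *m (E i)^T + E j *m (E j)^T = 1%:M.
Proof. by move=> ij; case: hE => _ _ <-; rewrite (sum_pair _ ij). Qed.

Lemma proj_direct_sum j : (E j)^T *m P = Pd j *m (E j)^T.
Proof.
rewrite hPE /direct_sum_endo mulmx_sumr (bigD1 j) //= big1 ?addr0.
  by rewrite !mulmxA EE mul1mx.
by move=> i ij; rewrite !mulmxA Eij 1?eq_sym // !mul0mx.
Qed.

Lemma direct_sum_incl j : P *m E j = E j *m Pd j.
Proof.
rewrite hPE /direct_sum_endo mulmx_suml (bigD1 j) //= big1 ?addr0.
  by rewrite -!mulmxA EE mulmx1.
by move=> i ij; rewrite -!mulmxA Eij // !mulmx0.
Qed.

Let Fj (j : 'I_2) : M -> ambient R n S := ribaucour g F (sub_data E d j).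
Let gj (j : 'I_2) : M -> 'M[R]_n := induced_metric (Fj j).

Let FjE j p : Fj j p = F p - cG g F (sub_data E d j) p
   *m invmx (rOmega (sub_data E d j) p) *m rphi (sub_data E d j) p.
Proof. by rewrite /Fj /ribaucour cGE. Qed.

Let CPE j p : calP g F (sub_data E d j) p = 1%:M - cG g F (sub_data E d j) p
   *m invmx (rOmega (sub_data E d j) p) *m (cG g F (sub_data E d j) p)^T.
Proof. by rewrite /calP cGE. Qed.

Section OnOpenSet.
Variable W : set M.
Hypothesis hP : P_transform W g F d P.

Lemma sub_data_transform j : P_transform W g F (sub_data E d j) (Pd j).
Proof.
exact: (sub_transform hP (EE j) (proj_direct_sum j) (direct_sum_incl j)
  (ds := sub_data E d j) (fun=> erefl) (fun=> erefl) (fun=> erefl)).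
Qed.

Section Pair.
Variables i j : 'I_2.
Hypothesis ij : i != j.

Let Y p := E i - E j *m (invmx (rOmega (sub_data E d j) p))^T
   *m ((E i)^T *m rOmega d p *m E j)^T.
Let Y' p := E i - E j *m invmx (rOmega (sub_data E d j) p)
   *m ((E j)^T *m rOmega d p *m E i).
Let db := bar_data E g F d i j.

Let phibE p : rphi db p = (Y p)^T *m rphi d p.
Proof.
rewrite /db /Y /= linearB /= !trmx_mul !trmxK mulmxBl.
by rewrite /Omega_block !mulmxA.
Qed.

Let betabE p : rbeta db p = calP g F (sub_data E d j) p *m (rbeta d p *m Y p).
Proof. by rewrite /db /Y /=; congr (_ *m _); rewrite mulmxBr /Omega_block !mulmxA. Qed.

Lemma bar_data_transform :
  P_transform (regular_points W (Fj j)) (gj j) (Fj j) db (Pd i).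
Proof.
exact: (bar_transform hP (EE i) (EE j) (Eij ij) (E1 ij) (proj_direct_sum i)
  (direct_sum_incl i) (proj_direct_sum j) (direct_sum_incl j) (dj := sub_data E d j)
  (fun=> erefl) (fun=> erefl) (fun=> erefl) (FjE j) (CPE j) (Y := Y) (Y' := Y')
  (fun=> erefl) (fun=> erefl) phibE betabE (fun=> erefl)).
Qed.

Lemma ribaucour_compose p : regular_points W (Fj j) p ->
  ribaucour g F d p = ribaucour (gj j) (Fj j) db p.
Proof.
move=> rp; rewrite /ribaucour !cGE; symmetry.
exact: (ribaucour_bar hP (EE i) (EE j) (Eij ij) (E1 ij) (direct_sum_incl i) (proj_direct_sum j) (direct_sum_incl j) (dj := sub_data E d j)
  (fun=> erefl) (fun=> erefl) (fun=> erefl) (FjE j) (CPE j) (Y := Y) (Y' := Y')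
  (fun=> erefl) (fun=> erefl) phibE betabE (fun=> erefl) (smooth_chart_at p) rp
  (chart_at_dom p)).
Qed.

(** The relation [calG^t F = phi] turns the first transform into
   [f_j = calP_j F]; being orthogonal, [calP_j] cancels in the product. *)
Lemma cG_bar_position p : regular_points W (Fj j) p ->
  (cG g F d p)^T *m F p = rphi d p ->
  Fj j p = calP g F (sub_data E d j) p *m F p /\
  (cG (gj j) (Fj j) db p)^T *m Fj j p = rphi db p.
Proof.
move=> rp GF; have [Wp _] := rp; have sc := smooth_chart_at p.
have cp := chart_at_dom p; have hj := sub_data_transform j.
have Gj := cG_sub hP (direct_sum_incl j) (ds := sub_data E d j) (fun=> erefl) (fun=> erefl)
  sc Wp cp.
have FE : Fj j p = calP g F (sub_data E d j) p *m F p.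
  rewrite FjE CPE mulmxBl mul1mx Gj [rphi (sub_data _ _ _) _]/= -GF.
  by rewrite (trmx_mul _ (E j)) !mulmxA.
split => //; have o := calP_orth hj (CPE j) sc Wp cp.
rewrite (cG_bar hP (EE j) (direct_sum_incl i) (proj_direct_sum j) (direct_sum_incl j)
  (dj := sub_data E d j) (fun=> erefl) (fun=> erefl) (fun=> erefl) (FjE j) (CPE j)
  (Y := Y) (Y' := Y') (fun=> erefl) (fun=> erefl) phibE betabE sc rp cp).
rewrite -(calP_cG hP (EE j) (proj_direct_sum j) (direct_sum_incl j)
  (dj := sub_data E d j) (fun=> erefl) (fun=> erefl) (fun=> erefl) (Fj := Fj j) (CPE j)
  (Y := Y) (Y' := Y') (fun=> erefl) (fun=> erefl) sc rp cp).
rewrite FE phibE -GF !trmx_mul -!mulmxA.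
by rewrite (mulmxA (calP _ _ _ _)^T) o mul1mx.
Qed.

End Pair.
End OnOpenSet.

Section Star.
Variables (W : set M) (u : chart R n M).
Hypothesis hs : P_star_transform W g F d P u.

Lemma star_sub j : P_star_transform W g F (sub_data E d j) (Pd j) u.
Proof.
have [hP F1 [v [pv hv]]] := hs; have [su Wu hv0] := pv.
split=> //; first exact: sub_data_transform.
exists v; split => // p Wp.
have sphi : smooth_on W (rphi d) by case: hP => _ [[]].
have hj := sub_data_transform hP j.
have sphij : smooth_on W (rphi (sub_data E d j)) by case: hj => _ [[]].
have up := Wu p Wp; have v0 i : v i p != 0 by have [h _ _] := hv0 p Wp i i; rewrite gt_eqF.
have dphi := smooth_in_diffat (sphi _ su) Wp up.
have dphij := smooth_in_diffat (sphij _ su) Wp up.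
have e := etrans (esym (star_sum _ v0 dphi)) (hv p Wp).
apply: etrans (star_sum _ v0 dphij) _.
rewrite (jac_sub hP (E := E j) (ds := sub_data E d j) (fun=> erefl) su Wp up).
have PT : (Pd j)^T *m (E j)^T = (E j)^T *m P^T by rewrite -!trmx_mul direct_sum_incl.
by rewrite mulmxA PT -!mulmxA -mulmxDr mulmxA e mulmx0.
Qed.

(** The first transform has the same operators [a_X], hence the same principal
   coordinates, and by [cG_position] the condition is the relation of
   [cG_bar_position]. *)
Lemma star_bar i j : i != j -> curv S = 0 ->
  P_star_transform (regular_points W (Fj j)) (gj j) (Fj j) (bar_data E g F d i j) (Pd i) u.
Proof.
move=> ij k0; have [hP F1 [v [pv hv]]] := hs; have [su Wu hv0] := pv.
have lF := ptransform_lframed hP; have hj := sub_data_transform hP j.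
have hd := diagonal_of_principal lF su Wu pv.
have lFj := lframed_transform hj (FjE j) (CPE j).
have Wju : regular_points W (Fj j) `<=` cdom u by move=> p [/Wu].
have hdj : diagonal_aop (regular_points W (Fj j)) (gj j) (Fj j) u.
  move=> p rp a b; rewrite (aop_transform hj (FjE j) (CPE j) su rp (Wju p rp)).
  by apply: hd; case: rp.
have pvj := principal_of_diagonal lFj su Wju hdj.
have hij := bar_data_transform hP ij.
have sphi : smooth_on W (rphi d) by case: hP => _ [[]].
have GF p : W p -> (cG g F d p)^T *m F p = rphi d p.
  move=> Wp; have up := Wu p Wp.
  have v0 i' : v i' p != 0 by have [h _ _] := hv0 p Wp i' i'; rewrite gt_eqF.
  have := hv p Wp; rewrite /= star_sum //; last exact: smooth_in_diffat (sphi _ su) Wp up.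
  rewrite (cG_position lF su Wu k0 hd F1 hP Wp).
  by move/eqP; rewrite addr_eq0 => /eqP ->.
have Fj1 p : regular_points W (Fj j) p -> dot (Fj j p) (Fj j p) = 1.
  move=> rp; have [Wp _] := rp; have [-> _] := cG_bar_position hP i rp (GF p Wp).
  have o := calP_orth hj (CPE j) (smooth_chart_at p) Wp (chart_at_dom p).
  by rewrite dot_mulmxl mulmxA o mul1mx F1.
split=> //; eexists; split; first exact: pvj.
move=> p rp; have [Wp _] := rp; have up := Wju p rp.
have sphib : smooth_on (regular_points W (Fj j)) (rphi (bar_data E g F d i j)).
  by case: hij => _ [[]].
have [_ _ hv1] := pvj.
have vj0 a : chart_length (gj j) u a p != 0.
  by have [h _ _] := hv1 p rp a a; rewrite gt_eqF.
have dphib := smooth_in_diffat (sphib _ su) rp up.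
apply: etrans (star_sum _ vj0 dphib) _.
have [_ e] := cG_bar_position hP i rp (GF p Wp).
have := cG_position lFj su Wju k0 hdj Fj1 hij rp.
by rewrite e => {1}->; rewrite addNr.
Qed.

End Star.

End Final.

Theorem theorem66 (R : realType) (n : nat) (M : manifold R n) (S : setting R)
    (g : M -> 'M[R]_n) (F : M -> ambient R n S)
    (k : nat) (d : ribdata R M (cdim n S + cdim n S) k) (P : 'M[R]_k)
    (kd : 'I_2 -> nat) (E : forall j : 'I_2, 'M[R]_(k, kd j))
    (Pd : forall j : 'I_2, 'M[R]_(kd j))
    (hf : P_transform setT g F d P)
    (hE : orthogonal_decomposition E)
    (hP : P = direct_sum_endo E Pd) :
  let Fj (j : 'I_2) : M -> ambient R n S := ribaucour g F (sub_data E d j) in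
  let Mj (j : 'I_2) : set M := regular_points setT (Fj j) in
  let gj (j : 'I_2) : M -> 'M[R]_n := induced_metric (Fj j) in
  let Fij (i j : 'I_2) : M -> ambient R n S :=
    ribaucour (gj j) (Fj j) (bar_data E g F d i j) in
  (forall j : 'I_2, P_transform setT g F (sub_data E d j) (Pd j)) /\
  (forall i j : 'I_2, i != j ->
     P_transform (Mj j) (gj j) (Fj j) (bar_data E g F d i j) (Pd i)) /\
  (forall i j : 'I_2, i != j ->
     regular_points (Mj j) (Fij i j)
       = Mj j `&` regular_points setT (ribaucour g F d) /\
     forall p, Mj j p -> ribaucour g F d p = Fij i j p) /\
  (S = Lagrangian -> (forall p, dot (F p) (F p) = 1) ->
   forall u : chart R n M, P_star_transform (cdom u) g F d P u ->
     (forall j : 'I_2, P_star_transform (cdom u) g F (sub_data E d j) (Pd j) u) /\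
     (forall i j : 'I_2, i != j ->
        P_star_transform (Mj i `&` cdom u) (gj i) (Fj i)
          (bar_data E g F d j i) (Pd j) u)).
Proof.
move=> Fj Mj gj Fij.
have hsub j : P_transform setT g F (sub_data E d j) (Pd j) := sub_data_transform hE hP hf j.
have hbar i j (ij : i != j) := bar_data_transform hE hP hf ij.
have comp i j (ij : i != j) p (Mp : Mj j p) := ribaucour_compose hE hP hf ij Mp.
split=> //; split=> //; split.
  move=> i j ij; split; last by move=> p Mp; exact: comp.
  have oMj : open (Mj j) by have [[]] := hbar i j ij.
  have dE p : Mj j p -> diffl (ribaucour g F d) p = diffl (Fij i j) p.
    move=> Mp; rewrite /diffl !jacE.
    exact: (jac_ext oMj Mp (chart_at_dom p) (comp i j ij)).
  apply/seteqP; split=> p.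
    move=> [Mp rp]; refine (conj Mp (conj I _)).
    by change (\rank (diffl (ribaucour g F d) p) = n); rewrite (dE p Mp); exact: rp.
  move=> [Mp [_ rp]]; refine (conj Mp _).
  by change (\rank (diffl (Fij i j) p) = n); rewrite -(dE p Mp); exact: rp.
move=> SL F1 u hs; split; first by move=> j; exact: (star_sub hE hP hs).
move=> i j ij; have ji : j != i by rewrite eq_sym.
have -> : Mj i `&` cdom u = regular_points (cdom u) (Fj i).
  by apply/seteqP; split=> p [] => [[_ rp] up|up rp]; split.
by apply: (star_bar hE hP hs ji); rewrite SL.
Qed.
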